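(* Let $(\Gamma,E)$ be a generalised Cartan lattice. Then $(W(\Gamma,E),\mathrm{cox}(\Gamma))$ is a pointed Coxeter group and the map $(\Gamma',E')\mapsto(W(\Gamma',E'),\mathrm{cox}(\Gamma'))$ induces an order preserving bijection between the subobjects of $(\Gamma,E)$ and the subgroups of the pointed Coxeter group $(W(\Gamma,E),\mathrm{cox}(\Gamma))$.
   Context: A bilinear lattice is an abelian group $\Gamma$ with a non-degenerate bilinear form $\langle-,-\rangle\colon\Gamma\times\Gamma\to\mathbb Z$ (i.e. $\langle x,-\rangle=0$ implies $x=0$, and $\langle-,y\rangle=0$ implies $y=0$); its symmetrised form is $(x,y)=\langle x,y\rangle+\langle y,x\rangle$. A root is $a\in\Gamma$ with $\langle a,a\rangle>0$ and $\frac{\langle a,x\rangle}{\langle a,a\rangle},\frac{\langle x,a\rangle}{\langle a,a\rangle}\in\mathbb Z$ for all $x\in\Gamma$; it defines the reflection $s_a(x)=x-2\frac{(x,a)}{(a,a)}a$. An exceptional sequence is a sequence of roots $E=(e_1,\dots,e_r)$ with $\langle e_i,e_j\rangle=0$ for $i>j$; it is complete if it generates $\Gamma$, and orthogonal if $\langle e_i,e_j\rangle\le0$ for $i\ne j$. Write $s_E=s_{e_1}\cdots s_{e_r}$. A generalised Cartan lattice $(\Gamma,E)$ is a bilinear lattice $\Gamma$ with a complete orthogonal exceptional sequence $E=(e_1,\dots,e_n)$. Its Weyl group $W(\Gamma,E)$ is the group generated by $S=\{s_{e_1},\dots,s_{e_n}\}$; $(W(\Gamma,E),S)$ is a Coxeter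 system. Its real roots are $\Phi(\Gamma,E)=\{w(e_i)\mid w\in W(\Gamma,E), 1\le i\le n\}$, and its Coxeter element is $\mathrm{cox}(\Gamma)=s_E$. A real exceptional sequence is a subsequence of a complete exceptional sequence in $\Gamma$ consisting of real roots. A morphism $\phi\colon(\Gamma',E')\to(\Gamma,E)$ is a group homomorphism $\Gamma'\to\Gamma$ preserving the bilinear forms such that $\phi E'$ is a real exceptional sequence in $(\Gamma,E)$; all morphisms are monomorphisms. Subobjects of $(\Gamma,E)$ are equivalence classes of morphisms ending in $(\Gamma,E)$ ($\phi\sim\phi'$ if each factors through the other), ordered by $[\phi]\le[\phi']$ iff $\phi$ factors through $\phi'$. Given such $\phi$, the assignment $s_a\mapsto s_{\phi(a)}$ (for $a\in\Phi(\Gamma',E')$) defines an injective group homomorphism $W(\Gamma',E')\to W(\Gamma,E)$, through which $W(\Gamma',E')$ and $\mathrm{cox}(\Gamma')$ are regarded inside $W(\Gamma,E)$. For a Coxeter system $(W,S)$ a Coxeter element is a product of all elements of $S$, each once, in some order; reflections are the conjugates of elements of $S$; $\ell(w)$ is the minimal number of reflections whose product is $w$; $u\le v$ iff $\ell(u)+\ell(u^{-1}v)=\ell(v)$; and $\mathrm{NC}(W,c)=\{w\in W\mid\mathrm{id}\le w\le c\}$. A pointed Coxeter group is a triple $(W,S,c)$ with $(W,S)$ a Coxeter system and $c$ a Coxeter element. A pointed Coxeter group $(W',S',c')$ is a subgroup of $(W,S,c)$ if $W'$ is a subgroup of $W$ and $\mathrm{NC}(W',c')=\{w\in\mathrm{NC}(W,c)\mid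 w\le c'\}$. The generating set is suppressed: subgroups of a pointed Coxeter group are recorded as pairs $(W',c')$ for which a suitable $S'$ exists (such a pair is determined by $c'$), and are ordered by the relation of being a subgroup. In $(W(\Gamma,E),\mathrm{cox}(\Gamma))$ the suppressed generating set is $S=\{s_{e_1},\dots,s_{e_n}\}$. *)

(* Defs.v *)
From HB Require Import structures.
From mathcomp Require Import all_boot all_order all_algebra.
From mathcomp Require Import boolp classical_sets functions.

Set Implicit Arguments.
Unset Strict Implicit.
Unset Printing Implicit Defensive.

Import Order.TTheory GRing.Theory Num.Theory.
Local Open Scope classical_set_scope.
Local Open Scope ring_scope.

(* All groups are subsets [W : set G] of an ambient group [G], so that the
   Weyl groups of different lattices can be compared as subgroups. *)

Section CoxeterGroups.
Variable G : groupType.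
Implicit Types (W S : set G) (c u v w : G).

Definition subgroup_set (H : set G) : Prop :=
  H 1%g /\ forall x y, H x -> H y -> H (x / y)%g.

Definition gen_subgroup S : set G := smallest subgroup_set S.

Definition prodg (s : seq G) : G := \big[*%g/1%g]_(x <- s) x.

Definition has_order (g : G) (m : nat) : Prop :=
  (0 < m)%N /\ forall k : nat, (g ^+ k)%g = 1%g <-> (m %| k)%N.

(* The congruence on words generated by (st)^m(s,t) = 1, where m(s,t) is the
   order of st, when finite.  The case s = t gives ss = 1, so that the quotient
   of the words in S is already the group presented by S and these relations:
   no formal inverses are needed. *)
Inductive cox_cong S : seq G -> seq G -> Prop :=
| cox_cong_refl (u : seq G) : cox_cong S u u
| cox_cong_sym (u v : seq G) : cox_cong S u v -> cox_cong S v u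
| cox_cong_trans (u v w : seq G) : cox_cong S u v -> cox_cong S v w -> cox_cong S u w
| cox_cong_rel (u v : seq G) (s t : G) (m : nat) : S s -> S t -> has_order (s * t)%g m ->
    cox_cong S (u ++ flatten (nseq m [:: s; t]) ++ v) (u ++ v).

Definition coxeter_system W S : Prop :=
  [/\ W = gen_subgroup S,
      forall s, S s -> has_order s 2
    & forall u v : seq G, [set` u] `<=` S -> [set` v] `<=` S ->
        prodg u = prodg v -> cox_cong S u v].

Definition coxeter_element S c : Prop :=
  exists s : seq G, [/\ uniq s, [set` s] = S & c = prodg s].

Definition pointed_coxeter W S c : Prop :=
  coxeter_system W S /\ coxeter_element S c.

Definition reflections W S : set G :=
  [set (w * s * w^-1)%g | w in W & s in S].

Definition is_refl_length W S w (n : nat) : Prop :=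
  (exists t : seq G,
     [/\ [set` t] `<=` reflections W S, size t = n & prodg t = w]) /\
  (forall t : seq G,
     [set` t] `<=` reflections W S -> prodg t = w -> (n <= size t)%N).

(* The default value is irrelevant: if W is generated by a set S of
   involutions, then every element of W has a length. *)
Definition refl_length W S w : nat := xget 0%N (is_refl_length W S w).

Definition abs_le W S u v : Prop :=
  (refl_length W S u + refl_length W S (u^-1 * v)%g)%N = refl_length W S v.

Definition NC W S c : set G :=
  [set w | [/\ W w, abs_le W S 1%g w & abs_le W S w c]].

Definition pointed_subgroup W' S' c' W S c : Prop :=
  [/\ pointed_coxeter W' S' c', W' `<=` W
    & NC W' S' c' = [set w | NC W S c w /\ abs_le W S w c']].

(* The generating set S' is suppressed. *)
Record pc_subgroup W S c := PCSubgroup {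
  pcs_group : set G;
  pcs_cox : G;
  pcsP : exists S', pointed_subgroup pcs_group S' pcs_cox W S c }.

Definition pc_subgroup_le W S c (p q : pc_subgroup W S c) : Prop :=
  exists S1 S2 : set G,
    [/\ pointed_subgroup (pcs_group p) S1 (pcs_cox p) W S c,
        pointed_subgroup (pcs_group q) S2 (pcs_cox q) W S c
      & pointed_subgroup (pcs_group p) S1 (pcs_cox p)
                         (pcs_group q) S2 (pcs_cox q)].

End CoxeterGroups.

Record zaut (V : zmodType) := ZAut {
  zaut_fun :> V -> V;
  zaut_inv : V -> V;
  zaut_add : {morph zaut_fun : x y / x + y};
  zaut_funK : cancel zaut_fun zaut_inv;
  zaut_invK : cancel zaut_inv zaut_fun }.

Section ZAutGroup.
Variable V : zmodType.
Implicit Types f g h : zaut V.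

Lemma zautP f g : (forall x, f x = g x) -> f = g.
Proof.
case: f g => [f f' fD fK f'K] [g g' gD gK g'K] /= /funext fg; subst g.
have fg' : f' = g' by apply/funext => x; rewrite -[in LHS](g'K x) fK.
by subst g'; congr ZAut; apply: Prop_irrelevance.
Qed.

Definition zaut_one := @ZAut V id id (fun _ _ => erefl) (fun=> erefl) (fun=> erefl).

Fact zaut_mul_add f g : {morph f \o g : x y / x + y}.
Proof. by move=> x y /=; rewrite !zaut_add. Qed.

Definition zaut_mul f g := ZAut (zaut_mul_add f g)
  (can_comp (zaut_funK f) (zaut_funK g)) (can_comp (zaut_invK g) (zaut_invK f)).

Fact zaut_opp_add f : {morph zaut_inv f : x y / x + y}.
Proof.
by move=> x y; apply: (can_inj (zaut_funK f)); rewrite zaut_add !zaut_invK.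
Qed.

Definition zaut_opp f := ZAut (zaut_opp_add f) (zaut_invK f) (zaut_funK f).

HB.instance Definition _ := gen_eqMixin (zaut V).
HB.instance Definition _ := gen_choiceMixin (zaut V).

Fact zaut_mulA : associative zaut_mul. Proof. by move=> f g h; apply: zautP. Qed.
Fact zaut_mul1 : left_id zaut_one zaut_mul. Proof. by move=> f; apply: zautP. Qed.
Fact zaut_1mul : right_id zaut_one zaut_mul. Proof. by move=> f; apply: zautP. Qed.
Fact zaut_mulV : left_inverse zaut_one zaut_opp zaut_mul.
Proof. by move=> f; apply: zautP => x; exact: zaut_funK. Qed.
Fact zaut_Vmul : right_inverse zaut_one zaut_opp zaut_mul.
Proof. by move=> f; apply: zautP => x; exact: zaut_invK. Qed.

HB.instance Definition _ := isGroup.Build (zaut V)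
  zaut_mulA zaut_mul1 zaut_1mul zaut_mulV zaut_Vmul.

End ZAutGroup.

Record bilinear_lattice := BilinearLattice {
  bl_sort :> zmodType;
  bform : bl_sort -> bl_sort -> int;
  bformDl : forall x y z, bform (x + y) z = bform x z + bform y z;
  bformDr : forall x y z, bform x (y + z) = bform x y + bform x z;
  bform_ndl : forall x, (forall y, bform x y = 0) -> x = 0;
  bform_ndr : forall y, (forall x, bform x y = 0) -> y = 0 }.

Section Roots.
Variable L : bilinear_lattice.
Implicit Types a x y : L.

Definition sym_form x y : int := bform x y + bform y x.

Definition is_root a : Prop :=
  0 < bform a a /\
  forall x, (bform a a %| bform a x)%Z /\ (bform a a %| bform x a)%Z.

(* For a root a the integer (a,a) divides 2(x,a), so the division is exact. *)
Definition refl_fun a x : L :=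
  x - a *~ ((2 * sym_form x a) %/ sym_form a a)%Z.

Lemma refl_coefE a x : is_root a ->
  ((2 * sym_form x a) %/ sym_form a a)%Z * bform a a = sym_form x a.
Proof.
case=> a0 aP; have [d1 d2] := aP x.
have dv : (bform a a %| sym_form x a)%Z by rewrite /sym_form rpredD.
have -> : sym_form a a = 2 * bform a a by rewrite mulr_natl mulr2n.
by rewrite divzMpl // divzK.
Qed.

Lemma refl_funD a : is_root a -> {morph refl_fun a : x y / x + y}.
Proof.
move=> ra x y; rewrite /refl_fun addrACA -opprD -mulrzDr.
congr (_ - _ *~ _); have a0 : bform a a != 0 by case: ra => /lt0r_neq0.
apply: (mulIf a0); rewrite [RHS]mulrDl !refl_coefE // /sym_form.
by rewrite bformDl bformDr addrACA.
Qed.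

Lemma bformMzl (x y : L) (n : int) : bform (x *~ n) y = n * bform x y.
Proof.
have f0 : bform 0 y = 0 by apply: (addIr (bform 0 y)); rewrite -bformDl !add0r.
have fN z : bform (- z) y = - bform z y.
  by apply/eqP; rewrite -addr_eq0 -bformDl addNr f0.
elim/int_rect: n => [|n IHn|n IHn]; first by rewrite mulr0z f0 mul0r.
  by rewrite intS mulrzDr mulr1z bformDl IHn mulrDl mul1r.
by rewrite intS opprD mulrzDr mulrN1z bformDl IHn fN mulrDl mulN1r.
Qed.

Lemma bformMzr (x y : L) (n : int) : bform x (y *~ n) = n * bform x y.
Proof.
have f0 : bform x 0 = 0 by apply: (addIr (bform x 0)); rewrite -bformDr !add0r.
have fN z : bform x (- z) = - bform x z.
  by apply/eqP; rewrite -addr_eq0 -bformDr addNr f0.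
elim/int_rect: n => [|n IHn|n IHn]; first by rewrite mulr0z f0 mul0r.
  by rewrite intS mulrzDr mulr1z bformDr IHn mulrDl mul1r.
by rewrite intS opprD mulrzDr mulrN1z bformDr IHn fN mulrDl mulN1r.
Qed.

Lemma refl_funK a : is_root a -> involutive (refl_fun a).
Proof.
move=> ra x; have a0 : bform a a != 0 by case: ra => /lt0r_neq0.
set k := ((2 * sym_form x a) %/ sym_form a a)%Z.
have kE : k * bform a a = sym_form x a := refl_coefE x ra.
suff E : ((2 * sym_form (refl_fun a x) a) %/ sym_form a a)%Z = - k.
  by rewrite {1}/refl_fun E mulrNz opprK subrK.
apply: (mulIf a0); rewrite refl_coefE // /refl_fun -/k -mulrNz.
rewrite /sym_form bformDl bformDr bformMzl bformMzr addrACA.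
by rewrite -/(sym_form x a) -kE -!mulrDl addrA subrr add0r.
Qed.

Definition refl_aut a (ra : is_root a) : zaut L :=
  ZAut (refl_funD ra) (refl_funK ra) (refl_funK ra).

(* The reflection s_a as an automorphism; only used when a is a root. *)
Definition refl a : zaut L :=
  if pselect (is_root a) is left ra then refl_aut ra else 1%g.

Definition exceptional (E : seq L) : Prop :=
  (forall a, a \in E -> is_root a) /\
  forall i j, (j < i < size E)%N -> bform E`_i E`_j = 0.

Definition complete_exceptional (E : seq L) : Prop :=
  exceptional E /\ forall x : L, inIntSpan (in_tuple E) x.

Definition orthogonal_seq (E : seq L) : Prop :=
  forall i j, (i < size E)%N -> (j < size E)%N -> i != j -> bform E`_i E`_j <= 0.

End Roots.

Record cartan_lattice := CartanLattice {
  cl_lattice :> bilinear_lattice;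
  cl_seq : seq cl_lattice;
  cl_complete : complete_exceptional cl_seq;
  cl_orthogonal : orthogonal_seq cl_seq }.

Section WeylGroup.
Variable C : cartan_lattice.

Definition simple_refl : set (zaut C) := [set refl e | e in [set` cl_seq C]].

Definition weyl : set (zaut C) := gen_subgroup simple_refl.

Definition real_root : set C :=
  [set a | exists w e, [/\ weyl w, e \in cl_seq C & a = w e]].

Definition cox : zaut C := prodg [seq refl e | e <- cl_seq C].

Definition real_exceptional (F : seq C) : Prop :=
  exists E : seq C, [/\ complete_exceptional E,
    forall a, a \in E -> real_root a & subseq F E].

End WeylGroup.

Record cl_morphism (C' C : cartan_lattice) := CLMorphism {
  clm_fun :> C' -> C;
  clm_add : {morph clm_fun : x y / x + y};
  clm_form : forall x y, bform (clm_fun x) (clm_fun y) = bform x y;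
  clm_real : real_exceptional (map clm_fun (cl_seq C')) }.

(* [weyl_map phi] is, on W(C'), the homomorphism W(C') -> W(C) mapping
   s_a to s_(phi a) for every real root a.  It is determined there by these
   conditions, since W(C') is generated by such s_a; its values elsewhere are
   irrelevant. *)
Definition is_weyl_map (C' C : cartan_lattice) (phi : cl_morphism C' C)
    (h : zaut C' -> zaut C) : Prop :=
  [/\ forall u, weyl u -> weyl (h u),
      forall u v, weyl u -> weyl v -> h (u * v)%g = (h u * h v)%g
    & forall a, real_root a -> h (refl a) = refl (phi a)].

Definition weyl_map (C' C : cartan_lattice) (phi : cl_morphism C' C) :
    zaut C' -> zaut C :=
  xget (fun=> 1%g) (is_weyl_map phi).

Record mor_to (C : cartan_lattice) := MorTo {
  mor_dom : cartan_lattice;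
  mor_arrow :> cl_morphism mor_dom C }.

Section Subobjects.
Variable C : cartan_lattice.

Definition factors_through (p q : mor_to C) : Prop :=
  exists psi : cl_morphism (mor_dom p) (mor_dom q), forall x, p x = q (psi x).

(* Plain predicates: [mor_to C] is too large a type for [set]. *)
Definition sub_class (p : mor_to C) : mor_to C -> Prop :=
  fun q => factors_through p q /\ factors_through q p.

Record subobject := Subobject {
  sub_mem : mor_to C -> Prop;
  sub_memP : exists p, sub_mem = sub_class p }.

Definition subobject_of (p : mor_to C) : subobject :=
  Subobject (ex_intro _ p erefl).

Definition subobject_le (X Y : subobject) : Prop :=
  exists p q : mor_to C,
    [/\ X = subobject_of p, Y = subobject_of q & factors_through p q].

(* W(C') and cox(C'), regarded inside W(C). *)
Definition weyl_in (p : mor_to C) : set (zaut C) :=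
  weyl_map p @` @weyl (mor_dom p).

Definition cox_in (p : mor_to C) : zaut C := weyl_map p (cox (mor_dom p)).

End Subobjects.

Arguments weyl C : clear implicits.
Arguments simple_refl C : clear implicits.

(* Main.v *)
Require Import Defs.
From HB Require Import structures.
From mathcomp Require Import all_boot all_order all_algebra all_field.
From mathcomp Require Import boolp classical_sets functions.
From mathcomp Require Import zify ring lra.

(* Real roots are positive or negative; this gives the Coxeter presentation of
   W, the exchange property, and (pushing down the peaks of a path in the
   Bruhat graph) the transitivity of the Hurwitz action on the factorizations
   of the Coxeter element into rank-many reflections.  Hence the noncrossing
   elements are the products of initial parts F of such factorizations F ++ X,
   viewed as sequences of positive roots.

   The heart of the matter is that the product of F determines F up to Hurwitz
   moves and signs.  Positive roots occurring in such factorizations are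
   dimension vectors of exceptional representations of a species over finite
   fields, and Hurwitz moves are mutations.  Reducing the total height by
   mutations, every F becomes orthogonal; the representations realising an
   orthogonal F are then the simple objects of the right perpendicular category
   of X, so their classes are determined by X.

   Consequently cox(Gamma') determines the subobject Gamma' and its real roots,
   and the interval below cox(Gamma') in NC(W, c) only involves reflections at
   real roots of Gamma'.  Conversely, if (W', c') is a subgroup, then c' is
   noncrossing, and an orthogonal F with product c' spans a subobject with the
   same noncrossing partitions.  A Coxeter element of an abstract Coxeter group
   has reflection length the number of simple reflections (a rank count in a
   geometric representation), so simple reflections are noncrossing, and both
   groups are generated by their noncrossing partitions. *)

Set Implicit Arguments.
Unset Strict Implicit.
Unset Printing Implicit Defensive.

Import Order.TTheory GRing.Theory Num.Theory.
Local Open Scope classical_set_scope.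
Local Open Scope ring_scope.

(** * Representations of species *)

(** Real exceptional sequences are defined by vanishing values of the form, whereas subgroups only
    know products of reflections. One translation is formal: by Serre duality on a span, the product
    of the reflections depends on the span only. The converse, from a factorization of the Coxeter
    element to vanishing values, is where representations enter: the simple roots are realised by
    simple representations, and mutations carry this along the Hurwitz orbit. Classes of
    representations have nonnegative coordinates, which settles the sign in each move and supplies
    positivity that the form alone does not show in infinite type. The fields at the vertices have
    degrees [bform (e i) (e i)], which differ, so [dd] is linear over the prime field only. With
    finite fields, cardinalities of finite sets replace ranks; the prime 2 is an arbitrary choice.
    Hom and Ext are never formed as spaces: only their vanishing is used, and its behaviour in short
    exact sequences is checked on cochains. Two sequences F and G with equal products are compared
    inside the whole lattice, by completing both with the same tail X. *)

Section MatrixFacts.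
Variable F : fieldType.

Lemma exact_factor a b c m (al : 'M[F]_(a, b)) (be : 'M[F]_(b, c)) (g : 'M[F]_(m, b)) :
  row_free al -> row_full be -> al *m be = 0 -> b = (a + c)%N -> g *m be = 0 ->
  exists h, g = h *m al.
Proof.
move=> fa fb ab0 dim gb0; apply/submxP.
have s1 : (al <= kermx be)%MS by apply/sub_kermxP.
have s2 : (g <= kermx be)%MS by apply/sub_kermxP.
apply: (submx_trans s2).
have := mxrank_leqif_sup s1; case=> _ <-.
by rewrite mxrank_ker (eqP fa) (eqP fb) dim addnK.
Qed.

Lemma exact_cofactor a b c m (al : 'M[F]_(a, b)) (be : 'M[F]_(b, c)) (g : 'M[F]_(b, m)) :
  row_free al -> row_full be -> al *m be = 0 -> b = (a + c)%N -> al *m g = 0 ->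
  exists h, g = be *m h.
Proof.
move=> fa fb ab0 dim ag0.
have [|||||h Hh] := @exact_factor c b a m be^T al^T g^T.
- by rewrite /row_free mxrank_tr; exact: fb.
- by rewrite /row_full mxrank_tr; exact: fa.
- by rewrite -trmx_mul ab0 trmx0.
- by rewrite addnC.
- by rewrite -trmx_mul ag0 trmx0.
by exists h^T; apply: trmx_inj; rewrite Hh trmx_mul trmxK.
Qed.

End MatrixFacts.

(* The bimodule of an arrow a is the field L_a itself, a common extension of the fields at its
   two ends; a representation assigns to a a matrix over L_a. *)
Record species := Species {
  sI : finType; sA : finType; src : sA -> sI; tgt : sA -> sI;
  sK : sI -> finFieldType; sL : sA -> finFieldType;
  semb : forall a, {rmorphism sK (src a) -> sL a};
  temb : forall a, {rmorphism sK (tgt a) -> sL a};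
  dK : sI -> nat; dL : sA -> nat;
  cardK : forall i, #|sK i| = (2 ^ dK i)%N;
  cardL : forall a, #|sL a| = (2 ^ dL a)%N }.

Definition opS (Q : species) : species :=
  Species (@temb Q) (@semb Q) (@cardK Q) (@cardL Q).

Section Reps.
Variable Q : species.
Notation I := (sI Q).
Notation A := (sA Q).
Notation K := (@sK Q).
Notation L := (@sL Q).

Record rep := Rep {
  rdim :> I -> nat;
  ract : forall a : A, 'M[L a]_(rdim (src a), rdim (tgt a)) }.

(** The terms of the two-term complex behind Hom and Ext^1. They depend on dimension vectors only,
    so they accept arbitrary functions on the vertices. *)
Definition C0 (v w : I -> nat) := forall i, 'M[K i]_(v i, w i).
Definition C1 (v w : I -> nat) := forall a : A, 'M[L a]_(v (src a), w (tgt a)).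

Definition em_s v w (f : C0 v w) a : 'M[L a]_(v (src a), w (src a)) :=
  map_mx (@semb Q a) (f (src a)).
Definition em_t v w (f : C0 v w) a : 'M[L a]_(v (tgt a), w (tgt a)) :=
  map_mx (@temb Q a) (f (tgt a)).

Definition cmp u v w (f : C0 u v) (g : C0 v w) : C0 u w := fun i => f i *m g i.
Definition lact u v w (f : C0 u v) (x : C1 v w) : C1 u w := fun a => em_s f a *m x a.
Definition ractn u v w (x : C1 u v) (f : C0 v w) : C1 u w := fun a => x a *m em_t f a.

(* Its kernel is Hom(V, W) and its cokernel is Ext^1(V, W). *)
Definition dd (V W : rep) (f : C0 V W) : C1 V W :=
  fun a => em_s f a *m ract W a - ract V a *m em_t f a.

Definition add0 u v (f g : C0 u v) : C0 u v := fun i => f i + g i.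
Definition opp0 u v (f : C0 u v) : C0 u v := fun i => - f i.
Definition add1 u v (f g : C1 u v) : C1 u v := fun i => f i + g i.
Definition opp1 u v (f : C1 u v) : C1 u v := fun i => - f i.
Definition zero0 u v : C0 u v := fun i => 0.
Definition zero1 u v : C1 u v := fun i => 0.
Definition one0 u : C0 u u := fun i => 1%:M.

Lemma C0E u v (f g : C0 u v) : (forall i, f i = g i) -> f = g.
Proof. exact: functional_extensionality_dep. Qed.
Lemma C1E u v (f g : C1 u v) : (forall i, f i = g i) -> f = g.
Proof. exact: functional_extensionality_dep. Qed.

Lemma em_s_cmp u v w (f : C0 u v) (g : C0 v w) a :
  em_s (cmp f g) a = em_s f a *m em_s g a.
Proof. by rewrite /em_s map_mxM. Qed.
Lemma em_t_cmp u v w (f : C0 u v) (g : C0 v w) a :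
  em_t (cmp f g) a = em_t f a *m em_t g a.
Proof. by rewrite /em_t map_mxM. Qed.

Lemma dd_cmp (U V W : rep) (f : C0 U V) (g : C0 V W) :
  dd (V:=U) (W:=W) (cmp f g) = add1 (ractn (dd f) g) (lact f (dd g)).
Proof.
apply: C1E => a; rewrite /dd /add1 /ractn /lact em_s_cmp em_t_cmp.
by rewrite mulmxBl mulmxBr !mulmxA [RHS]addrC addrA subrK.
Qed.

Lemma dd_add (V W : rep) (f g : C0 V W) : dd (V:=V) (W:=W) (add0 f g) = add1 (dd f) (dd g).
Proof.
apply: C1E => a; rewrite /dd /add1 /em_s /em_t !map_mxD mulmxDl mulmxDr.
by rewrite opprD addrACA.
Qed.
Lemma dd_opp (V W : rep) (f : C0 V W) : dd (V:=V) (W:=W) (opp0 f) = opp1 (dd f).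
Proof.
by apply: C1E => a; rewrite /dd /opp1 /em_s /em_t !map_mxN mulNmx mulmxN opprB opprK addrC.
Qed.
Lemma dd_one (V : rep) : dd (V:=V) (W:=V) (one0 V) = zero1 _ _.
Proof. by apply: C1E => a; rewrite /dd /em_s /em_t !map_mx1 mul1mx mulmx1 subrr. Qed.

Definition ishom (V W : rep) (f : C0 V W) := dd f = zero1 V W.
Definition Hom0 (V W : rep) := forall f : C0 V W, ishom f -> f = zero0 V W.
Definition Ext0 (V W : rep) := forall x : C1 V W, exists f : C0 V W, dd f = x.
Definition perp (V W : rep) := Hom0 V W /\ Ext0 V W.

Definition mono u v (f : C0 u v) := forall i, row_free (f i).
Definition epi u v (f : C0 u v) := forall i, row_full (f i).

(** Exactness in the middle is encoded by [ses_dim]: together with the other fields, the count of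
    dimensions forces the image of [al] to be the kernel of [be]. *)
Record ses (X Y Z : rep) (al : C0 X Y) (be : C0 Y Z) : Prop := Ses {
  ses_homl : ishom al; ses_homr : ishom be;
  ses_mono : mono al; ses_epi : epi be;
  ses_0 : cmp al be = zero0 X Z;
  ses_dim : forall i, rdim Y i = (rdim X i + rdim Z i)%N }.

Lemma lactA t u v w (f : C0 t u) (g : C0 u v) (x : C1 v w) :
  lact f (lact g x) = lact (cmp f g) x.
Proof. by apply: C1E => a; rewrite /lact em_s_cmp mulmxA. Qed.
Lemma ractA t u v w (x : C1 t u) (f : C0 u v) (g : C0 v w) :
  ractn (ractn x f) g = ractn x (cmp f g).
Proof. by apply: C1E => a; rewrite /ractn em_t_cmp mulmxA. Qed.
Lemma lractA t u v w (f : C0 t u) (x : C1 u v) (g : C0 v w) :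
  ractn (lact f x) g = lact f (ractn x g).
Proof. by apply: C1E => a; rewrite /ractn /lact mulmxA. Qed.
Lemma lact1 u v (x : C1 u v) : lact (one0 u) x = x.
Proof. by apply: C1E => a; rewrite /lact /em_s map_mx1 mul1mx. Qed.
Lemma ract1 u v (x : C1 u v) : ractn x (one0 v) = x.
Proof. by apply: C1E => a; rewrite /ractn /em_t map_mx1 mulmx1. Qed.
Lemma lact_x0 u v w (f : C0 u v) : lact f (zero1 v w) = zero1 u w.
Proof. by apply: C1E => a; rewrite /lact mulmx0. Qed.
Lemma ract_0x u v w (f : C0 v w) : ractn (zero1 u v) f = zero1 u w.
Proof. by apply: C1E => a; rewrite /ractn mul0mx. Qed.
Lemma lact_0x u v w (x : C1 v w) : lact (zero0 u v) x = zero1 u w.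
Proof. by apply: C1E => a; rewrite /lact /em_s map_mx0 mul0mx. Qed.
Lemma ract_x0 u v w (x : C1 u v) : ractn x (zero0 v w) = zero1 u w.
Proof. by apply: C1E => a; rewrite /ractn /em_t map_mx0 mulmx0. Qed.
Lemma add1x0 u v (x : C1 u v) : add1 x (zero1 u v) = x.
Proof. by apply: C1E => a; rewrite /add1 addr0. Qed.
Lemma add10x u v (x : C1 u v) : add1 (zero1 u v) x = x.
Proof. by apply: C1E => a; rewrite /add1 add0r. Qed.
Lemma ract_add u v w (x y : C1 u v) (f : C0 v w) :
  ractn (add1 x y) f = add1 (ractn x f) (ractn y f).
Proof. by apply: C1E => a; rewrite /ractn mulmxDl. Qed.
Lemma ract_opp u v w (x : C1 u v) (f : C0 v w) : ractn (opp1 x) f = opp1 (ractn x f).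
Proof. by apply: C1E => a; rewrite /ractn mulNmx. Qed.
Lemma lact_add u v w (f : C0 u v) (x y : C1 v w) :
  lact f (add1 x y) = add1 (lact f x) (lact f y).
Proof. by apply: C1E => a; rewrite /lact mulmxDr. Qed.
Lemma lact_opp u v w (f : C0 u v) (x : C1 v w) : lact f (opp1 x) = opp1 (lact f x).
Proof. by apply: C1E => a; rewrite /lact mulmxN. Qed.
Lemma add1N u v (x : C1 u v) : add1 x (opp1 x) = zero1 u v.
Proof. by apply: C1E => a; rewrite /add1 addrN. Qed.
Lemma cmpA t u v w (f : C0 t u) (g : C0 u v) (h : C0 v w) : cmp f (cmp g h) = cmp (cmp f g) h.
Proof. by apply: C0E => i; rewrite /cmp mulmxA. Qed.
Lemma cmp1x u v (f : C0 u v) : cmp (one0 u) f = f.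
Proof. by apply: C0E => i; rewrite /cmp mul1mx. Qed.
Lemma cmpx1 u v (f : C0 u v) : cmp f (one0 v) = f.
Proof. by apply: C0E => i; rewrite /cmp mulmx1. Qed.
Lemma cmp0x u v w (f : C0 v w) : cmp (zero0 u v) f = zero0 u w.
Proof. by apply: C0E => i; rewrite /cmp mul0mx. Qed.
Lemma cmpx0 u v w (f : C0 u v) : cmp f (zero0 v w) = zero0 u w.
Proof. by apply: C0E => i; rewrite /cmp mulmx0. Qed.
Lemma cmp_addl u v w (f g : C0 u v) (h : C0 v w) : cmp (add0 f g) h = add0 (cmp f h) (cmp g h).
Proof. by apply: C0E => i; rewrite /cmp mulmxDl. Qed.
Lemma cmp_addr u v w (f : C0 u v) (g h : C0 v w) : cmp f (add0 g h) = add0 (cmp f g) (cmp f h).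
Proof. by apply: C0E => i; rewrite /cmp mulmxDr. Qed.
Lemma cmp_oppl u v w (f : C0 u v) (h : C0 v w) : cmp (opp0 f) h = opp0 (cmp f h).
Proof. by apply: C0E => i; rewrite /cmp mulNmx. Qed.
Lemma cmp_oppr u v w (f : C0 u v) (h : C0 v w) : cmp f (opp0 h) = opp0 (cmp f h).
Proof. by apply: C0E => i; rewrite /cmp mulmxN. Qed.

Lemma hom_cmp (U V W : rep) (f : C0 U V) (g : C0 V W) :
  ishom f -> ishom g -> ishom (V:=U) (W:=W) (cmp f g).
Proof. by move=> hf hg; rewrite /ishom dd_cmp hf hg ract_0x lact_x0 add1x0. Qed.
Lemma hom_zero (V W : rep) : ishom (V:=V) (W:=W) (zero0 V W).
Proof. by apply: C1E => a; rewrite /dd /em_s /em_t !map_mx0 mul0mx mulmx0 subr0. Qed.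

Lemma dd_cmp_homr (U V W : rep) (f : C0 U V) (g : C0 V W) : ishom g ->
  dd (V:=U) (W:=W) (cmp f g) = ractn (dd f) g.
Proof. by move=> hg; rewrite dd_cmp hg lact_x0 add1x0. Qed.
Lemma dd_cmp_homl (U V W : rep) (f : C0 U V) (g : C0 V W) : ishom f ->
  dd (V:=U) (W:=W) (cmp f g) = lact f (dd g).
Proof. by move=> hg; rewrite dd_cmp hg ract_0x add10x. Qed.

Lemma mono_cmp_inj u v w (al : C0 v w) (f g : C0 u v) : mono al -> cmp f al = cmp g al -> f = g.
Proof.
move=> mal fg; apply: C0E => i; apply: (row_free_inj (mal i)).
by rewrite -[LHS]/(cmp f al i) fg.
Qed.
Lemma mono_ract_inj u v w (al : C0 v w) (x y : C1 u v) : mono al -> ractn x al = ractn y al -> x = y.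
Proof.
move=> mal fg; apply: C1E => a.
have ra : row_free (em_t al a) by rewrite /em_t row_free_map; apply: mal.
by apply: (row_free_inj ra); rewrite -[LHS]/(ractn x al a) fg.
Qed.

Lemma epi_section v w (be : C0 v w) : epi be -> exists s : C0 w v, cmp s be = one0 w.
Proof.
move=> eb; have P i : {s | s *m be i = 1%:M}.
  by apply: cid; apply/row_fullP; apply: eb.
by exists (fun i => sval (P i)); apply: C0E => i; rewrite /cmp (svalP (P i)).
Qed.

Lemma mono_retract v w (al : C0 v w) : mono al -> exists s : C0 w v, cmp al s = one0 v.
Proof.
move=> ma; have P i : {s | al i *m s = 1%:M}.
  by apply: cid; apply/row_freeP; apply: ma.
by exists (fun i => sval (P i)); apply: C0E => i; rewrite /cmp (svalP (P i)).
Qed.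

(** * The long exact Hom-Ext sequences, piece by piece *)

Section SES.
Variables (X Y Z : rep) (al : C0 X Y) (be : C0 Y Z).
Hypothesis S : ses al be.

Lemma ses_0i i : al i *m be i = 0.
Proof. by rewrite -[LHS]/(cmp al be i) (ses_0 S). Qed.

Lemma ses_fac0 u (g : C0 u Y) : cmp g be = zero0 u Z -> exists h : C0 u X, g = cmp h al.
Proof.
move=> g0; have P i : {h | g i = h *m al i}.
  apply: cid; apply: (exact_factor (ses_mono S i) (ses_epi S i) (ses_0i i) (ses_dim S i)).
  by rewrite -[LHS]/(cmp g be i) g0.
by exists (fun i => sval (P i)); apply: C0E => i; rewrite /cmp -(svalP (P i)).
Qed.

Lemma ses_cofac0 u (g : C0 Y u) : cmp al g = zero0 X u -> exists h : C0 Z u, g = cmp be h.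
Proof.
move=> g0; have P i : {h | g i = be i *m h}.
  apply: cid; apply: (exact_cofactor (ses_mono S i) (ses_epi S i) (ses_0i i) (ses_dim S i)).
  by rewrite -[LHS]/(cmp al g i) g0.
by exists (fun i => sval (P i)); apply: C0E => i; rewrite /cmp -(svalP (P i)).
Qed.

Lemma ses_fac1 u (g : C1 u Y) : ractn g be = zero1 u Z -> exists h : C1 u X, g = ractn h al.
Proof.
move=> g0; have P a : {h | g a = h *m em_t al a}.
  apply: cid; apply: (@exact_factor _ _ _ _ _ (em_t al a) (em_t be a) (g a)).
  - by rewrite /em_t row_free_map; apply: (ses_mono S).
  - by rewrite /em_t row_full_map; apply: (ses_epi S).
  - by rewrite -em_t_cmp (ses_0 S) /em_t map_mx0.
  - exact: (ses_dim S).
  - by rewrite -[LHS]/(ractn g be a) g0.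
by exists (fun i => sval (P i)); apply: C1E => i; rewrite /ractn -(svalP (P i)).
Qed.

Lemma ses_cofac1 u (g : C1 Y u) : lact al g = zero1 X u -> exists h : C1 Z u, g = lact be h.
Proof.
move=> g0; have P a : {h | g a = em_s be a *m h}.
  apply: cid; apply: (@exact_cofactor _ _ _ _ _ (em_s al a) (em_s be a) (g a)).
  - by rewrite /em_s row_free_map; apply: (ses_mono S).
  - by rewrite /em_s row_full_map; apply: (ses_epi S).
  - by rewrite -em_s_cmp (ses_0 S) /em_s map_mx0.
  - exact: (ses_dim S).
  - by rewrite -[LHS]/(lact al g a) g0.
by exists (fun i => sval (P i)); apply: C1E => i; rewrite /lact -(svalP (P i)).
Qed.

Lemma epi_lift0 u (g : C0 u Z) : exists h : C0 u Y, cmp h be = g.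
Proof.
have [s hs] := epi_section (ses_epi S).
by exists (cmp g s); rewrite -cmpA hs cmpx1.
Qed.
Lemma epi_lift1 u (g : C1 u Z) : exists h : C1 u Y, ractn h be = g.
Proof.
have [s hs] := epi_section (ses_epi S).
by exists (ractn g s); rewrite ractA hs ract1.
Qed.
Lemma mono_ext0 u (g : C0 X u) : exists h : C0 Y u, cmp al h = g.
Proof.
have [s hs] := mono_retract (ses_mono S).
by exists (cmp s g); rewrite cmpA hs cmp1x.
Qed.
Lemma mono_ext1 u (g : C1 X u) : exists h : C1 Y u, lact al h = g.
Proof.
have [s hs] := mono_retract (ses_mono S).
by exists (lact s g); rewrite lactA hs lact1.
Qed.

Lemma mono_facl_hom (U : rep) (h : C0 U X) : ishom (V:=U) (W:=Y) (cmp h al) -> ishom (V:=U) (W:=X) h.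
Proof.
rewrite /ishom dd_cmp_homr; last exact: ses_homl S.
by move=> H; apply: (mono_ract_inj (ses_mono S)); rewrite H ract_0x.
Qed.

Lemma epi_lact_inj u (x y : C1 Z u) : lact be x = lact be y -> x = y.
Proof.
have [s hs] := epi_section (ses_epi S).
by move=> /(congr1 (lact s)); rewrite !lactA hs !lact1.
Qed.
Lemma epi_cmp_inj u (x y : C0 Z u) : cmp be x = cmp be y -> x = y.
Proof.
have [s hs] := epi_section (ses_epi S).
by move=> /(congr1 (cmp s)); rewrite !cmpA hs !cmp1x.
Qed.

Lemma epi_facr_hom (U : rep) (h : C0 Z U) : ishom (V:=Y) (W:=U) (cmp be h) -> ishom (V:=Z) (W:=U) h.
Proof.
rewrite /ishom dd_cmp_homl; last exact: ses_homr S.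
by move=> H; apply: epi_lact_inj; rewrite H lact_x0.
Qed.

(** The complex has no term after [C1], so Ext^2 vanishes and Ext^1 is right exact: every 1-cochain
    is a cocycle and lifts along the epimorphism. *)
Lemma cov_ext_epi U : Ext0 U Y -> Ext0 U Z.
Proof.
move=> E x; have [y <-] := epi_lift1 x; have [f <-] := E y.
by exists (cmp f be); rewrite dd_cmp_homr //; exact: ses_homr S.
Qed.
Lemma con_ext_mono U : Ext0 Y U -> Ext0 X U.
Proof.
move=> E x; have [y <-] := mono_ext1 x; have [f <-] := E y.
by exists (cmp al f); rewrite dd_cmp_homl //; exact: ses_homl S.
Qed.
Lemma cov_hom_mono U : Hom0 U Y -> Hom0 U X.
Proof.
move=> E f hf; have := E (cmp f al); rewrite /ishom dd_cmp_homr ?hf ?ract_0x //; last exact: ses_homl S.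
by move=> /(_ erefl) H; apply: (mono_cmp_inj (ses_mono S)); rewrite H cmp0x.
Qed.
Lemma con_hom_epi U : Hom0 Y U -> Hom0 Z U.
Proof.
move=> E f hf; have := E (cmp be f); rewrite /ishom dd_cmp_homl ?hf ?lact_x0 //; last exact: ses_homr S.
by move=> /(_ erefl) H; apply: epi_cmp_inj; rewrite H cmpx0.
Qed.
(** The connecting homomorphism in disguise: a graded lift of [g] fails to be a morphism by a
    cochain with values in X, and Ext(U, X) = 0 allows a correction of the lift. *)
Lemma cov_hom_quot U : Hom0 U Y -> Ext0 U X -> Hom0 U Z.
Proof.
move=> HY EX g hg; have [h hh] := epi_lift0 g.
have : ractn (dd (V:=U) (W:=Y) h) be = zero1 _ _.
  by rewrite -dd_cmp_homr ?hh //; exact: ses_homr S.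
move=> /ses_fac1 [z hz]; have [k hk] := EX z.
have hom : ishom (V:=U) (W:=Y) (add0 h (opp0 (cmp k al))).
  rewrite /ishom dd_add dd_opp dd_cmp_homr ?hk -?hz ?add1N //; exact: ses_homl S.
have := HY _ hom; rewrite -hh => /(congr1 (fun x => cmp x be)).
by rewrite cmp_addl cmp_oppl -cmpA (ses_0 S) cmpx0 cmp0x => <-; apply: C0E => i; rewrite /add0 /opp0 /zero0 oppr0 addr0.
Qed.
Lemma cov_ext_sub U : Ext0 U Y -> Hom0 U Z -> Ext0 U X.
Proof.
move=> EY HZ z; have [g hg] := EY (ractn z al).
have : ishom (V:=U) (W:=Z) (cmp g be).
  by rewrite /ishom dd_cmp_homr ?hg ?ractA ?(ses_0 S) ?ract_x0 //; exact: ses_homr S.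
move=> /HZ /ses_fac0 [h hh]; exists h; apply: (mono_ract_inj (ses_mono S)).
by rewrite -hg hh dd_cmp_homr //; exact: ses_homl S.
Qed.
Lemma cov_hom_mid U : Hom0 U X -> Hom0 U Z -> Hom0 U Y.
Proof.
move=> HX HZ g hg.
have : ishom (V:=U) (W:=Z) (cmp g be) by apply: hom_cmp => //; exact: ses_homr S.
move=> /HZ /ses_fac0 [h hh]; rewrite hh in hg *; have := mono_facl_hom hg.
by move/HX => ->; rewrite cmp0x.
Qed.
Lemma cov_ext_mid U : Ext0 U X -> Ext0 U Z -> Ext0 U Y.
Proof.
move=> EX EZ x; have [f hf] := EZ (ractn x be); have [h hh] := epi_lift0 f.
have : ractn (add1 x (opp1 (dd (V:=U) (W:=Y) h))) be = zero1 _ _.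
  rewrite ract_add ract_opp -dd_cmp_homr ?hh ?hf ?add1N //; exact: ses_homr S.
move=> /ses_fac1 [z hz]; have [k hk] := EX z.
exists (add0 h (cmp k al)); rewrite dd_add dd_cmp_homr ?hk -?hz; last exact: ses_homl S.
by apply: C1E => a; rewrite /add1 /opp1 addrC subrK.
Qed.
Lemma con_hom_mid U : Hom0 X U -> Hom0 Z U -> Hom0 Y U.
Proof.
move=> HX HZ g hg.
have : ishom (V:=X) (W:=U) (cmp al g) by apply: hom_cmp => //; exact: ses_homl S.
move=> /HX /ses_cofac0 [h hh]; rewrite hh in hg *; have := epi_facr_hom hg.
by move/HZ => ->; rewrite cmpx0.
Qed.
Lemma con_ext_mid U : Ext0 X U -> Ext0 Z U -> Ext0 Y U.
Proof.
move=> EX EZ x; have [f hf] := EX (lact al x); have [h hh] := mono_ext0 f.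
have : lact al (add1 x (opp1 (dd (V:=Y) (W:=U) h))) = zero1 _ _.
  by rewrite lact_add lact_opp -dd_cmp_homl ?hh ?hf ?add1N //; exact: ses_homl S.
move=> /ses_cofac1 [z hz]; have [k hk] := EZ z.
exists (add0 h (cmp be k)); rewrite dd_add dd_cmp_homl ?hk -?hz; last exact: ses_homr S.
by apply: C1E => a; rewrite /add1 /opp1 addrC subrK.
Qed.
Lemma con_ext_quot U : Ext0 Y U -> Hom0 X U -> Ext0 Z U.
Proof.
move=> EY HX z; have [g hg] := EY (lact be z).
have : ishom (V:=X) (W:=U) (cmp al g).
  by rewrite /ishom dd_cmp_homl ?hg ?lactA ?(ses_0 S) ?lact_0x //; exact: ses_homl S.
move=> /HX /ses_cofac0 [h hh]; exists h; apply: epi_lact_inj.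
by rewrite -hg hh dd_cmp_homl //; exact: ses_homr S.
Qed.
Lemma con_hom_sub U : Hom0 Y U -> Ext0 Z U -> Hom0 X U.
Proof.
move=> HY EZ g hg; have [h hh] := mono_ext0 g.
have : lact al (dd (V:=Y) (W:=U) h) = zero1 _ _.
  by rewrite -dd_cmp_homl ?hh //; exact: ses_homl S.
move=> /ses_cofac1 [z hz]; have [k hk] := EZ z.
have hom : ishom (V:=Y) (W:=U) (add0 h (opp0 (cmp be k))).
  by rewrite /ishom dd_add dd_opp dd_cmp_homl ?hk -?hz ?add1N //; exact: ses_homr S.
have := HY _ hom; rewrite -hh => /(congr1 (fun x => cmp al x)).
by rewrite cmp_addr cmp_oppr cmpA (ses_0 S) cmp0x cmpx0 => <-; apply: C0E => i; rewrite /add0 /opp0 /zero0 oppr0 addr0.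
Qed.

Lemma perp_cov_mid U : perp U X -> perp U Z -> perp U Y.
Proof. by case=> h1 e1 [h2 e2]; split; [exact: cov_hom_mid | exact: cov_ext_mid]. Qed.
Lemma perp_cov_quot U : perp U X -> perp U Y -> perp U Z.
Proof. by case=> h1 e1 [h2 e2]; split; [exact: cov_hom_quot | exact: cov_ext_epi]. Qed.
Lemma perp_cov_sub U : perp U Y -> perp U Z -> perp U X.
Proof. by case=> h1 e1 [h2 e2]; split; [exact: cov_hom_mono | exact: cov_ext_sub]. Qed.
Lemma perp_con_mid U : perp X U -> perp Z U -> perp Y U.
Proof. by case=> h1 e1 [h2 e2]; split; [exact: con_hom_mid | exact: con_ext_mid]. Qed.
Lemma perp_con_quot U : perp X U -> perp Y U -> perp Z U.
Proof. by case=> h1 e1 [h2 e2]; split; [exact: con_hom_epi | exact: con_ext_quot]. Qed.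
Lemma perp_con_sub U : perp Y U -> perp Z U -> perp X U.
Proof. by case=> h1 e1 [h2 e2]; split; [exact: con_hom_sub | exact: con_ext_mono]. Qed.
End SES.
End Reps.

(** * The Euler form by counting; kernels, images and extensions *)

Section Reps2.
Variable Q : species.
Notation I := (sI Q).
Notation A := (sA Q).
Notation K := (@sK Q).
Notation L := (@sL Q).
Notation rep := (rep Q).

Definition n0 (v w : I -> nat) : nat := (\sum_i dK i * (v i * w i))%N.
Definition n1 (v w : I -> nat) : nat := (\sum_(a : A) dL a * (v (src a) * w (tgt a)))%N.
Definition eul (v w : I -> nat) : int := (n0 v w)%:Z - (n1 v w)%:Z.

Let F0 v w : finType := {dffun forall i : I, 'M[K i]_(v i, w i)}.
Let F1 v w : finType := {dffun forall a : A, 'M[L a]_(v (src a), w (tgt a))}.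

Lemma card_F0 v w : #|F0 v w| = (2 ^ n0 v w)%N.
Proof.
rewrite card_dep_ffun foldrE big_image /= /n0 expn_sum; apply: eq_bigr => i _.
by rewrite card_mx cardK -expnM.
Qed.
Lemma card_F1 v w : #|F1 v w| = (2 ^ n1 v w)%N.
Proof.
rewrite card_dep_ffun foldrE big_image /= /n1 expn_sum; apply: eq_bigr => i _.
by rewrite card_mx cardL -expnM.
Qed.

Let toF0 v w (f : C0 v w) : F0 v w := finfun f.
Let toF1 v w (f : C1 v w) : F1 v w := finfun f.
Let D (V W : rep) (f : F0 V W) : F1 V W := toF1 (dd (V:=V) (W:=W) f).

Lemma toF0K v w (f : C0 v w) : (toF0 f : C0 v w) = f.
Proof. by apply: C0E => i; rewrite ffunE. Qed.
Lemma toF1K v w (f : C1 v w) : (toF1 f : C1 v w) = f.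
Proof. by apply: C1E => i; rewrite ffunE. Qed.

Lemma hom0_inj (V W : rep) : Hom0 V W -> injective (@D V W).
Proof.
move=> H f g /(congr1 (fun x : F1 V W => (x : C1 V W))); rewrite !toF1K => e.
have h : ishom (V:=V) (W:=W) (add0 f (opp0 g)) by rewrite /ishom dd_add dd_opp e add1N.
have {}h := H _ h; apply/ffunP => i; apply/eqP; rewrite -subr_eq0; apply/eqP.
by rewrite -[LHS]/(add0 f (opp0 g) i) h.
Qed.

(** An injective [dd] between sets of 2 ^ [n0] and 2 ^ [n1] elements gives [n0] <= [n1]: counting
    stands in for rank-nullity. The next two lemmas treat a surjective [dd] in the same way, through
    a section of it. *)
Lemma hom0_eul (V W : rep) : Hom0 V W -> eul V W <= 0.
Proof.
move=> /hom0_inj /leq_card; rewrite card_F0 card_F1 leq_exp2l // /eul; lia.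
Qed.

Lemma ext0_eul (V W : rep) : Ext0 V W -> 0 <= eul V W.
Proof.
move=> E; pose G (x : F1 V W) : F0 V W := toF0 (sval (cid (E x))).
have GK : cancel G (@D V W).
  move=> x; apply/ffunP => a; rewrite /D /G toF0K (svalP (cid (E x))) ffunE //.
have := leq_card _ (can_inj GK); rewrite card_F0 card_F1 leq_exp2l // /eul; lia.
Qed.

Lemma ext0_eul0 (V W : rep) : Ext0 V W -> eul V W <= 0 -> Hom0 V W.
Proof.
move=> E e; pose G (x : F1 V W) : F0 V W := toF0 (sval (cid (E x))).
have GK : cancel G (@D V W).
  move=> x; apply/ffunP => a; rewrite /D /G toF0K (svalP (cid (E x))) ffunE //.
have : bijective G.
  apply: inj_card_bij (can_inj GK) _; move: e; rewrite card_F0 card_F1 leq_exp2l // /eul; lia.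
move=> bG; have DI := bij_inj (bij_can_bij bG GK).
move=> f hf; have : toF0 f = toF0 (zero0 V W).
  apply: DI; apply/ffunP => a; rewrite /D !ffunE !toF0K hf.
  by have -> : dd (V:=V) (W:=W) (zero0 V W) = zero1 V W by exact: hom_zero.
by move=> /(congr1 (fun x : F0 V W => (x : C0 V W))); rewrite !toF0K.
Qed.

Lemma perp_eul (V W : rep) : perp V W -> eul V W = 0.
Proof. by case=> /hom0_eul h /ext0_eul e; apply/eqP; rewrite eq_le h e. Qed.

Definition dim0 (C : rep) := forall i, rdim C i = 0%N.

Lemma C0_dim0l (v w : I -> nat) (f : C0 v w) : (forall i, v i = 0%N) -> f = zero0 v w.
Proof.
move=> z; apply: C0E => i; apply/matrixP => j k; case: j => m lt; exfalso.
by rewrite z in lt.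
Qed.
Lemma C0_dim0r (v w : I -> nat) (f : C0 v w) : (forall i, w i = 0%N) -> f = zero0 v w.
Proof.
move=> z; apply: C0E => i; apply/matrixP => j k; case: k => m lt; exfalso.
by rewrite z in lt.
Qed.
Lemma C1_dim0l (v w : I -> nat) (f : C1 v w) : (forall i, v i = 0%N) -> f = zero1 v w.
Proof.
move=> z; apply: C1E => i; apply/matrixP => j k; case: j => m lt; exfalso.
by rewrite z in lt.
Qed.
Lemma C1_dim0r (v w : I -> nat) (f : C1 v w) : (forall i, w i = 0%N) -> f = zero1 v w.
Proof.
move=> z; apply: C1E => i; apply/matrixP => j k; case: k => m lt; exfalso.
by rewrite z in lt.
Qed.
Lemma perp_dim0l (V W : rep) : dim0 V -> perp V W.
Proof.
move=> z; split=> [f _|x]; first exact: C0_dim0l.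
by exists (zero0 V W); rewrite [LHS]C1_dim0l // [RHS]C1_dim0l.
Qed.
Lemma perp_dim0r (V W : rep) : dim0 W -> perp V W.
Proof.
move=> z; split=> [f _|x]; first exact: C0_dim0r.
by exists (zero0 V W); rewrite [LHS]C1_dim0r // [RHS]C1_dim0r.
Qed.

Lemma epi0 (v w : I -> nat) (f : C0 v w) : epi f -> f = zero0 v w -> forall i, w i = 0%N.
Proof. by move=> e f0 i; have := e i; rewrite f0 /zero0 /row_full mxrank0 eq_sym => /eqP. Qed.
Lemma mono0 (v w : I -> nat) (f : C0 v w) : mono f -> f = zero0 v w -> forall i, v i = 0%N.
Proof. by move=> e f0 i; have := e i; rewrite f0 /zero0 /row_free mxrank0 eq_sym => /eqP. Qed.

Section Additive.
Variables (X Y Z : rep) (al : C0 X Y) (be : C0 Y Z).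
Hypothesis S : ses al be.
Lemma eul_sesr u : eul u Y = eul u X + eul u Z.
Proof.
rewrite /eul /n0 /n1.
have -> : (\sum_i dK i * (u i * Y i) = \sum_i dK i * (u i * X i) + \sum_i dK i * (u i * Z i))%N.
  by rewrite -big_split /=; apply: eq_bigr => i _; rewrite (ses_dim S) !mulnDr.
have -> : (\sum_(a : A) dL a * (u (src a) * Y (tgt a)) =
  \sum_(a : A) dL a * (u (src a) * X (tgt a)) + \sum_(a : A) dL a * (u (src a) * Z (tgt a)))%N.
  by rewrite -big_split /=; apply: eq_bigr => i _; rewrite (ses_dim S) !mulnDr.
lia.
Qed.
End Additive.

Lemma kernel_ses (V Z : rep) (be : C0 V Z) : ishom be -> epi be ->
  exists (X : rep) (al : C0 X V), ses al be.
Proof.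
move=> hb eb.
pose x i := \rank (kermx (be i)).
pose al0 : C0 x V := fun i => row_base (kermx (be i)).
have dim i : V i = (x i + Z i)%N.
  by rewrite /x mxrank_ker (eqP (eb i)) subnK // -(eqP (eb i)) rank_leq_row.
have ma : mono al0 by move=> i; exact: row_base_free.
have z i : al0 i *m be i = 0.
  by apply/sub_kermxP; rewrite eq_row_base.
have P a : {X | em_s al0 a *m ract V a = X *m em_t al0 a}.
  apply: cid; apply: (@exact_factor _ _ _ _ _ (em_t al0 a) (em_t be a)).
  - by rewrite /em_t row_free_map.
  - by rewrite /em_t row_full_map.
  - by rewrite /em_t -map_mxM z map_mx0.
  - exact: dim.
  - have := hb; rewrite /ishom => /(congr1 (fun f => f a)); rewrite /dd /zero1.
    move/eqP; rewrite subr_eq0 => /eqP e.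
    by rewrite -mulmxA -e mulmxA /em_s -map_mxM z map_mx0 mul0mx.
exists (Rep (fun a => sval (P a))), al0; split=> //.
- by apply: C1E => a; apply/eqP; rewrite subr_eq0; apply/eqP; have := svalP (P a).
- by apply: C0E => i; exact: z.
Qed.

Lemma cokernel_ses (X V : rep) (al : C0 X V) : ishom al -> mono al ->
  exists (Z : rep) (be : C0 V Z), ses al be.
Proof.
move=> hb ma.
pose x i := \rank (cokermx (al i)).
pose be0 : C0 V x := fun i => col_base (cokermx (al i)).
have dim i : V i = (X i + x i)%N.
  by rewrite /x mxrank_coker (eqP (ma i)) subnKC // -(eqP (ma i)) rank_leq_col.
have eb : epi be0 by move=> i; exact: col_base_full.
have z i : al i *m be0 i = 0.
  apply: (row_free_inj (row_base_free (cokermx (al i)))).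
  by rewrite -mulmxA mulmx_base mulmx_coker mul0mx.
have P a : {Y | ract V a *m em_t be0 a = em_s be0 a *m Y}.
  apply: cid; apply: (@exact_cofactor _ _ _ _ _ (em_s al a) (em_s be0 a)).
  - by rewrite /em_s row_free_map.
  - by rewrite /em_s row_full_map.
  - by rewrite /em_s -map_mxM z map_mx0.
  - exact: dim.
  - have := hb; rewrite /ishom => /(congr1 (fun f => f a)); rewrite /dd /zero1.
    move/eqP; rewrite subr_eq0 => /eqP e.
    by rewrite mulmxA e -mulmxA /em_t -map_mxM z map_mx0 mulmx0.
exists (Rep (fun a => sval (P a))), be0; split=> //.
- by apply: C1E => a; apply/eqP; rewrite subr_eq0; apply/eqP; have := svalP (P a).
- by apply: C0E => i; exact: z.
Qed.

Lemma image_fact (V W : rep) (f : C0 V W) : ishom f ->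
  exists (X J C : rep) (n : C0 X V) (p : C0 V J) (io : C0 J W) (ka : C0 W C),
  [/\ ses n p, ses io ka & f = cmp p io].
Proof.
move=> hf; pose x i := \rank (f i).
pose p : C0 V x := fun i => col_base (f i).
pose io : C0 x W := fun i => row_base (f i).
have fE : f = cmp p io by apply: C0E => i; rewrite /cmp mulmx_base.
have ep : epi p by move=> i; exact: col_base_full.
have mi : mono io by move=> i; exact: row_base_free.
have hfa a : em_s f a *m ract W a = ract V a *m em_t f a.
  by have /(congr1 (fun f => f a)) := hf; rewrite /dd /zero1 => /eqP; rewrite subr_eq0 => /eqP.
(* The action on the image that makes [io] a morphism is read off the action on V, by means of a
   section of [p] over the field of the arrow. *)
have P a : {X | em_s io a *m ract W a = X *m em_t io a}.
  apply: cid; have /row_fullP [s hs] : row_full (em_s p a) by rewrite /em_s row_full_map.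
  exists (s *m ract V a *m em_t p a).
  have E : em_s f a = em_s p a *m em_s io a by rewrite fE em_s_cmp.
  have E' : em_t f a = em_t p a *m em_t io a by rewrite fE em_t_cmp.
  by rewrite -!mulmxA -E' -hfa E -mulmxA !mulmxA hs mul1mx.
pose J := Rep (fun a => sval (P a)).
have hio : ishom (V:=J) (W:=W) io by apply: C1E => a; apply/eqP; rewrite subr_eq0; apply/eqP; have := svalP (P a).
have hp : ishom (V:=V) (W:=J) p.
  have e := @dd_cmp_homr _ V J W p io hio.
  by apply: (mono_ract_inj mi); rewrite ract_0x -[LHS]e -fE.
have [X [n Sn]] := kernel_ses hp ep.
have [C [ka Sk]] := cokernel_ses hio mi.
by exists X, J, C, n, p, io, ka.
Qed.

Section Extension.
Variables (X Z : rep) (x : C1 Z X).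
Definition extn : rep :=
  @Rep Q (fun i => X i + Z i)%N (fun a => block_mx (ract X a) 0 (x a) (ract Z a)).
Definition ext_in : C0 X extn := fun i => row_mx 1%:M 0.
Definition ext_out : C0 extn Z := fun i => col_mx 0 1%:M.
Definition ext_sec : C0 Z extn := fun i => row_mx 0 1%:M.

Lemma ext_ses : ses ext_in ext_out.
Proof.
split=> //.
- apply: C1E => a; rewrite /dd /zero1 /em_s /em_t !map_row_mx !map_mx1 !map_mx0 /=.
  by rewrite mul_row_block !mul1mx !mul0mx !addr0 mul_mx_row mulmx1 mulmx0 subrr.
- apply: C1E => a; rewrite /dd /zero1 /em_s /em_t !map_col_mx !map_mx1 !map_mx0 /=.
  by rewrite mul_block_col !mulmx1 !mulmx0 !add0r mul_col_mx mul1mx mul0mx subrr.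
- move=> i; rewrite /row_free eqn_leq rank_leq_row /=.
  suff /eqP -> : row_free (ext_in i) by [].
  by apply/row_freeP; exists (col_mx 1%:M 0); rewrite mul_row_col mulmx1 mulmx0 addr0.
- move=> i; apply/row_fullP; exists (row_mx 0 1%:M).
  by rewrite mul_row_col mulmx1 mulmx0 add0r.
- by apply: C0E => i; rewrite /cmp mul_row_col mulmx0 mul0mx addr0.
Qed.

Lemma ext_sec_out : cmp ext_sec ext_out = one0 Z.
Proof. by apply: C0E => i; rewrite /cmp mul_row_col mulmx1 mulmx0 add0r. Qed.

(** The graded section fails to be a morphism exactly by [x]: the extension has class [x], and a
    splitting would exhibit [x] as a coboundary. *)
Lemma dd_ext_sec : dd (V:=Z) (W:=extn) ext_sec = ractn x ext_in.
Proof.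
apply: C1E => a; rewrite /dd /ractn /em_s /em_t !map_row_mx !map_mx1 !map_mx0 /=.
rewrite mul_row_block !mul1mx !mul0mx !add0r !mul_mx_row mulmx1 !mulmx0 opp_row_mx add_row_mx.
by rewrite mulmx1 subrr oppr0 addr0.
Qed.
End Extension.

End Reps2.

(** * Exceptional representations and mutations *)

Section Reps3.
Variable Q : species.
Notation I := (sI Q).
Notation A := (sA Q).
Notation rep := (rep Q).
Implicit Types (U V W X Y Z N J C L E : rep).

Lemma eulE (v w : I -> nat) : eul v w =
  \sum_i (dK i)%:Z * ((v i)%:Z * (w i)%:Z)
  - \sum_(a : A) (dL a)%:Z * ((v (src a))%:Z * (w (tgt a))%:Z).
Proof.
rewrite /eul /n0 /n1 -!(big_morph Posz PoszD (erefl _)).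
by congr (_ - _); apply: eq_bigr => i _; rewrite !PoszM.
Qed.

Lemma eul_linl (l v w x : I -> nat) (s t : int) :
  (forall i, (l i)%:Z = s * (v i)%:Z + t * (w i)%:Z) ->
  eul l x = s * eul v x + t * eul w x.
Proof.
move=> H; rewrite !eulE !mulrBr addrACA -opprD !mulr_sumr -!big_split /=.
by congr (_ - _); apply: eq_bigr => i _; rewrite H; ring.
Qed.
Lemma eul_linr (l v w x : I -> nat) (s t : int) :
  (forall i, (l i)%:Z = s * (v i)%:Z + t * (w i)%:Z) ->
  eul x l = s * eul x v + t * eul x w.
Proof.
move=> H; rewrite !eulE !mulrBr addrACA -opprD !mulr_sumr -!big_split /=.
by congr (_ - _); apply: eq_bigr => i _; rewrite H; ring.
Qed.

(* [exc] omits the usual End(V) being a division ring: it follows from the root condition, see [exc_brick]. *)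
Definition rootdim (v : I -> nat) : Prop :=
  0 < eul v v /\ forall w : I -> nat, (eul v v %| eul v w)%Z /\ (eul v v %| eul w v)%Z.

Definition exc V : Prop := Ext0 V V /\ rootdim V.

(** Up to the sign [s], the vector [l] is the reflection of [w] at [v]: as [eul w v = 0], the
    condition [eul v l = 0] leaves only [k = eul v w / eul v v]. For the divisibility, the terms
    with [v] carry the factor [k * eul v v = eul v w], a multiple of [eul w w]. *)
Lemma rootdim_mut (v w l : I -> nat) (k s : int) : s * s = 1 ->
  rootdim v -> rootdim w -> eul w v = 0 -> eul v l = 0 ->
  (forall i, (l i)%:Z = s * (w i)%:Z + - (s * k) * (v i)%:Z) ->
  rootdim l /\ k * eul v v = eul v w.
Proof.
move=> ss [dv rv] [dw rw] wv vl lE.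
have kE : k * eul v v = eul v w.
  have := vl; rewrite (eul_linr _ lE) => /(congr1 (fun z => s * z)); rewrite mulr0 mulrDr mulrA ss mul1r.
  rewrite !mulNr mulrN !mulrA ss mul1r => /eqP; rewrite subr_eq0 => /eqP -> //.
have ll : eul l l = eul w w.
  rewrite (eul_linl _ lE) !(eul_linr _ lE) wv -kE.
  transitivity ((s * s) * eul w w); [ring | by rewrite ss mul1r].
split=> //; split; first by rewrite ll.
move=> x; rewrite ll (eul_linl _ lE) (eul_linr _ lE).
have [rw1 rw2] := rw x; have [rv1 rv2] := rv x.
have [/dvdzP [c cE] _] := rw v; have [_ /dvdzP [c' cE']] := rw v.
split; apply: rpredD; first exact: dvdz_mull.
- case/dvdzP: rv1 => y yE; rewrite yE; apply/dvdzP; exists (- s * c' * y).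
  by transitivity (- s * y * (k * eul v v)); [ring | rewrite kE cE'; ring].
- exact: dvdz_mull.
- case/dvdzP: rv2 => y yE; rewrite yE; apply/dvdzP; exists (- s * c' * y).
  by transitivity (- s * y * (k * eul v v)); [ring | rewrite kE cE'; ring].
Qed.

Lemma iso_inv V W (f : C0 V W) : ishom f -> mono f -> epi f ->
  exists g : C0 W V, [/\ ishom (V:=W) (W:=V) g, cmp f g = one0 V & cmp g f = one0 W].
Proof.
move=> hf mf ef; have [s hs] := epi_section ef; have [r hr] := mono_retract mf.
have rs : r = s by rewrite -[r]cmp1x -hs -cmpA hr cmpx1.
exists s; split=> //; last by rewrite -rs.
have := @dd_cmp_homl _ V W V f s hf; rewrite -rs hr.
have -> : dd (V:=V) (W:=V) (one0 V) = zero1 V V by exact: dd_one.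
by move=> /(congr1 (lact s)); rewrite lactA -rs lact_x0 rs hs lact1.
Qed.

Lemma ses_monor X Y Z (al : C0 X Y) (be : C0 Y Z) : ses al be -> dim0 X -> mono be.
Proof.
move=> S z i; rewrite /row_free (eqP (ses_epi S i)) (ses_dim S) z; exact: eqxx.
Qed.
Lemma ses_epil X Y Z (al : C0 X Y) (be : C0 Y Z) : ses al be -> dim0 Z -> epi al.
Proof.
move=> S z i; rewrite /row_full (eqP (ses_mono S i)) (ses_dim S) z addn0; exact: eqxx.
Qed.

Lemma mono_cmp u v w (f : @C0 Q u v) (g : C0 v w) : mono f -> mono g -> mono (cmp f g).
Proof.
move=> mf mg i; have /row_freeP [s hs] := mf i; have /row_freeP [t height] := mg i.
by apply/row_freeP; exists (t *m s); rewrite /cmp !mulmxA -(mulmxA (f i)) height mulmx1.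
Qed.
Lemma epi_cmp u v w (f : @C0 Q u v) (g : C0 v w) : epi f -> epi g -> epi (cmp f g).
Proof.
move=> mf mg i; have /row_fullP [s hs] := mf i; have /row_fullP [t height] := mg i.
by apply/row_fullP; exists (t *m s); rewrite /cmp !mulmxA -(mulmxA t) hs mulmx1.
Qed.

Lemma epi_ne0 X Y Z (al : C0 X Y) (be : C0 Y Z) : ses al be -> ~ dim0 Z -> ~ Hom0 Y Z.
Proof. by move=> S nz H; apply: nz; exact: epi0 (ses_epi S) (H _ (ses_homr S)). Qed.

Lemma ext0_pos V W : Ext0 V W -> ~ Hom0 V W -> 0 < eul V W.
Proof. by move=> E H; rewrite ltNge; apply/negP => /(ext0_eul0 E). Qed.

Lemma pos_hom V W : 0 < eul V W -> ~ Hom0 V W.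
Proof. by move=> p /hom0_eul; rewrite leNgt p. Qed.

Lemma rootdim_nz V : rootdim V -> ~ dim0 V.
Proof. by case=> p _ z; have := pos_hom p; apply; case: (perp_dim0l V z). Qed.

(** Image J and cokernel C of [f] are quotients of V, so Ext(V, J) = Ext(V, C) = 0, and [eul V J],
    [eul V C] are nonnegative multiples of [eul V V] with sum [eul V V]. As J is nonzero, it takes
    everything, and C = 0. *)
Lemma exc_brick V (f : C0 V V) : exc V -> ishom f -> f <> zero0 V V ->
  exists g : C0 V V, [/\ ishom g, cmp f g = one0 V & cmp g f = one0 V].
Proof.
case=> E [d r] hf f0; have [X [J [C [n [p [io [ka [Sn Sk fE]]]]]]]] := image_fact hf.
have EI : Ext0 V J := cov_ext_epi Sn E.
have hp : ~ Hom0 V J.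
  by move=> /(_ p (ses_homr Sn)) p0; apply: f0; rewrite fE p0 cmp0x.
have pI := ext0_pos EI hp.
have EC : Ext0 V C := cov_ext_epi Sk E.
have zC : dim0 C.
  apply: contrapT => /(epi_ne0 Sk) hC; have pC := ext0_pos EC hC.
  have e := eul_sesr Sk V.
  have [dI _] := r J; have [dC _] := r C.
  move: dI dC pI pC e d.
  move: (eul V V) (eul V J) (eul V C) => a b c /dvdzP [x ->] /dvdzP [y ->] px py e a0.
  by move: px py; rewrite !pmulr_lgt0 //; nia.
have zX : dim0 X.
  by move=> i; have := ses_dim Sn i; have := ses_dim Sk i; rewrite zC; lia.
apply: iso_inv => //; rewrite fE.
  by apply: mono_cmp (ses_monor Sn zX) (ses_mono Sk).
by apply: epi_cmp (ses_epi Sn) (ses_epil Sk zC).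
Qed.

(** Such V and V' are isomorphic, since [eul V V' > 0] yields a nonzero morphism; its kernel X and
    cokernel C have equal dimension vectors, Hom(V, X) = 0 because V is a brick, and a nonzero C
    would give the contradiction [eul V' C > 0]. This makes two realisations of the same roots
    interchangeable. *)
Lemma exc_same V V' : exc V -> exc V' -> (forall i, rdim V i = rdim V' i) ->
  forall Z, (perp V Z -> perp V' Z) /\ (perp Z V -> perp Z V').
Proof.
move=> eV eV' dim Z; have [E [d r]] := eV; have [E' _] := eV'.
have ext (l : I -> nat) : eul V l = eul V' l.
  by rewrite (@eul_linl _ V' V' l 1 0) ?mul1r ?mul0r ?addr0 // => i; rewrite dim mul1r mul0r addr0.
have extr (l : I -> nat) : eul l V = eul l V'.
  by rewrite (@eul_linr _ V' V' l 1 0) ?mul1r ?mul0r ?addr0 // => i; rewrite dim mul1r mul0r addr0.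
have /existsNP [f /not_implyP [hf f0]] : ~ Hom0 V V' by apply: pos_hom; rewrite -extr.
have [X [J [C [n [p [io [ka [Sn Sk fE]]]]]]]] := image_fact hf.
have HX : Hom0 V X.
  move=> h hh; apply: contrapT => h0.
  have hn : ishom (V:=V) (W:=V) (cmp h n) by apply: hom_cmp => //; exact: ses_homl Sn.
  have [|g [hg g1 g2]] := exc_brick eV hn.
    by move=> e; apply: h0; apply: (mono_cmp_inj (ses_mono Sn)); rewrite e cmp0x.
  apply: f0; rewrite fE -[p]cmp1x -g2 -!cmpA (cmpA n) (ses_0 Sn) cmp0x cmpx0 cmpx0 //.
have xc i : rdim X i = rdim C i.
  by have := ses_dim Sn i; have := ses_dim Sk i; rewrite dim; lia.
have zC : dim0 C.
  apply: contrapT => /(epi_ne0 Sk) hC.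
  have pC := ext0_pos (cov_ext_epi Sk E') hC.
  have := hom0_eul HX; rewrite ext (@eul_linr _ C C V' 1 0); first by rewrite mul1r mul0r addr0 leNgt pC.
  by move=> i; rewrite xc mul1r mul0r addr0.
have zX : dim0 X by move=> i; rewrite xc.
split=> P.
  apply: (perp_con_mid Sk); last exact: perp_dim0l.
  by apply: (perp_con_quot Sn) => //; exact: perp_dim0l.
apply: (perp_cov_mid Sk); last exact: perp_dim0r.
by apply: (perp_cov_quot Sn) => //; exact: perp_dim0r.
Qed.

(* A graded retraction of J -> W, corrected by a graded map W -> U -> J, is a morphism W -> J.
   If it is zero, the correction splits U -> J; otherwise W -> J -> W is a nonzero
   endomorphism of the brick W, so J = W. *)
Lemma epi_or_split U W N J C (n : C0 N U) (p : C0 U J) (io : C0 J W) (ka : C0 W C) :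
  ses n p -> ses io ka -> Ext0 W U -> exc W ->
  dim0 C \/ exists s : C0 U N, ishom s /\ cmp n s = one0 N.
Proof.
move=> Sn Sk E eW; have [rho hr] := mono_retract (ses_mono Sk).
have h1 : lact io (dd (V:=W) (W:=J) rho) = zero1 J J.
  have <- := @dd_cmp_homl _ J W J io rho (ses_homl Sk).
  by rewrite hr; exact: dd_one.
have [z hz] := ses_cofac1 Sk h1; have [z' hz'] := epi_lift1 Sn z.
have [y hy] := E (lact ka z').
have hs : ishom (V:=W) (W:=J) (add0 rho (opp0 (cmp y p))).
  rewrite /ishom dd_add dd_opp.
  have -> : dd (V:=W) (W:=J) (cmp y p) = dd (V:=W) (W:=J) rho.
    by have -> := @dd_cmp_homr _ W U J y p (ses_homr Sn); rewrite hy lractA hz' hz.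
  exact: add1N.
set sg := add0 _ _ in hs.
have [s0|s0] := pselect (cmp sg io = zero0 W W); last first.
  left; have [|g [hg g1 g2]] := exc_brick eW _ s0.
    by apply: hom_cmp => //; exact: ses_homl Sk.
  move=> i; apply: (epi0 (ses_epi Sk)).
  by rewrite -[ka]cmp1x -g2 -!cmpA (ses_0 Sk) !cmpx0.
right.
have {}s0 : sg = zero0 W J by apply: (mono_cmp_inj (ses_mono Sk)); rewrite s0 cmp0x.
have rE : rho = cmp y p.
  apply: C0E => i; apply/eqP; rewrite -subr_eq0; apply/eqP.
  by have /(congr1 (fun f => f i)) := s0.
have hsec : ishom (V:=J) (W:=U) (cmp io y).
  rewrite /ishom; have -> := @dd_cmp_homl _ J W U io y (ses_homl Sk).
  by rewrite hy lactA (ses_0 Sk) lact_0x.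
have sec : cmp (cmp io y) p = one0 J by rewrite -cmpA -rE.
have : cmp (add0 (one0 U) (opp0 (cmp p (cmp io y)))) p = zero0 U J.
  rewrite cmp_addl cmp_oppl cmp1x -cmpA sec cmpx1.
  by apply: C0E => i; rewrite /add0 /opp0 subrr.
move=> /(ses_fac0 Sn) [s hsE]; exists s; split.
  apply: (mono_facl_hom Sn); rewrite -hsE /ishom dd_add dd_opp.
  have -> : dd (V:=U) (W:=U) (cmp p (cmp io y)) = zero1 U U.
    by apply: hom_cmp => //; exact: ses_homr Sn.
  have -> : dd (V:=U) (W:=U) (one0 U) = zero1 U U by exact: dd_one.
  exact: add1N.
apply: (mono_cmp_inj (ses_mono Sn)); rewrite -cmpA -hsE cmp_addr cmp_oppr cmpx1 cmpA (ses_0 Sn) cmp0x cmp1x.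
by apply: C0E => i; rewrite /add0 /opp0 oppr0 addr0.
Qed.

(** The Happel-Ringel lemma. Unless [f] is epi, its kernel N is a direct summand of V; the projector
    of V onto N is zero or invertible as V is a brick, and in the second case [f] would be zero. *)
Lemma happel_ringel V W (f : C0 V W) : exc V -> exc W -> Ext0 W V ->
  ishom f -> f <> zero0 V W -> mono f \/ epi f.
Proof.
move=> eV eW E hf f0; have [N [J [C [n [p [io [ka [Sn Sk fE]]]]]]]] := image_fact hf.
case: (epi_or_split Sn Sk E eW) => [zC|[s [hs ns]]].
  by right; rewrite fE; apply: epi_cmp (ses_epi Sn) (ses_epil Sk zC).
left; have [e|e] := pselect (cmp s n = zero0 V V).
  have zN : dim0 N.
    apply: (mono0 (ses_mono Sn)).
    by rewrite -[n]cmp1x -ns -cmpA e cmpx0.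
  by rewrite fE; apply: mono_cmp (ses_monor Sn zN) (ses_mono Sk).
have [|g [hg g1 g2]] := exc_brick eV _ e.
  by apply: hom_cmp => //; exact: ses_homl Sn.
by case: f0; rewrite fE -[p]cmp1x -g2 -!cmpA (cmpA n) (ses_0 Sn) cmp0x !cmpx0.
Qed.

(* Add copies of V on top of Y by nonsplit extensions, each lowering dim Ext(V, Y), until it vanishes. *)
Lemma gamma_phase V Y : exc V -> Hom0 V Y ->
  exists L : rep, [/\ perp V L, exists k : nat, forall i, rdim L i = (Y i + k * V i)%N &
   forall P : rep -> Prop,
    (forall X X' (al : C0 X X') (be : C0 X' V), ses al be -> P X -> P X') -> P Y -> P L].
Proof.
move=> eV; have [n] := ubnP (absz (eul V Y)); elim: n Y => // n IH Y ltn HY.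
have [E|nE] := pselect (Ext0 V Y).
  exists Y; split=> //; exists 0%N => i; by rewrite mul0n addn0.
have [x hx] : exists x : C1 V Y, forall f : C0 V Y, dd f <> x.
  by move/existsNP: nE => [x Hx]; exists x => f hf; apply: Hx; exists f.
pose E := extn x; have S := ext_ses x.
(* A morphism from V to E followed by the projection to V is zero or invertible. Zero means that it
   lands in Y; invertible means that the extension splits, so that [x] would be a coboundary. *)
have HE : Hom0 V E.
  move=> g hg; have [b0|b0] := pselect (cmp g (ext_out x) = zero0 V V).
    have [h hh] := ses_fac0 S b0; rewrite hh in hg *.
    by have -> := HY _ (mono_facl_hom S hg); rewrite cmp0x.
  have [|g' [hg' g1 g2]] := exc_brick eV _ b0.
    by apply: hom_cmp => //; exact: ses_homr S.
  set s' := cmp g' g.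
  have hs' : ishom (V:=V) (W:=E) s' by apply: hom_cmp.
  have : cmp (add0 (ext_sec x) (opp0 s')) (ext_out x) = zero0 V V.
    rewrite cmp_addl cmp_oppl ext_sec_out /s' -cmpA g2.
    by apply: C0E => i; rewrite /add0 /opp0 subrr.
  move=> /(ses_fac0 S) [h hh]; case: (hx h).
  apply: (mono_ract_inj (ses_mono S)).
  have <- := @dd_cmp_homr _ V Y E h (ext_in x) (ses_homl S).
  rewrite -hh dd_add dd_opp hs'.
  have -> := dd_ext_sec x.
  by apply: C1E => a; rewrite /add1 /opp1 /zero1 oppr0 addr0.
have eE : eul V E = eul V Y + eul V V by exact: eul_sesr S V.
have dV : 0 < eul V V by case: eV => _ [].
have [||L [pL [k kE] cl]] := IH E; last first.
- exists L; split=> //; last by move=> P HP PY; apply: cl => //; exact: HP S PY.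
  exists k.+1 => i; rewrite kE /= mulSn; lia.
- exact: HE.
- have := hom0_eul HE; rewrite eE; lia.
Qed.

(* The properties of an iterated self-extension of j copies of V that are needed. *)
Definition filt V U (j : nat) : Prop :=
  [/\ forall i, rdim U i = (j * V i)%N,
     forall Z, Hom0 V Z -> Hom0 U Z, forall Z, Ext0 V Z -> Ext0 U Z,
     forall Z, Hom0 Z V -> Hom0 Z U & forall Z, Ext0 Z V -> Ext0 Z U].

Lemma filt_add V U j (x : C1 V U) : filt V U j -> filt V (extn x) j.+1.
Proof.
case=> d h e h' e'; have S := ext_ses x; split.
- by move=> i /=; rewrite d mulSn addnC.
- by move=> Z HZ; apply: (con_hom_mid S) => //; exact: h.
- by move=> Z HZ; apply: (con_ext_mid S) => //; exact: e.
- by move=> Z HZ; apply: (cov_hom_mid S) => //; exact: h'.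
- by move=> Z HZ; apply: (cov_ext_mid S) => //; exact: e'.
Qed.

(* Grow U in filt(V) mapping to W as long as V still maps nontrivially to the cokernel. *)
Lemma filt_grow V W U j (u : C0 U W) : exc V -> exc W -> perp W V ->
  filt V U j -> ishom u -> mono u ->
  (exists U' j' (u' : C0 U' W) C (ka : C0 W C), [/\ filt V U' j', ses u' ka & Hom0 V C]) \/
  (exists U' j' (u' : C0 U' W) N (n : C0 N U'), [/\ filt V U' j', ses n u' & Hom0 V N]).
Proof.
move=> eV eW pWV; have [m] := ubnP (\sum_i W i - \sum_i U i)%N.
elim: m U j u => // m IH U j u ltm fU hu mu.
have [C [ka Sk]] := cokernel_ses hu mu.
have [HC|] := pselect (Hom0 V C); first by left; exists U, j, u, C, ka.
move=> /existsNP [g /not_implyP [hg g0]].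
have [dU hU xU hU' xU'] := fU.
have EVU : Ext0 V U by apply: xU'; case: eV.
(* Since Ext(V, U) = 0, the morphism [g] to the cokernel lifts to a morphism [g'] to W; together
   with [u] it gives [u'] on the direct sum of U and V. *)
have [g1 hg1] := epi_lift0 Sk g.
have : ractn (dd (V:=V) (W:=W) g1) ka = zero1 V C.
  by have <- := @dd_cmp_homr _ V W C g1 ka (ses_homr Sk); rewrite hg1.
move=> /(ses_fac1 Sk) [z hz]; have [k hk] := EVU z.
pose g' := add0 g1 (opp0 (cmp k u)).
have hg' : ishom (V:=V) (W:=W) g'.
  rewrite /ishom dd_add dd_opp.
  by have -> := @dd_cmp_homr _ V U W k u hu; rewrite hk -hz add1N.
have g'ka : cmp g' ka = g.
  rewrite cmp_addl cmp_oppl hg1 -cmpA (ses_0 Sk) cmpx0.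
  by apply: C0E => i; rewrite /add0 /opp0 oppr0 addr0.
pose E := extn (zero1 V U); have S := ext_ses (zero1 V U).
pose u' : C0 E W := fun i => col_mx (u i) (g' i).
have fE : filt V E j.+1 by exact: filt_add.
have hu' : ishom (V:=E) (W:=W) u'.
  apply: C1E => a; rewrite /dd /zero1 /em_s /em_t /u' !map_col_mx /= mul_block_col.
  have /(congr1 (fun f => f a)) := hu; rewrite /dd /em_s /em_t /zero1 => e1.
  have /(congr1 (fun f => f a)) := hg'; rewrite /dd /em_s /em_t /zero1 => e2.
  by rewrite !mul0mx addr0 add0r mul_col_mx opp_col_mx add_col_mx e1 e2 col_mx0.
have inu : cmp (ext_in (zero1 V U)) u' = u.
  by apply: C0E => i; rewrite /cmp mul_row_col mul1mx mul0mx addr0.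
have secu : cmp (ext_sec (zero1 V U)) u' = g'.
  by apply: C0E => i; rewrite /cmp mul_row_col mul1mx mul0mx add0r.
(* A morphism from V to E killed by [u'] has components [a] in U and [b] in V. If [b] is invertible,
   then [g] is zero in the cokernel, which is excluded; if [b] is zero, then [a] is killed by the
   mono [u]. *)
have key N (n : C0 N E) : ishom n -> mono n -> cmp n u' = zero0 N W -> Hom0 V N.
  move=> hn mn nu h hh.
  pose b := cmp (cmp h n) (ext_out (zero1 V U)).
  have hhn : ishom (V:=V) (W:=E) (cmp h n) by apply: hom_cmp.
  have hb : ishom (V:=V) (W:=V) b by apply: hom_cmp => //; exact: ses_homr S.
  have hnu : cmp (cmp h n) u' = zero0 V W by rewrite -cmpA nu cmpx0.
  have dec (f : C0 V E) : exists a : C0 V U,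
     f = add0 (cmp a (ext_in (zero1 V U))) (cmp (cmp f (ext_out (zero1 V U))) (ext_sec (zero1 V U))).
    have : cmp (add0 f (opp0 (cmp (cmp f (ext_out (zero1 V U))) (ext_sec (zero1 V U))))) (ext_out (zero1 V U)) = zero0 V V.
      rewrite cmp_addl cmp_oppl -!cmpA ext_sec_out cmpx1.
      by apply: C0E => i; rewrite /add0 /opp0 subrr.
    move=> /(ses_fac0 S) [a ha]; exists a; rewrite -ha.
    by apply: C0E => i; rewrite /add0 /opp0 subrK.
  have [a ha] := dec (cmp h n).
  have eqn : add0 (cmp a u) (cmp b g') = zero0 V W.
    by rewrite -hnu ha -inu -secu cmp_addl !cmpA.
  rewrite -/b in ha; clearbody b.
  have [b0|b0] := pselect (b = zero0 V V); last first.
    have [b' [hb' b1 b2]] := exc_brick eV hb b0.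
    case: g0; rewrite -g'ka -[g']cmp1x -b2 -!cmpA (cmpA b).
    have : cmp (add0 (cmp a u) (cmp b g')) ka = zero0 V C by rewrite eqn cmp0x.
    rewrite cmp_addl -cmpA (ses_0 Sk) cmpx0 => e; rewrite -[RHS](@cmpx0 _ _ _ C b'); congr (cmp b' _).
    by rewrite -[RHS]e; apply: C0E => i; rewrite /add0 add0r.
  have a0 : a = zero0 V U.
    apply: (mono_cmp_inj mu); rewrite cmp0x -[RHS]eqn b0 cmp0x.
    by apply: C0E => i; rewrite /add0 addr0.
  apply: (mono_cmp_inj mn); rewrite cmp0x ha a0 b0 !cmp0x.
  by apply: C0E => i; rewrite /add0 addr0.
have [N [J [C' [n [p [io [ka' [Sn Sk' uE]]]]]]]] := image_fact hu'.
have EWE : Ext0 W E by case: fE => _ _ _ _; apply; case: pWV.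
case: (epi_or_split Sn Sk' EWE eW) => [zC|[s [hs ns]]].
  have eu' : epi u' by rewrite uE; apply: epi_cmp (ses_epi Sn) (ses_epil Sk' zC).
  have [N' [n' Sn']] := kernel_ses hu' eu'.
  right; exists E, j.+1, u', N', n'; split=> //.
  by apply: key (ses_homl Sn') (ses_mono Sn') (ses_0 Sn').
(* The kernel N is a summand of E. Vanishing of Hom(V, N) passes to Hom(E, N) because E is filtered
   by copies of V, so the projection to N is zero and [u'] is mono: the growth continues. *)
have HN : Hom0 V N.
  apply: key (ses_homl Sn) (ses_mono Sn) _.
  by rewrite uE cmpA (ses_0 Sn) cmp0x.
have s0 : s = zero0 E N by case: fE => _ h _ _ _; exact: h HN _ hs.
have zN : dim0 N.
  by apply: (mono0 (ses_mono Sn)); rewrite -[n]cmp1x -ns s0 cmpx0 cmp0x.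
have mu' : mono u' by rewrite uE; apply: mono_cmp (ses_monor Sn zN) (ses_mono Sk').
apply: (IH E j.+1 u') => //.
have leE : (\sum_i E i <= \sum_i W i)%N.
  by apply: leq_sum => i _; have := mu' i; rewrite /row_free => /eqP <-; exact: rank_leq_col.
have eE : (\sum_i E i = \sum_i U i + \sum_i V i)%N by rewrite -big_split.
have : (0 < \sum_i V i)%N.
  rewrite lt0n; apply/negP; rewrite sum_nat_eq0 => /forallP z0.
  by case: eV => _ /rootdim_nz; apply => i; apply/eqP; exact: z0.
move: ltm leE; rewrite eE; lia.
Qed.

(** If Hom(V, W) = 0, then L is an iterated extension of W by copies of V. Otherwise Ext(V, W) = 0
    by Happel-Ringel, and L comes from a map of an object filtered by V to W: its cokernel if the
    map is mono; if it is epi, its kernel after further extensions by V, since only Hom from V to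
    the kernel vanishes at first. Filtered objects replace minimal approximations, so no bases over
    End(V) occur. *)
Lemma left_mutation V W : exc V -> exc W -> perp W V ->
  exists L : rep, [/\ exc L, perp V L,
    forall Z, (perp Z V -> perp Z W -> perp Z L) /\ (perp V Z -> perp W Z -> perp L Z)
    & exists s k : int, [/\ s * s = 1, k * eul V V = eul V W &
       forall i, (L i)%:Z = s * (W i)%:Z + - (s * k) * (V i)%:Z] ].
Proof.
move=> eV eW pWV; have [EV rV] := eV; have [EW rW] := eW; have [HWV EWV] := pWV.
suff [L [EL pVL th [s [k [ss LE]]]]] : exists L : rep, [/\ Ext0 L L, perp V L,
    forall Z, (perp Z V -> perp Z W -> perp Z L) /\ (perp V Z -> perp W Z -> perp L Z)
    & exists s k : int, s * s = 1 /\
       forall i, (L i)%:Z = s * (W i)%:Z + - (s * k) * (V i)%:Z].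
  have [rL kE] := rootdim_mut ss rV rW (perp_eul pWV) (perp_eul pVL) LE.
  by exists L; split=> //; exists s, k.
have [H|] := pselect (Hom0 V W).
  have [L [pL [k kE] cl]] := gamma_phase eV H.
  have EWL : Ext0 W L.
    by apply: (cl (fun X => Ext0 W X)) => // X X' al be S EX; exact: (cov_ext_mid S).
  exists L; split=> //.
  - apply: (cl (fun X => Ext0 X L)) => // X X' al be S EX; apply: (con_ext_mid S) => //.
    by case: pL.
  - move=> Z; split=> p1 p2.
      by apply: (cl (fun X => perp Z X)) => // X X' al be S EX; exact: (perp_cov_mid S).
    by apply: (cl (fun X => perp X Z)) => // X X' al be S EX; exact: (perp_con_mid S).
  - by exists 1, (- k%:Z); split=> // i; rewrite kE; lia.
move=> /existsNP [f /not_implyP [hf f0]].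
have EVW : Ext0 V W.
  case: (happel_ringel eV eW EWV hf f0) => [mf|ef].
    by have [C [ka S]] := cokernel_ses hf mf; exact: (con_ext_mono S).
  by have [C [ka S]] := kernel_ses hf ef; exact: (cov_ext_epi S).
pose U0 : rep := @Rep Q (fun=> 0%N) (fun=> 0).
have fU0 : filt V U0 0.
  have z : dim0 U0 by [].
  split=> // Z _; by [case: (perp_dim0l Z z) | case: (perp_dim0r Z z)].
have hu0 : ishom (V:=U0) (W:=W) (zero0 U0 W) by exact: hom_zero.
have mu0 : mono (zero0 U0 W) by move=> i; rewrite /row_free eqn_leq rank_leq_row.
case: (filt_grow eV eW pWV fU0 hu0 mu0) => -[U [j [u [C [ka [fU S HC]]]]]].
  have [dU hU xU hU' xU'] := fU.
  have EVC : Ext0 V C := cov_ext_epi S EVW.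
  have pVC : perp V C by [].
  exists C; split=> //.
  - by apply: (con_ext_quot S); [exact: (cov_ext_epi S) | exact: hU].
  - move=> Z; split=> [[h1 e1] p2|[h1 e1] p2].
      by apply: (perp_cov_quot S) => //; split; [exact: hU' | exact: xU'].
    by apply: (perp_con_quot S) => //; split; [exact: hU | exact: xU].
  - by exists 1, j%:Z; split=> // i; have := ses_dim S i; rewrite dU; lia.
have [dU hU xU hU' xU'] := fU.
have [L [pL [k kE] cl]] := gamma_phase eV HC.
exists L; split=> //.
- apply: (cl (fun X => Ext0 X L)).
    move=> X X' al be S' EX; apply: (con_ext_mid S') => //; by case: pL.
  by apply: (con_ext_mono S); apply: xU; case: pL.
- move=> Z; split=> [p1 p2|p1 p2].
    apply: (cl (fun X => perp Z X)).
      by move=> X X' al be S' EX; exact: (perp_cov_mid S').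
    apply: (perp_cov_sub S) => //; case: p1 => h1 e1; split; [exact: hU' | exact: xU'].
  apply: (cl (fun X => perp X Z)).
    by move=> X X' al be S' EX; exact: (perp_con_mid S').
  apply: (perp_con_sub S) => //; case: p1 => h1 e1; split; [exact: hU | exact: xU].
- exists (-1), (j%:Z + k%:Z); split=> // i; rewrite kE; have := ses_dim S i; rewrite dU; lia.
Qed.

End Reps3.

(** * Transposition of matrices, and right mutations from left ones over the opposite species *)

Section Dual.
Variable Q : species.
Notation I := (sI Q).
Notation A := (sA Q).

Definition dual (V : rep Q) : rep (opS Q) :=
  @Rep (opS Q) (rdim V) (fun a => (ract V a)^T).
Definition undual (V : rep (opS Q)) : rep Q :=
  @Rep Q (rdim V) (fun a => (ract V a)^T).

Lemma dualK (V : rep Q) : undual (dual V) = V.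
Proof.
case: V => v act; rewrite /undual /dual /=; congr Rep.
by apply: functional_extensionality_dep => a; rewrite trmxK.
Qed.

Definition trf v w (f : @C0 (opS Q) v w) : @C0 Q w v := fun i => (f i)^T.
Definition untrf v w (f : @C0 Q v w) : @C0 (opS Q) w v := fun i => (f i)^T.

Lemma dd_dual (X Y : rep (opS Q)) (f : C0 X Y) (a : A) :
  dd (V:=undual Y) (W:=undual X) (trf f) a = - (dd (V:=X) (W:=Y) f a)^T.
Proof.
rewrite /dd /em_s /em_t /trf /= linearB /= !trmx_mul opprB.
by rewrite !map_trmx.
Qed.

Lemma Hom0_dual (X Y : rep (opS Q)) : Hom0 (undual Y) (undual X) <-> Hom0 X Y.
Proof.
split=> H f hf.
  have := H (trf f); rewrite /ishom.
  have -> : dd (V:=undual Y) (W:=undual X) (trf f) = zero1 _ _.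
    by apply: C1E => a; rewrite dd_dual hf /zero1 trmx0 oppr0.
  move=> /(_ erefl) e; apply: C0E => i; apply: trmx_inj.
  by have /(congr1 (fun g => g i)) := e; rewrite /trf /zero0 trmx0.
have := H (untrf f); rewrite /ishom.
have -> : dd (V:=X) (W:=Y) (untrf f) = zero1 _ _.
  apply: C1E => a; apply: trmx_inj; apply: oppr_inj; rewrite -dd_dual.
  have -> : trf (untrf f) = f by apply: C0E => i; rewrite /trf /untrf trmxK.
  by rewrite hf /zero1 trmx0 oppr0.
move=> /(_ erefl) e; apply: C0E => i; apply: trmx_inj.
by have /(congr1 (fun g => g i)) := e; rewrite /untrf /zero0 trmx0.
Qed.

Lemma Ext0_dual (X Y : rep (opS Q)) : Ext0 (undual Y) (undual X) <-> Ext0 X Y.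
Proof.
split=> H x.
  pose x' : C1 (undual Y) (undual X) := fun a => - (x a)^T.
  have [f hf] := H x'; exists (untrf f); apply: C1E => a.
  apply: trmx_inj; apply: oppr_inj; rewrite -dd_dual.
  have -> : trf (untrf f) = f by apply: C0E => i; rewrite /trf /untrf trmxK.
  by rewrite hf.
pose x' : C1 X Y := fun a => - (x a)^T.
have [f hf] := H x'; exists (trf f); apply: C1E => a.
by rewrite dd_dual hf /x' linearN /= trmxK opprK.
Qed.

Lemma perp_dual (X Y : rep (opS Q)) : perp (undual Y) (undual X) <-> perp X Y.
Proof. by split; case=> /Hom0_dual h /Ext0_dual e. Qed.

Lemma eul_dual (v w : I -> nat) : @eul (opS Q) v w = @eul Q w v.
Proof.
rewrite /eul /n0 /n1 /=; congr (Posz _ - Posz _).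
  by apply: eq_bigr => i _; rewrite [(v i * _)%N]mulnC.
by apply: eq_bigr => i _; rewrite [(v _ * _)%N]mulnC.
Qed.

Lemma rootdim_dual (v : I -> nat) : @rootdim (opS Q) v <-> @rootdim Q v.
Proof.
by split; case=> d r; split; [move: d; rewrite !eul_dual | |move: d; rewrite !eul_dual |] => // w;
  have [r1 r2] := r w; move: r1 r2; rewrite !eul_dual.
Qed.

Lemma exc_dual (X : rep (opS Q)) : exc (undual X) <-> exc X.
Proof.
by split; case=> e r; split; [exact/Ext0_dual | exact/rootdim_dual
  | exact/Ext0_dual | exact/rootdim_dual].
Qed.

Lemma right_mutation (V W : rep Q) : exc V -> exc W -> perp W V ->
  exists R : rep Q, [/\ exc R, perp R W,
    forall Z, (perp Z V -> perp Z W -> perp Z R) /\ (perp V Z -> perp W Z -> perp R Z)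
    & exists s k : int, [/\ s * s = 1, k * eul W W = eul V W &
       forall i, (R i)%:Z = s * (V i)%:Z + - (s * k) * (W i)%:Z] ].
Proof.
move=> eV eW p.
have eV' : exc (dual V) by apply/exc_dual; rewrite dualK.
have eW' : exc (dual W) by apply/exc_dual; rewrite dualK.
have p' : perp (dual V) (dual W) by apply/perp_dual; rewrite !dualK.
have [L [eL pL th [s [k [ss kE LE]]]]] := left_mutation eW' eV' p'.
exists (undual L); split.
- exact/exc_dual.
- by move/perp_dual: pL; rewrite dualK.
- move=> Z; have [t1 t2] := th (dual Z); split=> p1 p2.
    by rewrite -[Z]dualK; apply/perp_dual/t2; apply/perp_dual; rewrite !dualK.
  by rewrite -[Z]dualK; apply/perp_dual/t1; apply/perp_dual; rewrite !dualK.
- by exists s, k; split=> //; move: kE; rewrite !eul_dual.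
Qed.

End Dual.

(** * Simple objects of a perpendicular category *)

Section Filtration.
Variable Q : species.
Notation rep := (rep Q).
Implicit Types (V W X Y Z E C : rep).

(** The right perpendicular category is closed under kernels and cokernels: the image is a subobject
    of Y, which gives Hom = 0, and a quotient of X, which gives Ext = 0. *)
Lemma perp_image (P : rep -> Prop) (X Y J C N : rep) (n : C0 N X) (p : C0 X J) (io : C0 J Y) (ka : C0 Y C) :
  ses n p -> ses io ka ->
  (forall Z, P Z -> perp Z X) -> (forall Z, P Z -> perp Z Y) ->
  (forall Z, P Z -> perp Z N) /\ (forall Z, P Z -> perp Z C).
Proof.
move=> Sn Sk PX PY.
have PJ Z : P Z -> perp Z J.
  move=> PZ; split; first by apply: (cov_hom_mono Sk); case: (PY _ PZ).
  by apply: (cov_ext_epi Sn); case: (PX _ PZ).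
split=> Z PZ; first by apply: (perp_cov_sub Sn); [exact: PX | exact: PJ].
by apply: (perp_cov_quot Sk); [exact: PJ | exact: PY].
Qed.

(** The [M i] behave as the simple objects of the right perpendicular category of P. A nonzero
    morphism from [M i] to Y is mono: a nonzero kernel would receive a nonzero morphism from some
    [M j], which is excluded for j <> i by [orth] and invertible for j = i. Then [M i] is split off
    the dimension vector and the cokernel is treated next. *)
Lemma filtration (P : rep -> Prop) (r : nat) (M : 'I_r -> rep) :
  (forall i, exc (M i)) ->
  (forall i j, i != j -> Hom0 (M i) (M j)) ->
  (forall i Z, P Z -> perp Z (M i)) ->
  (forall Y, ~ dim0 Y -> (forall Z, P Z -> perp Z Y) -> exists i, ~ Hom0 (M i) Y) ->
  forall Y, (forall Z, P Z -> perp Z Y) ->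
  exists m : 'I_r -> nat, forall v, Y v = (\sum_i m i * M i v)%N.
Proof.
move=> eM orth PM hom Y; have [n] := ubnP (\sum_v Y v)%N.
elim: n Y => // n IH Y ltn PY.
have [zY|nzY] := pselect (dim0 Y).
  by exists (fun=> 0%N) => v; rewrite zY big1.
have [i /existsNP [f /not_implyP [hf f0]]] := hom _ nzY PY.
have [N [J [C [k [p [io [ka [Sn Sk fE]]]]]]]] := image_fact hf.
have [PN PC] := perp_image Sn Sk (PM i) PY.
have zN : dim0 N.
  apply: contrapT => nzN; have [j] := hom _ nzN PN.
  move=> /existsNP [g /not_implyP [hg g0]].
  have hgk : ishom (V:=M j) (W:=M i) (cmp g k) by apply: hom_cmp => //; exact: ses_homl Sn.
  have gk0 : cmp g k <> zero0 (M j) (M i).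
    by move=> e; apply: g0; apply: (mono_cmp_inj (ses_mono Sn)); rewrite e cmp0x.
  have [ji|ji] := eqVneq j i; last by apply: gk0; exact: orth ji _ hgk.
  subst j; have [g' [hg' g1 g2]] := exc_brick (eM i) hgk gk0.
  by apply: f0; rewrite fE -[p]cmp1x -g2 -!cmpA (cmpA k) (ses_0 Sn) cmp0x !cmpx0.
have dim v : Y v = (M i v + C v)%N.
  by have := ses_dim Sn v; have := ses_dim Sk v; rewrite zN; lia.
have [|m hm] := IH C _ PC.
  have : (\sum_v Y v = \sum_v M i v + \sum_v C v)%N.
    by rewrite -big_split; apply: eq_bigr => v _; rewrite dim.
  have : (0 < \sum_v M i v)%N.
    rewrite lt0n; apply/negP; rewrite sum_nat_eq0 => /forallP z0.
    by case: (eM i) => _ /rootdim_nz; apply => v; apply/eqP; exact: z0.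
  move: ltn; lia.
exists (fun j => (j == i) + m j)%N => v; rewrite dim hm.
under [RHS]eq_bigr do rewrite mulnDl.
rewrite big_split /=; congr (_ + _)%N.
rewrite (bigD1 i) //= eqxx mul1n big1 ?addn0 // => j /negPf ->.
by rewrite mul0n.
Qed.

(** In an exceptional sequence where V precedes W, every member X between them satisfies both
    premises [perp W X] and [perp X V]. So all Ext(V, X), or all Ext(X, W), vanish; this lets
    [reduce_pair] approach V and W to each other. *)
Lemma hom_middle V W : exc V -> exc W -> perp W V -> ~ Hom0 V W ->
  (forall X, perp W X -> Ext0 V X) \/ (forall X, perp X V -> Ext0 X W).
Proof.
move=> eV eW [_ e] /existsNP [f /not_implyP [hf f0]].
case: (happel_ringel eV eW e hf f0) => [mf|ef].
  by left=> X [_ eWX]; have [C [ka S]] := cokernel_ses hf mf; exact: (con_ext_mono S eWX).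
by right=> X [_ exV]; have [C [ka S]] := kernel_ses hf ef; exact: (cov_ext_epi S exV).
Qed.

Lemma hom_ext0 V W : exc V -> exc W -> perp W V -> ~ Hom0 V W -> Ext0 V W.
Proof.
move=> eV eW [_ e] /existsNP [f /not_implyP [hf f0]].
case: (happel_ringel eV eW e hf f0) => [mf|ef].
  by have [C [ka S]] := cokernel_ses hf mf; apply: (con_ext_mono S); case: eW.
by have [C [ka S]] := kernel_ses hf ef; apply: (cov_ext_epi S); case: eV.
Qed.

Definition simple (i : sI Q) : rep := @Rep Q (fun j => (j == i)%N) (fun=> 0).

Lemma simple_perp i j : i != j -> (forall a : sA Q, src a = i -> tgt a <> j) ->
  perp (simple i) (simple j).
Proof.
move=> ij na; split=> [f _|x].
  apply: C0E => k; apply/matrixP => u v; exfalso.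
  case: u => u; case: v => v /= hv hu; move: hu hv.
  by case: eqVneq => [->|_] //; rewrite (negPf ij).
exists (zero0 _ _); apply: C1E => a; apply/matrixP => u v; exfalso.
case: u => u; case: v => v /= hv hu; move: hu hv.
by case: eqVneq => [e _|] //; case: eqVneq => [e'|] //; case: (na a).
Qed.

Lemma simple_ext0 i : (forall a : sA Q, src a <> tgt a) -> Ext0 (simple i) (simple i).
Proof.
move=> na x; exists (zero0 _ _); apply: C1E => a; apply/matrixP => u v; exfalso.
case: u => u; case: v => v /= hv hu; move: hu hv.
by case: eqVneq => [e _|] //; case: eqVneq => [e'|] //; case: (na a); rewrite e.
Qed.
End Filtration.

(** * Species over finite fields *)

Record char2ff := Char2FF { c2F :> finFieldType; c2P : 2%N \in [pchar c2F] }.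

Section SubFF.
Variables (B : char2ff) (d : nat).

(** Fixed points of the d-th power of the Frobenius map: the subfield with 2 ^ d elements when d
    divides the degree of B. With all fields of a species inside one [B], the embeddings are
    inclusions. *)
Definition ffix : pred B := fun x => x ^+ (2 ^ d) == x.

Lemma frobD (x y : B) : (x + y) ^+ (2 ^ d) = x ^+ (2 ^ d) + y ^+ (2 ^ d).
Proof.
by rewrite exprDn_pchar // (eq_pnat _ (pcharf_eq (c2P B))) pnatX pnat_id.
Qed.

Lemma ffix_closed : divring_closed ffix.
Proof.
have N (x : B) : - x = x by rewrite (oppr_pchar2 (c2P B)).
split.
- by rewrite unfold_in /ffix expr1n.
- move=> x y; rewrite !unfold_in /ffix N => /eqP ex /eqP ey.
  by rewrite frobD ex ey.
- move=> x y; rewrite !unfold_in /ffix => /eqP ex /eqP ey.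
  by rewrite exprMn exprVn ex ey.
Qed.
HB.instance Definition _ := GRing.isDivringClosed.Build B ffix ffix_closed.

Record subff := SubFF { ffval : B; ffvalP : ffval \in ffix }.
HB.instance Definition _ := [isSub for ffval].
HB.instance Definition _ := [Finite of subff by <:].
HB.instance Definition _ := [SubChoice_isSubIntegralDomain of subff by <:].
HB.instance Definition _ := [SubIntegralDomain_isSubField of subff by <:].
End SubFF.

Arguments ffix B d : clear implicits.
Arguments subff B d : clear implicits.

Section CardSub.
Variables (B : char2ff).
Definition frobpoly d : {poly B} := 'X^(2 ^ d) - 'X.

Lemma frobpoly_dvd d k : frobpoly d %| frobpoly (d * k).
Proof.
have P2 : 2%N \in [pchar {poly B}] by rewrite pchar_poly; exact: c2P.
elim: k => [|k IH]; first by rewrite muln0 /frobpoly expn0 expr1 subrr dvdp0.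
have -> : frobpoly (d * k.+1) = (frobpoly (d * k)) ^+ (2 ^ d) + frobpoly d.
  rewrite /frobpoly !(oppr_pchar2 P2) exprDn_pchar; last first.
    by rewrite (eq_pnat _ (pcharf_eq P2)) pnatX pnat_id.
  rewrite -exprM -expnD mulnS addnC -addrA; congr (_ + _).
  by rewrite addrA (addrr_pchar2 P2) add0r.
rewrite dvdp_addr ?dvdpp //; apply: (dvdp_trans IH).
by rewrite -[X in X %| _]expr1 dvdp_exp2l ?expn_gt0.
Qed.

Lemma size_frobpoly d : (0 < d)%N -> size (frobpoly d) = (2 ^ d).+1.
Proof.
move=> d0; rewrite /frobpoly size_polyDl size_polyXn // size_polyN size_polyX.
by rewrite ltnS; have := @leq_exp2l 2 1 d isT; rewrite d0 expn1 => ->.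
Qed.

(** Two root counts: [frobpoly d] has at most 2 ^ d roots, and its cofactor in [frobpoly M], which
    vanishes at all remaining elements of B, has at most 2 ^ M - 2 ^ d. *)
Lemma card_subff d M : (0 < d)%N -> (d %| M)%N -> (0 < M)%N -> #|B| = (2 ^ M)%N ->
  #|{: subff B d}| = (2 ^ d)%N.
Proof.
move=> d0 /dvdnP [k Mk] M0 cB; rewrite card_sub.
have nz m : (0 < m)%N -> frobpoly m != 0.
  by move=> m0; rewrite -size_poly_eq0 size_frobpoly.
have rootE m x : root (frobpoly m) x = (x ^+ (2 ^ m) == x).
  by rewrite /root /frobpoly !hornerE subr_eq0.
apply/eqP; rewrite eqn_leq; apply/andP; split.
  have := @max_poly_roots _ (frobpoly d) (enum (ffix B d)) (nz _ d0) _ (enum_uniq _).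
  rewrite size_frobpoly // ltnS cardE; apply.
  by apply/allP => x; rewrite mem_enum rootE.
have /dvdpP [R RE] : frobpoly d %| frobpoly M by rewrite Mk mulnC frobpoly_dvd.
have R0 : R != 0 by have := nz _ M0; rewrite RE mulf_eq0 negb_or => /andP [].
have sR : (size R).-1 = (2 ^ M - 2 ^ d)%N.
  have := size_mul R0 (nz _ d0); rewrite -RE !size_frobpoly //.
  by move: (2 ^ M)%N (2 ^ d)%N (size R) => a b c; lia.
have := @max_poly_roots _ R (enum [predC (ffix B d)]) R0 _ (enum_uniq _).
have -> : all (root R) (enum [predC ffix B d]).
  apply/allP => x; rewrite mem_enum inE => nx.
  have : root (frobpoly M) x by rewrite rootE -cB expf_card.
  by rewrite RE rootM rootE => /orP [//|] h; move: nx; rewrite unfold_in /ffix h.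
move=> /(_ isT); rewrite -cardE => h.
have := cardC (ffix B d); rewrite cB => e.
have h2 : (#|[predC ffix B d]| <= 2 ^ M - 2 ^ d)%N.
  by rewrite -sR; move: h; case: (size R).
have h3 : (2 ^ d <= 2 ^ M)%N by rewrite leq_exp2l // Mk leq_pmull //; case: (k) Mk M0 => // ->.
by move: e h2 h3; move: #|ffix B d| #|[predC ffix B d]| (2 ^ M)%N (2 ^ d)%N => a b c e; lia.
Qed.
End CardSub.

Section Embed.
Variables (B : char2ff) (d m : nat).
Hypothesis dm : (d %| m)%N.

Lemma ffix_sub x : x \in ffix B d -> x \in ffix B m.
Proof.
case/dvdnP: dm => k ->; elim: k => [|k IH]; first by move=> _; rewrite mul0n unfold_in /ffix expn0 expr1.
move=> hx; have := IH hx; rewrite !unfold_in /ffix mulSn expnD exprM.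
by move: hx; rewrite unfold_in /ffix => /eqP ->.
Qed.

Definition subff_emb (x : subff B d) : subff B m := SubFF (ffix_sub (ffvalP x)).

Lemma subff_emb_zmod : zmod_morphism subff_emb.
Proof. by move=> x y; apply: val_inj. Qed.
Lemma subff_emb_monoid : monoid_morphism subff_emb.
Proof. by split=> [|x y]; apply: val_inj. Qed.
HB.instance Definition _ := GRing.isZmodMorphism.Build _ _ subff_emb subff_emb_zmod.
HB.instance Definition _ := GRing.isMonoidMorphism.Build _ _ subff_emb subff_emb_monoid.
Definition subff_rmorph : {rmorphism subff B d -> subff B m} := subff_emb.
End Embed.

Lemma species_exists n (d : 'I_n -> nat) (m : 'I_n -> 'I_n -> nat) :
  (forall i, (0 < d i)%N) ->
  (forall i j : 'I_n, (i < j)%N -> (d i %| m i j)%N /\ (d j %| m i j)%N) ->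
  exists (Q : species) (v : 'I_n -> sI Q),
    [/\ bijective v, forall a : sA Q, exists i j : 'I_n, [/\ (i < j)%N, src a = v i & tgt a = v j]
     & forall x y : sI Q -> nat, eul x y =
       \sum_i (d i)%:Z * ((x (v i))%:Z * (y (v i))%:Z) -
       \sum_(i < n) \sum_(j < n | (i < j)%N) (m i j)%:Z * ((x (v i))%:Z * (y (v j))%:Z)].
Proof.
move=> d0 dm.
(* A common multiple of the degrees of all fields needed. The zero values of [m] stand for missing
   arrows and must stay out of the product. *)
pose M := ((\prod_i d i) * \prod_(p : 'I_n * 'I_n | m p.1 p.2 != 0) m p.1 p.2)%N.
have M0 : (0 < M)%N.
  by rewrite muln_gt0 prodn_gt0 //= prodn_cond_gt0 // => p; rewrite -lt0n.
have [B0 B2 cB] := pPrimePowerField (isT : prime 2) M0.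
pose B := Char2FF B2.
have dM i : (d i %| M)%N by rewrite /M dvdn_mulr // (bigD1 i) //= dvdn_mulr.
have mM i j : (0 < m i j)%N -> (m i j %| M)%N.
  by move=> h; rewrite /M dvdn_mull // (bigD1 (i, j)) /= -?lt0n // dvdn_mulr.
pose pa : {pred 'I_n * 'I_n} := fun p => (p.1 < p.2)%N && (0 < m p.1 p.2)%N.
pose Ar : finType := {p in pa}.
have h1 (a : Ar) : (d (val a).1 %| m (val a).1 (val a).2)%N.
  by case: (andP (valP a)) => /dm [].
have h2 (a : Ar) : (d (val a).2 %| m (val a).1 (val a).2)%N.
  by case: (andP (valP a)) => /dm [].
have cK i : #|{: subff B (d i)}| = (2 ^ d i)%N by apply: (@card_subff B _ M).
have cL (a : Ar) : #|{: subff B (m (val a).1 (val a).2)}| = (2 ^ m (val a).1 (val a).2)%N.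
  have /andP [_ h] := valP a.
  by apply: (@card_subff B _ M) => //; exact: mM.
pose Q := @Species 'I_n Ar (fun a => (val a).1) (fun a => (val a).2)
  (fun i => subff B (d i)) (fun a => subff B (m (val a).1 (val a).2))
  (fun a => subff_rmorph B (h1 a)) (fun a => subff_rmorph B (h2 a)) d
  (fun a => m (val a).1 (val a).2) cK cL.
exists Q, id; split.
- by exists id.
- move=> a; exists (val a).1, (val a).2; split=> //.
  by have /andP [] := valP a.
move=> x y; rewrite eulE /=; congr (_ - _).
rewrite pair_big_dep /=.
transitivity (\sum_(p : 'I_n * 'I_n | (p.1 < p.2)%N && (0 < m p.1 p.2)%N)
  (m p.1 p.2)%:Z * ((x p.1)%:Z * (y p.2)%:Z)).
  exact: esym (big_sub pa (fun p => (m p.1 p.2)%:Z * ((x p.1)%:Z * (y p.2)%:Z))).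
rewrite [RHS](bigID (fun p : 'I_n * 'I_n => (0 < m p.1 p.2)%N)) /=.
rewrite [X in _ + X]big1 ?addr0 // => p /andP [_]; rewrite -eqn0Ngt => /eqP ->.
by rewrite mul0r.
Qed.

(** * Reflections in bilinear lattices *)

Section GroupFacts.
Variable G : groupType.
Implicit Types (s t : seq G) (S H : set G).

Lemma prodg_cat s t : prodg (s ++ t) = (prodg s * prodg t)%g.
Proof. by rewrite /prodg big_cat. Qed.
Lemma prodg_nil : prodg [::] = 1%g :> G.
Proof. by rewrite /prodg big_nil. Qed.
Lemma prodg_cons x s : prodg (x :: s) = (x * prodg s)%g.
Proof. by rewrite /prodg big_cons. Qed.
Lemma prodg_rcons x s : prodg (rcons s x) = (prodg s * x)%g.
Proof. by rewrite -cats1 prodg_cat prodg_cons prodg_nil mulg1. Qed.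

Lemma prodg_nseq m (s t : G) : prodg (flatten (nseq m [:: s; t])) = ((s * t) ^+ m)%g.
Proof.
elim: m => [|m IH]; first by rewrite prodg_nil.
by rewrite /= !prodg_cons IH expgS mulgA.
Qed.

Lemma cox_cong_prodg S s t : cox_cong S s t -> prodg s = prodg t.
Proof.
elim=> // [u v w _ -> _ -> //|u v a b m Sa Sb [m0 ho]].
rewrite !prodg_cat prodg_nseq (_ : _ ^+ m = 1)%g ?mul1g //.
by apply/ho.
Qed.

Lemma cox_cong_odd S s t : cox_cong S s t -> odd (size s) = odd (size t).
Proof.
elim=> // [u v w _ -> _ -> //|u v a b m Sa Sb [m0 ho]].
rewrite !size_cat !oddD; congr (_ (+) _).
have -> : size (flatten (nseq m [:: a; b])) = m.*2.
  by elim: (m) => //= k ->.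
by rewrite odd_double.
Qed.

Lemma cox_cong_ctx S a b s t : cox_cong S s t -> cox_cong S (a ++ s ++ b) (a ++ t ++ b).
Proof.
elim=> [u|u v _ IH|u v w _ IH1 _ IH2|u v x y m Sx Sy ho].
- exact: cox_cong_refl.
- exact: cox_cong_sym.
- exact: cox_cong_trans IH1 IH2.
- have := cox_cong_rel (a ++ u) (v ++ b) Sx Sy ho.
  by rewrite -!catA.
Qed.

Lemma gen_subgroupP S : subgroup_set (gen_subgroup S) /\ S `<=` gen_subgroup S.
Proof.
split; last by move=> x Sx H [_ h]; exact: h.
split; first by move=> H [sH _]; exact: sH.1.
by move=> x y hx hy H [sH SH]; apply: sH.2; [apply: hx | apply: hy]; split.
Qed.

Lemma gen_subgroup_min S H : subgroup_set H -> S `<=` H -> gen_subgroup S `<=` H.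
Proof. by move=> sH SH x; apply. Qed.

Lemma subgroupV H x : subgroup_set H -> H x -> H (x^-1)%g.
Proof. by case=> h1 h2 hx; have := h2 _ _ h1 hx; rewrite mul1g. Qed.
Lemma subgroupM H x y : subgroup_set H -> H x -> H y -> H (x * y)%g.
Proof. by move=> sH hx hy; have := sH.2 _ _ hx (subgroupV sH hy); rewrite invgK. Qed.
Lemma subgroup_prodg H s : subgroup_set H -> (forall x, x \in s -> H x) -> H (prodg s).
Proof.
move=> sH; elim: s => [|x s IH] h; first by rewrite prodg_nil; case: sH.
rewrite prodg_cons; apply: subgroupM => //; first by apply: h; rewrite inE eqxx.
by apply: IH => y ys; apply: h; rewrite inE ys orbT.
Qed.

Lemma prodg_revV s : (forall x, x \in s -> (x * x)%g = 1%g) -> (prodg s)^-1%g = prodg (rev s).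
Proof.
elim: s => [|x s IH] h; first by rewrite prodg_nil invg1.
rewrite prodg_cons rev_cons prodg_rcons invgM IH; last by move=> y ys; apply: h; rewrite inE ys orbT.
congr (_ * _)%g; apply: mulg1_eq; apply: h; by rewrite inE eqxx.
Qed.

Lemma gen_subgroup_words S : (forall x, S x -> (x * x)%g = 1%g) ->
  gen_subgroup S = [set w | exists s, [set` s] `<=` S /\ w = prodg s].
Proof.
move=> inv; apply/seteqP; split.
  apply: gen_subgroup_min; last first.
    move=> x Sx; exists [:: x]; rewrite prodg_cons prodg_nil mulg1; split=> // y.
    by rewrite /= inE => /eqP ->.
  split; first by exists [::]; rewrite prodg_nil; split.
  move=> x y [s [hs ->]] [t [height ->]]; exists (s ++ rev t); split.
    by move=> z; rewrite /= mem_cat mem_rev => /orP [/hs|/height].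
  rewrite prodg_cat prodg_revV // => z zeta; apply: inv; exact: height.
move=> w [s [hs ->]]; have [sg sub] := gen_subgroupP S.
by apply: subgroup_prodg => // x xs; apply: sub; exact: hs.
Qed.
End GroupFacts.

Section Lattice.
Variable L : bilinear_lattice.
Implicit Types (a b x y : L).

Lemma zmulE (f g : zaut L) x : (f * g)%g x = f (g x). Proof. by []. Qed.
Lemma zoneE x : (1%g : zaut L) x = x. Proof. by []. Qed.
Lemma zinvK (f : zaut L) x : (f^-1)%g (f x) = x.
Proof. by rewrite -zmulE mulVg. Qed.
Lemma zKinv (f : zaut L) x : f ((f^-1)%g x) = x.
Proof. by rewrite -zmulE mulgV. Qed.

Lemma zaut0 (f : zaut L) : f 0 = 0.
Proof. by apply: (addIr (f 0)); rewrite -zaut_add !add0r. Qed.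
Lemma zautN (f : zaut L) x : f (- x) = - f x.
Proof. by apply/eqP; rewrite -addr_eq0 -zaut_add addNr zaut0. Qed.
Lemma zautMz (f : zaut L) x (k : int) : f (x *~ k) = f x *~ k.
Proof.
elim/int_rect: k => [|k IH|k IH]; rewrite ?mulr0z ?zaut0 //.
  by rewrite intS !mulrzDr !mulr1z zaut_add IH.
by rewrite intS opprD !mulrzDr !mulrN1z zaut_add IH zautN.
Qed.
Lemma zaut_sum (f : zaut L) (I : Type) (r : seq I) (P : pred I) (F : I -> L) :
  f (\sum_(i <- r | P i) F i) = \sum_(i <- r | P i) f (F i).
Proof. by apply: (big_morph f (zaut_add f) (zaut0 f)). Qed.

Lemma bform0l y : bform 0 y = 0 :> int.
Proof. by have := bformMzl 0 y 0; rewrite mulr0z mul0r. Qed.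
Lemma bform0r y : bform y 0 = 0 :> int.
Proof. by have := bformMzr y 0 0; rewrite mulr0z mul0r. Qed.
Lemma bformNl x y : bform (- x) y = - bform x y.
Proof. by have := bformMzl x y (-1); rewrite mulrN1z mulN1r. Qed.
Lemma bformNr x y : bform x (- y) = - bform x y.
Proof. by have := bformMzr x y (-1); rewrite mulrN1z mulN1r. Qed.
Lemma bform_suml (I : Type) (r : seq I) (P : pred I) (F : I -> L) y :
  bform (\sum_(i <- r | P i) F i) y = \sum_(i <- r | P i) bform (F i) y.
Proof. by apply: (big_morph (fun z => bform z y)) => [u v|]; rewrite ?bformDl ?bform0l. Qed.
Lemma bform_sumr (I : Type) (r : seq I) (P : pred I) (F : I -> L) y :
  bform y (\sum_(i <- r | P i) F i) = \sum_(i <- r | P i) bform y (F i).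
Proof. by apply: (big_morph (fun z => bform y z)) => [u v|]; rewrite ?bformDr ?bform0r. Qed.

Lemma symC x y : sym_form x y = sym_form y x.
Proof. by rewrite /sym_form addrC. Qed.
Lemma symDl x y z : sym_form (x + y) z = sym_form x z + sym_form y z.
Proof. by rewrite /sym_form bformDl bformDr addrACA. Qed.
Lemma symMl x y (k : int) : sym_form (x *~ k) y = k * sym_form x y.
Proof. by rewrite /sym_form bformMzl bformMzr mulrDr. Qed.
Lemma symNl x y : sym_form (- x) y = - sym_form x y.
Proof. by rewrite /sym_form bformNl bformNr opprD. Qed.
Lemma symDr x y z : sym_form z (x + y) = sym_form z x + sym_form z y.
Proof. by rewrite !(symC z) symDl. Qed.
Lemma symMr x y (k : int) : sym_form y (x *~ k) = k * sym_form y x.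
Proof. by rewrite !(symC y) symMl. Qed.
Lemma symNr x y : sym_form y (- x) = - sym_form y x.
Proof. by rewrite !(symC y) symNl. Qed.
Lemma symxx x : sym_form x x = 2 * bform x x.
Proof. by rewrite /sym_form mulr_natl mulr2n. Qed.

Definition refl_coef a x : int := ((2 * sym_form x a) %/ sym_form a a)%Z.

Lemma cfE a x : is_root a -> refl_coef a x * bform a a = sym_form x a.
Proof. exact: refl_coefE. Qed.

Lemma refl_coef_uniq a x k : is_root a -> k * bform a a = sym_form x a -> refl_coef a x = k.
Proof.
by move=> ra; rewrite -(cfE x ra) => /mulIf -> //; case: ra => /lt0r_neq0.
Qed.

Lemma reflE a x : is_root a -> refl a x = x - a *~ refl_coef a x.
Proof. by rewrite /refl => ra; case: pselect. Qed.

Lemma cfD a x y : is_root a -> refl_coef a (x + y) = refl_coef a x + refl_coef a y.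
Proof. by move=> ra; apply: refl_coef_uniq => //; rewrite mulrDl !cfE // symDl. Qed.
Lemma cfM a x k : is_root a -> refl_coef a (x *~ k) = k * refl_coef a x.
Proof. by move=> ra; apply: refl_coef_uniq => //; rewrite -mulrA !cfE // symMl. Qed.
Lemma cfN a x : is_root a -> refl_coef a (- x) = - refl_coef a x.
Proof. by move=> ra; apply: refl_coef_uniq => //; rewrite mulNr !cfE // symNl. Qed.
Lemma cfaa a : is_root a -> refl_coef a a = 2.
Proof. by move=> ra; apply: refl_coef_uniq => //; rewrite symxx. Qed.
Lemma refl_a a : is_root a -> refl a a = - a.
Proof. by move=> ra; rewrite reflE // cfaa // (_ : 2 = 1 + 1) // mulrzDr mulr1z opprD addrA subrr add0r. Qed.
Lemma refl_invo a : is_root a -> (refl a * refl a)%g = 1%g.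
Proof.
by move=> ra; apply: zautP => x; rewrite zmulE /refl; case: pselect => // r; exact: refl_funK.
Qed.
Lemma reflK a x : is_root a -> refl a (refl a x) = x.
Proof. by move=> ra; rewrite -zmulE refl_invo. Qed.
Lemma reflV a : is_root a -> (refl a)^-1%g = refl a.
Proof. by move=> ra; apply: mulg1_eq; exact: refl_invo. Qed.

Definition isom (w : zaut L) := forall x y, sym_form (w x) (w y) = sym_form x y.

Lemma isom_refl a : isom (refl a).
Proof.
move=> x y; have [ra|nra] := pselect (is_root a); last first.
  by rewrite /refl; case: pselect.
rewrite !reflE // -!mulrNz symDl !symDr !symMl !symMr -(cfE x ra) (symC a y) -(cfE y ra) symxx; ring.
Qed.
Lemma isom1 : isom 1%g. Proof. by []. Qed.
Lemma isomM f g : isom f -> isom g -> isom (f * g)%g.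
Proof. by move=> hf hg x y; rewrite !zmulE hf hg. Qed.
Lemma isom_bxx f x : isom f -> bform (f x) (f x) = bform x x.
Proof. by move=> h; have := h x x; rewrite !symxx => /mulfI ->. Qed.

Lemma is_rootN a : is_root a -> is_root (- a).
Proof.
case=> p d; split; first by rewrite bformNl bformNr opprK.
move=> x; have [d1 d2] := d x; rewrite !bformNl !bformNr opprK.
by rewrite !rpredN.
Qed.

Lemma root_refl a b : is_root a -> is_root b -> is_root (refl b a).
Proof.
move=> ra rb; have e := isom_bxx a (@isom_refl b); split; first by rewrite e; case: ra.
move=> x; rewrite e reflE //.
have [_ da] := ra; have [_ db] := rb.
have [dax dxa] := da x; have [dbx dxb] := db x.
have key : (bform a a %| refl_coef b a * bform b b)%Z.
  by rewrite cfE // /sym_form rpredD //; case: (da b).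
have [/dvdzP [y yE] /dvdzP [z zE]] := db x.
split; rewrite -mulrNz ?bformDl ?bformDr ?bformMzl ?bformMzr rpredD //.
  by rewrite yE mulNr rpredN mulrCA dvdz_mull.
by rewrite zE mulNr rpredN mulrCA dvdz_mull.
Qed.

Lemma refl_conj (w : zaut L) a : isom w -> is_root a -> is_root (w a) ->
  (w * refl a * w^-1)%g = refl (w a).
Proof.
move=> hw ra rwa; apply: zautP => x; rewrite !zmulE !reflE //.
rewrite zaut_add zautN zautMz zKinv; congr (_ - _ *~ _).
by apply: refl_coef_uniq => //; rewrite -(isom_bxx a hw) cfE // -[in LHS](zKinv w x) hw.
Qed.

Lemma reflNa a : is_root a -> refl (- a) = refl a.
Proof.
move=> ra; have ra' := is_rootN ra; apply: zautP => x; rewrite !reflE //.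
have -> : refl_coef (- a) x = - refl_coef a x.
  by apply: refl_coef_uniq => //; rewrite bformNl bformNr opprK symNr mulNr cfE.
by rewrite mulNrz mulrNz opprK.
Qed.

(** * Rank two: iterates of a product of two reflections *)

Section Dihedral.
Variables a b : L.
Hypotheses (ra : is_root a) (rb : is_root b).
Let p := - refl_coef a b.
Let q := - refl_coef b a.
(** The recursion for the coefficients (X, Y) of (s_a s_b)^k x - x = X a + Y b, where [al] and [be]
    are the reflection coefficients of x. It works for every x of the lattice, also outside the span
    of [a] and [b]. *)
Definition dstep (p q al be : int) (XY : int * int) : int * int :=
  let Y' := - XY.2 + q * XY.1 - be in (- XY.1 + p * Y' - al, Y').

Lemma dihedral_iter x k : ((refl a * refl b) ^+ k)%g x =
  x + a *~ (iter k (dstep p q (refl_coef a x) (refl_coef b x)) (0, 0)).1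
    + b *~ (iter k (dstep p q (refl_coef a x) (refl_coef b x)) (0, 0)).2.
Proof.
elim: k => [|k IH]; first by rewrite expg0 zoneE /= !mulr0z !addr0.
rewrite expgS !zmulE IH iterS.
case: (iter k _ _) => X Y /=.
have e1 : refl b (x + a *~ X + b *~ Y) = x + a *~ X + b *~ (- Y + q * X - refl_coef b x).
  rewrite reflE // !cfD // !cfM // cfaa // -addrA -mulrNz -mulrzDr; congr (_ + _ *~ _).
  by rewrite /q; ring.
rewrite e1 reflE // !cfD // !cfM // cfaa //.
rewrite addrAC; congr (_ + _).
rewrite -addrA -mulrNz -mulrzDr; congr (_ + _ *~ _).
by rewrite /p; ring.
Qed.

(** The types A1 x A1, A2, B2 and G2: for these values of p and q the recursion returns to (0, 0)
    after 2, 3, 4 or 6 steps, for all [al] and [be]. *)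
Lemma dihedral_order : (p * q = 0 /\ (p = 0 /\ q = 0) -> ((refl a * refl b) ^+ 2)%g = 1%g) /\
  (p = 1 /\ q = 1 -> ((refl a * refl b) ^+ 3)%g = 1%g) /\
  ((p = 1 /\ q = 2) \/ (p = 2 /\ q = 1) -> ((refl a * refl b) ^+ 4)%g = 1%g) /\
  ((p = 1 /\ q = 3) \/ (p = 3 /\ q = 1) -> ((refl a * refl b) ^+ 6)%g = 1%g).
Proof.
have key k : (forall al be, iter k (dstep p q al be) (0, 0) = (0, 0)) ->
    ((refl a * refl b) ^+ k)%g = 1%g.
  by move=> h; apply: zautP => x; rewrite dihedral_iter h /= !mulr0z !addr0.
split=> [[_ [hp hq]]|]; first by apply: key => al be; rewrite hp hq /dstep /=; congr pair; ring.
split=> [[hp hq]|]; first by apply: key => al be; rewrite hp hq /dstep /=; congr pair; ring.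
split=> [[[hp hq]|[hp hq]]|[[hp hq]|[hp hq]]];
  by apply: key => al be; rewrite hp hq /dstep /=; congr pair; ring.
Qed.
End Dihedral.
End Lattice.

(** * The Weyl group as a Coxeter group *)

Section Cartan.
Variable C : cartan_lattice.

Definition rk := size (cl_seq C).
Definition sroot (i : 'I_rk) : C := (cl_seq C)`_i.
Notation e := sroot.

Lemma sroot_in i : e i \in cl_seq C. Proof. exact: mem_nth. Qed.
Lemma sroot_root i : is_root (e i).
Proof. by case: (cl_complete C) => -[h _] _; apply: h; exact: sroot_in. Qed.
Lemma sroot_tri (i j : 'I_rk) : (j < i)%N -> bform (e i) (e j) = 0.
Proof. by case: (cl_complete C) => -[_ h] _ ji; apply: h; rewrite ji /=. Qed.
Lemma sroot_orth (i j : 'I_rk) : i != j -> bform (e i) (e j) <= 0.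
Proof. by move=> ij; exact: (@cl_orthogonal C i j (ltn_ord i) (ltn_ord j) ij). Qed.
Lemma sroot_pos i : 0 < bform (e i) (e i). Proof. by case: (sroot_root i). Qed.

Lemma lat_span (x : C) : exists c : 'I_rk -> int, x = \sum_i e i *~ c i.
Proof. by case: (cl_complete C) => _ /(_ x) [c ->]; exists c. Qed.

Lemma sroot_free (c : 'I_rk -> int) : \sum_i e i *~ c i = 0 -> forall i, c i = 0.
Proof.
move=> h; suff H (k : nat) (i : 'I_rk) : (rk - i <= k)%N -> c i = 0.
  by move=> i; exact: (H (rk - i)%N).
elim: k i => [|k IH] i hk; first by have := ltn_ord i; rewrite -subn_gt0; lia.
have := congr1 (bform (e i)) h; rewrite bform_sumr bform0r (bigD1 i) //= big1 ?addr0.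
  rewrite bformMzr => /eqP; rewrite mulf_eq0 => /orP [/eqP //|].
  by have := sroot_pos i; case: eqP => // ->.
move=> j ji; rewrite bformMzr; have [lt|le] := ltnP i j.
  by rewrite IH ?mul0r //; have := ltn_ord j; lia.
by rewrite sroot_tri ?mulr0 // ltn_neqAle le andbT; exact: ji.
Qed.

Definition coord (x : C) : 'I_rk -> int := sval (cid (lat_span x)).
Lemma coordE x : x = \sum_i e i *~ coord x i.
Proof. exact: (svalP (cid (lat_span x))). Qed.
Lemma coord_uniq x (c : 'I_rk -> int) : x = \sum_i e i *~ c i -> coord x = c.
Proof.
move=> h; apply/funext => i; apply/eqP; rewrite -subr_eq0; apply/eqP; move: i.
apply: sroot_free; under eq_bigr do rewrite mulrzBr.
by rewrite sumrB -coordE -h subrr.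
Qed.
Lemma coordD x y i : coord (x + y) i = coord x i + coord y i.
Proof.
rewrite (@coord_uniq _ (fun i => coord x i + coord y i)) //.
under eq_bigr do rewrite mulrzDr.
by rewrite big_split /= -!coordE.
Qed.
Lemma coordM x k i : coord (x *~ k) i = k * coord x i.
Proof.
rewrite (@coord_uniq _ (fun i => k * coord x i)) //.
rewrite [in LHS](coordE x) mulrz_suml; apply: eq_bigr => j _.
by rewrite -mulrzA mulrC.
Qed.
Lemma coordN x i : coord (- x) i = - coord x i.
Proof. by rewrite -mulrN1z coordM mulN1r. Qed.
Lemma coord0 i : coord 0 i = 0.
Proof. by have := coordM 0 0 i; rewrite mulr0z mul0r. Qed.
Lemma coord_e i j : coord (e i) j = (i == j)%:Z.
Proof.
rewrite (@coord_uniq _ (fun j => (i == j)%:Z)) //.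
rewrite (bigD1 i) //= eqxx mulr1z big1 ?addr0 // => k; rewrite eq_sym => /negPf ->.
by rewrite mulr0z.
Qed.
Lemma coord_inj x y : (forall i, coord x i = coord y i) -> x = y.
Proof. by move=> h; rewrite (coordE x) (coordE y); apply: eq_bigr => i _; rewrite h. Qed.

Definition nonneg (x : C) := forall i, 0 <= coord x i.
Lemma nnD x y : nonneg x -> nonneg y -> nonneg (x + y).
Proof. by move=> hx hy i; rewrite coordD addr_ge0. Qed.
Lemma nnM x k : 0 <= k -> nonneg x -> nonneg (x *~ k).
Proof. by move=> k0 hx i; rewrite coordM mulr_ge0. Qed.
Lemma nonneg_e i : nonneg (e i).
Proof. by move=> j; rewrite coord_e. Qed.
Lemma nonneg_anti x : nonneg x -> nonneg (- x) -> x = 0.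
Proof.
move=> h h'; apply: coord_inj => i; rewrite coord0; apply/eqP; rewrite eq_le h andbT.
by have := h' i; rewrite coordN oppr_ge0.
Qed.

Definition sr (i : 'I_rk) : zaut C := refl (e i).
Definition act (u : seq 'I_rk) : zaut C := prodg (map sr u).
Definition word_cong (u v : seq 'I_rk) := cox_cong (simple_refl C) (map sr u) (map sr v).

Lemma sr_in i : simple_refl C (sr i).
Proof. by exists (e i) => //=; exact: sroot_in. Qed.
Lemma simple_reflP s : simple_refl C s -> exists i, s = sr i.
Proof.
case=> x /= /(nthP 0) [i hi <-] <-; by exists (Ordinal hi).
Qed.
Lemma act_cat u v : act (u ++ v) = (act u * act v)%g.
Proof. by rewrite /act map_cat prodg_cat. Qed.
Lemma act_cons i u : act (i :: u) = (sr i * act u)%g.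
Proof. by rewrite /act /= prodg_cons. Qed.
Lemma act_nil : act [::] = 1%g. Proof. exact: prodg_nil. Qed.
Lemma act_rcons i u : act (rcons u i) = (act u * sr i)%g.
Proof. by rewrite -cats1 act_cat act_cons act_nil mulg1. Qed.
Lemma sr_invo i : (sr i * sr i)%g = 1%g. Proof. exact: refl_invo (sroot_root i). Qed.
Lemma act_rev u : act (rev u) = (act u)^-1%g.
Proof.
rewrite /act prodg_revV -?map_rev // => x /mapP [i _ ->]; exact: sr_invo.
Qed.

Lemma word_cong_refl u : word_cong u u. Proof. exact: cox_cong_refl. Qed.
Lemma word_cong_sym u v : word_cong u v -> word_cong v u. Proof. exact: cox_cong_sym. Qed.
Lemma word_cong_trans u v w : word_cong u v -> word_cong v w -> word_cong u w. Proof. exact: cox_cong_trans. Qed.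
Lemma word_cong_ctx a b u v : word_cong u v -> word_cong (a ++ u ++ b) (a ++ v ++ b).
Proof. by rewrite /word_cong !map_cat; exact: cox_cong_ctx. Qed.
Lemma word_cong_act u v : word_cong u v -> act u = act v. Proof. exact: cox_cong_prodg. Qed.
Lemma word_cong_odd u v : word_cong u v -> odd (size u) = odd (size v).
Proof. by move/cox_cong_odd; rewrite !size_map. Qed.
Lemma word_cong_ii i : word_cong [:: i; i] [::].
Proof.
have h : has_order (sr i * sr i)%g 1.
  by split=> // k; rewrite sr_invo dvd1n; split=> // _; rewrite expg1n.
by have := cox_cong_rel [::] [::] (sr_in i) (sr_in i) h.
Qed.
Lemma word_cong_rel i j m : has_order (sr i * sr j)%g m -> word_cong (flatten (nseq m [:: i; j])) [::].
Proof.
move=> h; have := cox_cong_rel [::] [::] (sr_in i) (sr_in j) h.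
by rewrite /word_cong /= cats0 map_flatten map_nseq.
Qed.
Lemma word_cong_catr u v w : word_cong u v -> word_cong (u ++ w) (v ++ w).
Proof. exact: (@word_cong_ctx [::] w). Qed.
Lemma word_cong_catl u v w : word_cong u v -> word_cong (w ++ u) (w ++ v).
Proof. by move=> h; have := @word_cong_ctx w [::] _ _ h; rewrite !cats0. Qed.
Lemma word_cong_rev u : word_cong (u ++ rev u) [::].
Proof.
elim: u => [|i u IH]; first exact: word_cong_refl.
rewrite rev_cons cat_cons -cats1 catA.
apply: (@word_cong_trans _ [:: i; i]); last exact: word_cong_ii.
exact: (@word_cong_ctx [:: i] [:: i] _ _ IH).
Qed.
Lemma word_cong_cancel u v : word_cong (u ++ v) [::] -> word_cong u (rev v).
Proof.
move=> h; have h1 : word_cong (v ++ rev v) [::] := word_cong_rev v.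
have := word_cong_catl u h1; rewrite cats0 => /word_cong_sym h2; apply: word_cong_trans h2 _.
by rewrite catA; exact: (word_cong_catr (rev v) h).
Qed.

(** Minimal length within a class of the word congruence rather than among the words of one group
    element: that the two agree is [act_faithful], whose proof rests on reduced words. *)
Definition reduced u := forall v, word_cong u v -> (size u <= size v)%N.
Lemma reduced_ex u : exists v, word_cong u v /\ reduced v.
Proof.
have [n] := ubnP (size u); elim: n u => // n IH u lt.
have [r|nr] := pselect (reduced u); first by exists u; split=> //; exact: word_cong_refl.
have [v /not_implyP [hv /negP sv]] : exists v, ~ (word_cong u v -> (size u <= size v)%N).
  by apply/existsNP.
have [|w [h1 h2]] := IH v; first by rewrite -ltnNge in sv; lia.
by exists w; split=> //; exact: word_cong_trans h1.
Qed.
Lemma reduced_mid a u b : reduced (a ++ u ++ b) -> reduced u.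
Proof.
move=> r v h; have := r _ (word_cong_ctx a b h); rewrite !size_cat; lia.
Qed.
Lemma reduced_prefix u i : reduced (rcons u i) -> reduced u.
Proof. by rewrite -cats1 => /(@reduced_mid [::]). Qed.
Lemma reduced_same u v : reduced u -> word_cong u v -> size u = size v -> reduced v.
Proof. by move=> r h e w /(word_cong_trans h) /r; rewrite e. Qed.
(** The relators have even length, so by parity a shorter word has at most [size u - 1] letters;
    fewer are impossible, since appending [i] once more gives a word congruent to the reduced
    [u]. *)
Lemma not_reduced_drop u i : reduced u -> ~ reduced (rcons u i) ->
  exists v, word_cong (rcons u i) v /\ size u = (size v).+1.
Proof.
move=> r nr; have [v /not_implyP [hv /negP sv]] : exists v, ~ (word_cong (rcons u i) v -> (size (rcons u i) <= size v)%N).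
  by apply/existsNP.
exists v; split=> //; have := word_cong_odd hv; rewrite size_rcons /= -ltnNge in sv *.
have : (size u <= (size v).+1)%N.
  have h : word_cong (rcons v i) u.
    apply: word_cong_sym; have := word_cong_ii i => /word_cong_sym /(word_cong_catl u); rewrite cats0 => h; apply: word_cong_trans h _.
    by have := word_cong_catr [:: i] hv; rewrite -!cats1 -catA.
  by have := r _ (word_cong_sym h); rewrite size_rcons.
have [->//|] := eqVneq (size u) (size v).+1.
move=> ne le; have -> : size v = size u by lia.
by rewrite /=; case: (odd _).
Qed.

(* alternating words: alt i j k has length k, and ends with j *)
Fixpoint alt (i j : 'I_rk) (k : nat) : seq 'I_rk :=
  if k is k'.+1 then rcons (alt j i k') j else [::].
Lemma size_alt i j k : size (alt i j k) = k.
Proof. by elim: k i j => //= k IH i j; rewrite size_rcons IH. Qed.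

Lemma alt_of i j w : reduced (rcons w i) -> (forall x, x \in w -> x = i \/ x = j) ->
  w = alt i j (size w).
Proof.
elim/last_ind: w i j => [|w x IH] i j //= r h.
have xin : x \in rcons w x by rewrite mem_rcons inE eqxx.
have [xi|xj] := h x xin.
  exfalso; subst x; have := r w; rewrite -!cats1 -catA => /(_ _).
  have := word_cong_catl w (word_cong_ii i); rewrite cats0 => h1 /(_ h1); rewrite !size_cat /=; lia.
subst x; rewrite size_rcons /=; congr rcons; apply: IH.
  by move: r => /reduced_prefix.
move=> y yw; have yin : y \in rcons w j by rewrite mem_rcons inE yw orbT.
by have [->|->] := h y yin; [right | left].
Qed.

Lemma alt_suffix i j k l : (l <= k)%N -> exists a, alt i j k = a ++ alt i j l.
Proof.
elim: l i j k => [|l IH] i j k le; first by exists (alt i j k); rewrite cats0.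
case: k le => // k le; have [a ha] := IH j i k le.
by exists a; rewrite /= ha rcons_cat.
Qed.

Lemma flatten_alt i j m : flatten (nseq m [:: i; j]) = alt i j m.*2.
Proof.
elim: m => //= m IH; rewrite -IH -!cats1 -catA /=.
elim: m {IH} => //= m IH; by rewrite IH.
Qed.

Lemma alt_cat i j k l : alt i j (k + l) =
  (if odd l then alt j i k else alt i j k) ++ alt i j l.
Proof.
elim: l i j => [|l IH] i j; first by rewrite addn0 cats0.
by rewrite addnS /= IH -rcons_cat; case: (odd l).
Qed.

Lemma rev_alt i j k : rev (alt i j k) = if odd k then alt i j k else alt j i k.
Proof.
have hd k' : forall i j, alt i j k'.+1 = (if odd k' then i else j) :: alt i j k'.
  elim: k' => // k' IH i' j'; rewrite [LHS]/= -/(alt j' i' k'.+1) IH /=.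
  by case: (odd k').
elim: k i j => // k IH i j.
rewrite hd rev_cons IH /=; have := hd k i j; rewrite /=.
by case: (odd k).
Qed.

Lemma braid i j m : has_order (sr i * sr j)%g m -> word_cong (alt i j m) (alt j i m).
Proof.
move=> /word_cong_rel; rewrite flatten_alt -addnn alt_cat; case: (boolP (odd m)) => om.
  by move/word_cong_cancel; rewrite rev_alt om => /word_cong_sym.
by move/word_cong_cancel; rewrite rev_alt (negPf om).
Qed.

(** The braid relation turns the last m letters before the final [i] into a word that ends in [i],
    and two letters cancel. *)
Lemma alt_not_reduced i j k m : has_order (sr i * sr j)%g m -> (0 < m <= k)%N ->
  ~ reduced (rcons (alt i j k) i).
Proof.
move=> ho /andP [m0 mk] r; have [a ha] := alt_suffix i j mk.
have := r (a ++ alt i j m.-1); rewrite ha size_rcons !size_cat !size_alt.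
case: m m0 ho mk ha => // m _ ho mk ha; rewrite (_ : m.+1.-1 = m) // => H.
have : (a ++ alt i j m.+1 = alt i j k) by [].
suff /H : word_cong (rcons (a ++ alt i j m.+1) i) (a ++ alt i j m) by lia.
rewrite -cats1 -catA; apply: word_cong_catl.
apply: (@word_cong_trans _ (alt j i m.+1 ++ [:: i])); first by apply: word_cong_catr; exact: braid.
rewrite /= -cats1 -catA /=.
by have := word_cong_catl (alt i j m) (word_cong_ii i); rewrite cats0.
Qed.

(** The negative of the usual Cartan integer, hence nonnegative off the diagonal. *)
Definition cartan_entry i j : int := - refl_coef (e i) (e j).
Lemma ct_ge0 i j : i != j -> 0 <= cartan_entry i j.
Proof.
move=> ij; have h := cfE (e j) (sroot_root i).
have : sym_form (e j) (e i) <= 0.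
  by rewrite /sym_form; have := sroot_orth ij; have := sroot_orth (i:=j) (j:=i); rewrite eq_sym ij => /(_ isT); lia.
by rewrite -h /cartan_entry; have := sroot_pos i; nia.
Qed.
Lemma ct0 i j : cartan_entry i j = 0 -> cartan_entry j i = 0.
Proof.
rewrite /cartan_entry => h; have h1 := cfE (e j) (sroot_root i); have h2 := cfE (e i) (sroot_root j).
have {}h1 : sym_form (e j) (e i) = 0.
  by rewrite -h1 (_ : refl_coef (e i) (e j) = 0) ?mul0r //; lia.
move: h2; rewrite symC h1 => /eqP; rewrite mulf_eq0 => /orP [/eqP ->|]; first by rewrite oppr0.
by have := sroot_pos j; case: eqP => // ->.
Qed.

Lemma sr_e i j : sr i (e j) = e j + e i *~ cartan_entry i j.
Proof. by rewrite /sr reflE ?mulrNz //; exact: sroot_root. Qed.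
Lemma sr_ei i : sr i (e i) = - e i.
Proof. by rewrite /sr refl_a //; exact: sroot_root. Qed.

Lemma order_pq i j : i != j -> cartan_entry i j * cartan_entry j i < 4 ->
  exists m0, [/\ (m0 = 2 /\ cartan_entry i j = 0 /\ cartan_entry j i = 0)%N \/ (m0 = 3 /\ cartan_entry i j = 1 /\ cartan_entry j i = 1)%N \/
     (m0 = 4 /\ ((cartan_entry i j = 1 /\ cartan_entry j i = 2) \/ (cartan_entry i j = 2 /\ cartan_entry j i = 1)))%N \/
     (m0 = 6 /\ ((cartan_entry i j = 1 /\ cartan_entry j i = 3) \/ (cartan_entry i j = 3 /\ cartan_entry j i = 1)))%N
   & has_order (sr i * sr j)%g m0].
Proof.
move=> ij h4; have p0 := ct_ge0 ij; have q0 : 0 <= cartan_entry j i by apply: ct_ge0; rewrite eq_sym.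
have pq0 := @ct0 i j; have qp0 := @ct0 j i.
have [h2 [h3 [h4' h6]]] := dihedral_order (sroot_root i) (sroot_root j).
(* The iteration is applied to x = [e i], whose reflection coefficients are 2 at [e i] and
   [- cartan_entry j i] at [e j]; as [e i] and [e j] are independent, nonzero coefficients show that
   the power is not 1. *)
have ne k X Y : iter k (dstep (cartan_entry i j) (cartan_entry j i) 2 (- cartan_entry j i)) (0, 0) = (X, Y) ->
    (X, Y) <> (0, 0) -> ((sr i * sr j) ^+ k)%g <> 1%g.
  move=> E XY /(congr1 (fun f : zaut C => f (e i))).
  rewrite (dihedral_iter (sroot_root i) (sroot_root j)) cfaa; last exact: sroot_root.
  rewrite -/(cartan_entry i j) -/(cartan_entry j i) -[refl_coef (e j) (e i)]opprK -/(cartan_entry j i) E /= => hh; apply: XY.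
  have := congr1 (fun x => coord x i) hh; have := congr1 (fun x => coord x j) hh.
  rewrite !coordD !coordM !coord_e !eqxx (eq_sym j i) (negPf ij) /= => h1' h2'; congr pair; lia.
have ord m : (0 < m)%N -> ((sr i * sr j) ^+ m)%g = 1%g ->
   (forall k, (0 < k < m)%N -> (k %| m)%N -> ((sr i * sr j) ^+ k)%g <> 1%g) -> has_order (sr i * sr j)%g m.
  move=> m0 gm hk; split=> // k; split; last first.
    by case/dvdnP => c ->; rewrite mulnC expgnA gm expg1n.
  (* The exponents that kill the element are closed under gcd, so only the proper divisors of [m]
     have to be excluded. *)
  move=> gk; have gd : ((sr i * sr j) ^+ (gcdn k m))%g = 1%g.
    have [->|k0] := posnP k; first by rewrite gcd0n.
    have [a b E _] := egcdnP m k0.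
    have := congr1 (fun n => ((sr i * sr j) ^+ n)%g) E.
    by rewrite (mulnC a) expgnA gk expg1n expgnDr (mulnC b) expgnA gm expg1n mul1g.
  have d := dvdn_gcdr k m; have g0 : (0 < gcdn k m)%N by rewrite gcdn_gt0 m0 orbT.
  have [E|neq] := eqVneq (gcdn k m) m; first by rewrite -E dvdn_gcdl.
  by case: (hk (gcdn k m)) => //; rewrite g0 ltn_neqAle neq dvdn_leq.
have div2 k : (0 < k < 2)%N -> k = 1%N by lia.
have div3 k : (0 < k < 3)%N -> (k %| 3)%N -> k = 1%N by case: k => [|[|[|]]].
have div4 k : (0 < k < 4)%N -> (k %| 4)%N -> k = 1%N \/ k = 2%N by case: k => [|[|[|[|]]]] //; lia.
have div6 k : (0 < k < 6)%N -> (k %| 6)%N -> k = 1%N \/ k = 2%N \/ k = 3%N.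
  by case: k => [|[|[|[|[|[|]]]]]] //; lia.
have : (cartan_entry i j = 0 /\ cartan_entry j i = 0) \/ (cartan_entry i j = 1 /\ cartan_entry j i = 1) \/
  ((cartan_entry i j = 1 /\ cartan_entry j i = 2) \/ (cartan_entry i j = 2 /\ cartan_entry j i = 1)) \/
  ((cartan_entry i j = 1 /\ cartan_entry j i = 3) \/ (cartan_entry i j = 3 /\ cartan_entry j i = 1)) by nia.
case=> [[c1 c2]|[[c1 c2]|[c|c]]].
- exists 2%N; split; first by left.
  apply: ord => //; first by apply: h2; rewrite -/(cartan_entry i j) -/(cartan_entry j i) c1 c2.
  by move=> k /div2 -> _; apply: (ne _ (-2) 0) => //; rewrite c1 c2.
- exists 3%N; split; first by right; left.
  apply: ord => //; first by apply: h3.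
  by move=> k /div3 H /H ->; apply: (ne _ (-1) 1) => //; rewrite c1 c2.
- exists 4%N; split; first by right; right; left.
  apply: ord => //; first by apply: h4'.
  by move=> k /div4 H /H [|] ->; case: c => -[c1 c2]; eapply ne; rewrite ?c1 ?c2 //=.
- exists 6%N; split; first by right; right; right.
  apply: ord => //; first by apply: h6.
  by move=> k /div6 H /H [|[|]] ->; case: c => -[c1 c2]; eapply ne; rewrite ?c1 ?c2 //=.
Qed.
End Cartan.

(** * Positivity of real roots and the Coxeter presentation *)

Section Positivity.
Variable C : cartan_lattice.
Notation e := (@sroot C).
Notation sr := (@sr C).
Notation act := (@act C).
Notation nonneg := (@nonneg C).
Notation word_cong := (@word_cong C).
Notation cartan_entry := (@cartan_entry C).
Notation alt := (@alt C).
Notation coord := (@coord C).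

Lemma act_alt_rec i j k :
  act (alt i j k.+2) (e i) = act (alt j i k.+1) (e j) *~ cartan_entry j i - act (alt i j k) (e i).
Proof.
rewrite [alt i j k.+2]/= act_rcons zmulE sr_e zaut_add zautMz addrC; congr (_ + _).
by rewrite /= act_rcons zmulE sr_ei zautN.
Qed.

Definition cone2 i j (x : C) := exists a b : int, [/\ 0 <= a, 0 <= b & x = e i *~ a + e j *~ b].

Lemma alt_cone_big i j k : i != j -> 4 <= cartan_entry i j * cartan_entry j i ->
  cone2 i j (act (alt i j k) (e i)).
Proof.
move=> ij h4.
(* The invariant [2 * a <= cartan_entry j i * a'] says that the next coefficient
   [cartan_entry j i * a' - a] of the recursion is at least [a]. It reproduces itself because the
   product of the two Cartan entries is at least 4. *)
have H k' : forall i j, i != j -> 4 <= cartan_entry i j * cartan_entry j i ->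
   exists a b a' b' : int, [/\ act (alt i j k') (e i) = e i *~ a + e j *~ b,
     act (alt j i k'.+1) (e j) = e i *~ a' + e j *~ b', 0 <= a, 0 <= b & 2 * a <= cartan_entry j i * a' /\ 2 * b <= cartan_entry j i * b'].
  elim: k' => [|k' IH] {}i {}j {}ij {}h4.
    have p0 := ct_ge0 ij; have q0 : 0 <= cartan_entry j i by apply: ct_ge0; rewrite eq_sym.
    exists 1, 0, (cartan_entry i j), 1; split=> //.
    - by rewrite /= act_nil zoneE mulr1z mulr0z addr0.
    - by rewrite /= act_cons act_nil mulg1 sr_e addrC mulr1z.
    - by split; nia.
  have ji : j != i by rewrite eq_sym.
  have h4' : 4 <= cartan_entry j i * cartan_entry i j by rewrite mulrC.
  have p0 := ct_ge0 ij; have q0 := ct_ge0 ji.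
  have [b [a [b' [a' [hA hA' b0 a0 [h1 h2]]]]]] := IH j i ji h4'.
  have pa : 0 <= a' by have cp : 0 < cartan_entry i j by [nia]; rewrite -(pmulr_rge0 a' cp); lia.
  have pb : 0 <= b' by have cp : 0 < cartan_entry i j by [nia]; rewrite -(pmulr_rge0 b' cp); lia.
  have u1 : 0 <= cartan_entry j i * (cartan_entry i j * a' - 2 * a) by apply: mulr_ge0 => //; lia.
  have u2 : 0 <= cartan_entry j i * (cartan_entry i j * b' - 2 * b) by apply: mulr_ge0 => //; lia.
  have u3 : 0 <= (cartan_entry i j * cartan_entry j i - 4) * a' by apply: mulr_ge0 => //; lia.
  have u4 : 0 <= (cartan_entry i j * cartan_entry j i - 4) * b' by apply: mulr_ge0 => //; lia.
  exists a', b', (cartan_entry i j * a' - a), (cartan_entry i j * b' - b); split=> //.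
  - by rewrite hA' addrC.
  - rewrite act_alt_rec hA' hA mulrzDl -!mulrzA !mulrzBr opprD.
    by rewrite (mulrC (cartan_entry i j) a') (mulrC (cartan_entry i j) b') addrACA addrC.
  - by split; lia.
by have [a [b [_ [_ [h _ a0 b0 _]]]]] := H k i j ij h4; exists a, b.
Qed.

Lemma alt_cone i j k : i != j -> reduced (rcons (alt i j k) i) ->
  cone2 i j (act (alt i j k) (e i)).
Proof.
move=> ij r; have ji : j != i by rewrite eq_sym.
have [h4|h4] := lerP 4 (cartan_entry i j * cartan_entry j i); first exact: alt_cone_big.
have [m [hm ho]] := order_pq ij h4.
have m0 : (0 < m)%N by case: ho.
have km : (k < m)%N by rewrite ltnNge; apply/negP => mk; apply: (alt_not_reduced ho _ r); rewrite m0.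
have b0 x y : act (alt x y 0) (e x) = e x by rewrite act_nil zoneE.
have b1 x y : act (alt x y 1) (e x) = e x + e y *~ cartan_entry y x.
  by rewrite /= act_cons act_nil mulg1 sr_e.
have A0 : act (alt i j 0) (e i) = e i *~ 1 + e j *~ 0 by rewrite b0 mulr1z mulr0z addr0.
have B0 : act (alt j i 0) (e j) = e i *~ 0 + e j *~ 1 by rewrite b0 mulr1z mulr0z add0r.
have A1 : act (alt i j 1) (e i) = e i *~ 1 + e j *~ cartan_entry j i by rewrite b1 mulr1z.
have B1 : act (alt j i 1) (e j) = e i *~ cartan_entry i j + e j *~ 1 by rewrite b1 mulr1z addrC.
have AS k' (a b a' b' : int) : act (alt i j k') (e i) = e i *~ a + e j *~ b ->
    act (alt j i k'.+1) (e j) = e i *~ a' + e j *~ b' ->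
    act (alt i j k'.+2) (e i) = e i *~ (cartan_entry j i * a' - a) + e j *~ (cartan_entry j i * b' - b).
  move=> h1 h2; rewrite act_alt_rec h1 h2 mulrzDl -!mulrzA !mulrzBr opprD addrACA.
  by rewrite (mulrC a') (mulrC b').
have BS k' (a b a' b' : int) : act (alt j i k') (e j) = e i *~ a + e j *~ b ->
    act (alt i j k'.+1) (e i) = e i *~ a' + e j *~ b' ->
    act (alt j i k'.+2) (e j) = e i *~ (cartan_entry i j * a' - a) + e j *~ (cartan_entry i j * b' - b).
  move=> h1 h2; rewrite act_alt_rec h1 h2 mulrzDl -!mulrzA !mulrzBr opprD addrACA.
  by rewrite (mulrC a') (mulrC b').
have A2 := AS _ _ _ _ _ A0 B1; have B2 := BS _ _ _ _ _ B0 A1.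
have A3 := AS _ _ _ _ _ A1 B2; have B3 := BS _ _ _ _ _ B1 A2.
have A4 := AS _ _ _ _ _ A2 B3; have B4 := BS _ _ _ _ _ B2 A3.
have A5 := AS _ _ _ _ _ A3 B4.
clear AS BS B0 B1 B2 B3 B4.
case: hm => [[? [cp cq]]|[[? [cp cq]]|[[? [[cp cq]|[cp cq]]]|[? [[cp cq]|[cp cq]]]]]]; subst m;
  rewrite cp cq in A1 A2 A3 A4 A5;
  case: k km {r} => [|[|[|[|[|[|k]]]]]] // _;
  by [eexists; eexists; split; [| |exact: A0] | eexists; eexists; split; [| |exact: A1] |
      eexists; eexists; split; [| |exact: A2] | eexists; eexists; split; [| |exact: A3] |
      eexists; eexists; split; [| |exact: A4] | eexists; eexists; split; [| |exact: A5]].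
Qed.

Lemma word_cong_act_e u v x : word_cong u v -> act u x = act v x.
Proof. by move/word_cong_act => ->. Qed.

(** Write [u] as v w, where w uses only [i] and the last letter [j] of [u], with v as short as
    possible. By induction v sends [e i] and [e j] to nonnegative vectors, and w sends [e i] into
    the cone of these two by the rank-two computation. *)
Lemma reduced_pos u i : reduced (rcons u i) -> nonneg (act u (e i)).
Proof.
have [n] := ubnP (size u); elim: n u i => // n IH u i lt r.
have ru := reduced_prefix r.
case/lastP: u lt r ru => [|u' j] lt r ru; first by rewrite act_nil; exact: nonneg_e.
have ji : j != i.
  apply/eqP => ji; subst j; have := r u'; rewrite -!cats1 -catA.
  have := word_cong_catl u' (word_cong_ii i); rewrite cats0 => h1 /(_ h1); rewrite !size_cat /=; lia.
pose u := rcons u' j.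
pose dec (k : nat) := exists v w, [/\ word_cong u (v ++ w), size u = (size v + size w)%N,
  (forall x, x \in w -> x = i \/ x = j) & size v = k].
have dec_u' : dec (size u').
  exists u', [:: j]; split=> //.
  - by rewrite cats1; exact: word_cong_refl.
  - by rewrite size_rcons /= addn1.
  - by move=> x; rewrite inE => /eqP ->; right.
have exd : exists k, `[< dec k >] by exists (size u'); apply/asboolP.
have [k /asboolP [v [w [huv sz hw vk]]] kmin] := ex_minnP exd.
have ksz : (k <= size u')%N by apply: kmin; apply/asboolP.
have rvw : reduced (v ++ w) by apply: (reduced_same ru huv); rewrite size_cat.
have rv : reduced v by apply: (@reduced_mid _ [::] v w).
(* Otherwise the letter x could be moved from v to the front of w, making v shorter. *)
have red x : x = i \/ x = j -> reduced (rcons v x).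
  move=> xij; apply: contrapT => nr.
  have [v' [hv' sv']] := not_reduced_drop rv nr.
  have : (k <= size v')%N.
    apply: kmin; apply/asboolP; exists v', (x :: w); split=> //.
    - apply: word_cong_trans huv _; apply: (@word_cong_trans _ _ (rcons v x ++ x :: w)).
        rewrite cat_rcons; apply: word_cong_catl; apply: word_cong_sym; exact: (word_cong_catr w (word_cong_ii x)).
      exact: word_cong_catr.
    - by rewrite sz sv' /= addnS.
    - by move=> y; rewrite inE => /orP [/eqP ->|/hw].
  by rewrite -vk sv' ltnn.
have sv : (size v < n)%N by move: lt; rewrite size_rcons; lia.
have pi := IH _ _ sv (red i (or_introl erefl)).
have pj := IH _ _ sv (red j (or_intror erefl)).
have rwi : reduced (rcons w i).
  apply: (@reduced_mid _ v (rcons w i) [::]); rewrite cats0 -rcons_cat.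
  apply: (reduced_same r); last by rewrite !size_rcons size_cat -sz size_rcons.
  by rewrite -[rcons (rcons _ _) i]cats1 -[rcons (v ++ w) i]cats1; exact: word_cong_catr huv.
rewrite (word_cong_act_e _ huv) act_cat zmulE (alt_of rwi hw).
have [||a [b [a0 b0 ->]]] := @alt_cone i j (size w).
- by rewrite eq_sym.
- by rewrite -(alt_of rwi hw).
by rewrite zaut_add !zautMz; apply: nnD; apply: nnM.
Qed.

Lemma sroot_ne0 i : e i <> 0.
Proof. by move=> /(congr1 (fun x => coord x i)); rewrite coord_e eqxx coord0. Qed.

(** A nonempty reduced word u' i acting trivially would give [e i] = - u' ([e i]), a nonpositive
    vector. *)
Lemma act_faithful u v : act u = act v -> word_cong u v.
Proof.
move=> h; have h1 : act (u ++ rev v) = 1%g by rewrite act_cat act_rev h mulgV.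
suff H w : act w = 1%g -> word_cong w [::].
  by have := word_cong_cancel (H _ h1); rewrite revK.
move=> hw; have [w' [hww' r]] := reduced_ex w.
case/lastP: w' r hww' => [|u' i] r hww'; first by [].
exfalso; have hx := reduced_pos r.
have E : - act u' (e i) = e i.
  by rewrite -zautN -sr_ei -zmulE -act_rcons -(word_cong_act hww') hw.
apply: (@sroot_ne0 i); rewrite -E (nonneg_anti hx) ?oppr0 // E; exact: nonneg_e.
Qed.

Lemma weylE : weyl C = [set w | exists u, w = act u].
Proof.
rewrite /weyl gen_subgroup_words; last by move=> _ /simple_reflP [i ->]; exact: sr_invo.
apply/seteqP; split=> [w [s [hs ->]]|w [u ->]]; last first.
  exists (map sr u); split=> // x /= /mapP [i _ ->]; exact: sr_in.
elim: s hs => [|x s IH] hs; first by exists [::]; rewrite act_nil prodg_nil.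
have [|u hu] := IH; first by move=> y ys; apply: hs; rewrite /= inE ys orbT.
have /simple_reflP [i xi] : simple_refl C x by apply: hs; rewrite /= inE eqxx.
by exists (i :: u); rewrite act_cons prodg_cons xi hu.
Qed.

Lemma weyl_act u : weyl C (act u). Proof. by rewrite weylE; exists u. Qed.
Lemma weyl_sg : subgroup_set (weyl C). Proof. exact: (gen_subgroupP _).1. Qed.
Lemma weyl1 : weyl C 1%g. Proof. by case: weyl_sg. Qed.
Lemma weylM u v : weyl C u -> weyl C v -> weyl C (u * v)%g.
Proof. exact: subgroupM weyl_sg. Qed.
Lemma weylV u : weyl C u -> weyl C (u^-1)%g.
Proof. exact: subgroupV weyl_sg. Qed.
Lemma weyl_isom w : weyl C w -> isom w.
Proof.
rewrite weylE => -[u ->]; elim: u => [|i u IH]; first by rewrite act_nil; exact: isom1.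
by rewrite act_cons; apply: isomM IH; exact: isom_refl.
Qed.

Lemma act_root u i : is_root (act u (e i)).
Proof.
elim: u => [|j u IH]; first by rewrite act_nil; exact: sroot_root.
by rewrite act_cons zmulE; apply: root_refl IH (sroot_root _).
Qed.

Lemma real_rootP (a : C) : real_root a -> exists u i, a = act u (e i).
Proof.
case=> w [x [hw /(nthP 0) [i hi <-] ->]]; move: hw; rewrite weylE => -[u ->].
by exists u, (Ordinal hi).
Qed.
Lemma real_act u i : real_root (act u (e i)).
Proof. by exists (act u), (e i); split; [exact: weyl_act | exact: sroot_in |]. Qed.
Lemma real_root_root (a : C) : real_root a -> is_root a.
Proof. by move=> /real_rootP [u [i ->]]; exact: act_root. Qed.
Lemma real_e i : real_root (e i).
Proof. by have := real_act [::] i; rewrite act_nil. Qed.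
Lemma real_weyl w (a : C) : weyl C w -> real_root a -> real_root (w a).
Proof.
rewrite weylE => -[v ->] /real_rootP [u [i ->]].
by rewrite -zmulE -act_cat; exact: real_act.
Qed.
Lemma real_rootN (a : C) : real_root a -> real_root (- a).
Proof.
move=> /real_rootP [u [i ->]]; rewrite -zautN -sr_ei -zmulE -act_rcons; exact: real_act.
Qed.
Lemma refl_weyl (a : C) : real_root a -> weyl C (refl a).
Proof.
move=> ra; have [u [i E]] := real_rootP ra; rewrite E -refl_conj; last exact: act_root.
- by rewrite -/(sr i) -act_rev -act_rcons -act_cat; exact: weyl_act.
- exact: weyl_isom (weyl_act u).
- exact: sroot_root.
Qed.
Lemma refl_weyl_conj w (a : C) : weyl C w -> real_root a -> (w * refl a * w^-1)%g = refl (w a).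
Proof.
move=> hw ra; apply: refl_conj; first exact: weyl_isom.
  exact: real_root_root.
by apply: real_root_root; exact: real_weyl.
Qed.

Lemma real_sign (a : C) : real_root a -> nonneg a \/ nonneg (- a).
Proof.
move=> /real_rootP [u [i ->]]; have [v [huv r]] := reduced_ex u.
rewrite (word_cong_act_e _ huv).
have [r'|nr] := pselect (reduced (rcons v i)); first by left; exact: reduced_pos.
right; have [w [hw sw]] := not_reduced_drop r nr.
have hv : word_cong v (rcons w i).
  have := word_cong_catl v (word_cong_ii i); rewrite cats0 => /word_cong_sym h; apply: word_cong_trans h _.
  by have := word_cong_catr [:: i] hw; rewrite -!cats1 -catA.
have rw : reduced (rcons w i) by apply: (reduced_same r hv); rewrite size_rcons.
rewrite (word_cong_act_e _ hv) act_rcons zmulE sr_ei zautN opprK; exact: reduced_pos.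
Qed.

Lemma coxeter_system_weyl : coxeter_system (weyl C) (simple_refl C).
Proof.
split=> //.
- move=> _ /simple_reflP [i ->]; split=> // k.
  rewrite -[k in LHS]odd_double_half -muln2 mulnC expgnDr expgnA expg2 sr_invo expg1n mulg1 dvdn2.
  case: (odd k) => /=; last by [].
  split=> // h; exfalso; have := sr_ei i; rewrite -[sr i]expg1 h zoneE => E.
  apply: (@sroot_ne0 i); apply: nonneg_anti; last rewrite -E; exact: nonneg_e.
- move=> u v hu hv h.
  have key s : [set` s] `<=` simple_refl C -> exists s', s = map sr s'.
    elim: s => [|x s IH] hs; first by exists [::].
    have [|s' ->] := IH; first by move=> y ys; apply: hs; rewrite /= inE ys orbT.
    have /simple_reflP [i ->] : simple_refl C x by apply: hs; rewrite /= inE eqxx.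
    by exists (i :: s').
  have [u' eu] := key _ hu; have [v' ev] := key _ hv; rewrite eu ev in h *.
  exact: act_faithful.
Qed.

Lemma sr_inj : injective sr.
Proof.
move=> i j h; apply/eqP; apply: contrapT => /negP ij.
have : sr i (e i) = sr j (e i) by rewrite h.
rewrite sr_ei sr_e => /(congr1 (fun x => coord x i)).
rewrite coordN coordD coordM !coord_e eqxx eq_sym (negPf ij); lia.
Qed.

Lemma map_nth_sroot : cl_seq C = map e (enum 'I_(rk C)).
Proof.
apply: (@eq_from_nth _ 0); first by rewrite size_map size_enum_ord.
move=> k hk; rewrite (nth_map (Ordinal hk)) ?size_enum_ord //.
by rewrite /sroot nth_enum_ord.
Qed.

Lemma cox_act : cox C = act (enum 'I_(rk C)).
Proof. by rewrite /cox map_nth_sroot -map_comp. Qed.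

Lemma pointed_coxeter_weyl : pointed_coxeter (weyl C) (simple_refl C) (cox C).
Proof.
split; first exact: coxeter_system_weyl.
exists (map sr (enum 'I_(rk C))); split.
- by rewrite map_inj_uniq ?enum_uniq //; exact: sr_inj.
- apply/seteqP; split=> [x /= /mapP [i _ ->]|x /simple_reflP [i ->]]; first exact: sr_in.
  by apply/mapP; exists i => //; rewrite mem_enum.
- exact: cox_act.
Qed.
End Positivity.

(** * The Hurwitz action *)

Section Hurwitz.
Variable C : cartan_lattice.
Notation e := (@sroot C).
Notation sr := (@sr C).
Notation act := (@act C).
Notation nonneg := (@nonneg C).
Notation coord := (@coord C).
Implicit Types (a b x y : C) (w : zaut C).

Definition posroot a := real_root a /\ nonneg a.

Lemma posroot_root a : posroot a -> is_root a. Proof. by case=> /real_root_root. Qed.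
Lemma real_neq0 a : real_root a -> a <> 0.
Proof. by move=> /real_root_root [h _] a0; move: h; rewrite a0 bform0l ltxx. Qed.

(** Transport by the Weyl group makes b simple; then a has a single nonzero coordinate, and it is 1
    or -1 because a is itself conjugate to a simple root and hence indivisible. *)
Lemma real_prop a b (x y : int) : real_root a -> real_root b -> x != 0 ->
  a *~ x = b *~ y -> a = b \/ a = - b.
Proof.
move=> ra rb x0; have [u [i ->]] := real_rootP rb => h.
pose a' := (act u)^-1%g a.
have ra' : real_root a' by apply: real_weyl ra; apply: weylV; exact: weyl_act.
have h' : a' *~ x = e i *~ y.
  by rewrite -zautMz h zautMz zinvK.
have cj j : j != i -> coord a' j = 0.
  move=> ji; have := congr1 (fun z => coord z j) h'.
  rewrite !coordM coord_e eq_sym (negPf ji) mulr0 => /eqP; rewrite mulf_eq0 (negPf x0) => /eqP //.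
have aE : a' = e i *~ coord a' i.
  apply: coord_inj => j; rewrite coordM coord_e; have [->|ij] := eqVneq i j; first by rewrite mulr1.
  by rewrite mulr0 cj // eq_sym.
have [v [k vE]] := real_rootP ra'.
have : (act v)^-1%g (e i *~ coord a' i) = e k by rewrite -aE vE zinvK.
rewrite zautMz => /(congr1 (fun z => coord z k)); rewrite coordM coord_e eqxx => h1.
have [c1|c1] : coord a' i = 1 \/ coord a' i = -1.
  move: h1 => /(congr1 absz); rewrite abszM /= => /eqP; rewrite muln_eq1 => /andP [/eqP h1 _].
  by lia.
  by left; rewrite -[a](zKinv (act u)) -/a' aE c1 mulr1z.
by right; rewrite -[a](zKinv (act u)) -/a' aE c1 mulrN1z zautN.
Qed.

Lemma posroot_opp a : posroot a -> ~ nonneg (- a).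
Proof. by case=> ra pa na; apply: (real_neq0 ra); exact: nonneg_anti. Qed.

Lemma posroot_prop a b (x y : int) : posroot a -> posroot b -> x != 0 -> a *~ x = b *~ y -> a = b.
Proof.
move=> pa pb x0 h; case: (real_prop pa.1 pb.1 x0 h) => // ab.
by case: (posroot_opp pb); rewrite -ab; case: pa.
Qed.

(** A reflection determines its root up to sign only; for a real root this picks the positive
    one. *)
Definition pabs x : C := if `[< nonneg x >] then x else - x.
Lemma pabs_nn x : nonneg x -> pabs x = x.
Proof. by rewrite /pabs => h; rewrite asboolT. Qed.
Lemma pabs_pr x : real_root x -> posroot (pabs x).
Proof.
rewrite /pabs => r; case: asboolP => h; first by split.
by split; [exact: real_rootN r | case: (real_sign r)].
Qed.
Lemma pabsN x : real_root x -> pabs (- x) = pabs x.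
Proof.
move=> r; rewrite /pabs opprK; case: asboolP => h; case: asboolP => h' //.
  by case: (posroot_opp (conj r h')).
by case: (real_sign r).
Qed.
Lemma pabs_cases x : pabs x = x \/ pabs x = - x.
Proof. by rewrite /pabs; case: asboolP; [left|right]. Qed.
Lemma pabs_id x : posroot x -> pabs x = x. Proof. by case=> _; exact: pabs_nn. Qed.
Lemma refl_pabs x : real_root x -> refl (pabs x) = refl x.
Proof. by move=> /real_root_root r; case: (pabs_cases x) => ->; rewrite ?reflNa. Qed.
Lemma pabs_w w x : weyl C w -> real_root x -> pabs (w (pabs x)) = pabs (w x).
Proof.
move=> hw r; case: (pabs_cases x) => -> //; rewrite zautN pabsN //; exact: real_weyl.
Qed.
Lemma refl_real a b : real_root a -> real_root b -> real_root (refl a b).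
Proof. by move=> ra rb; apply: real_weyl => //; exact: refl_weyl. Qed.

Lemma sr_flip i b : posroot b -> nonneg (- sr i b) -> b = e i.
Proof.
move=> pb h; have bE : b = e i *~ coord b i.
  apply: coord_inj => j; rewrite coordM coord_e; have [->|ij] := eqVneq i j; first by rewrite mulr1.
  rewrite mulr0; have := h j; rewrite /(sr _) reflE; last exact: sroot_root.
  rewrite coordN coordD coordN coordM coord_e (negPf ij) mulr0 subr0; have := pb.2 j; lia.
have pe : posroot (e i) by split; [exact: real_e | exact: nonneg_e].
by apply: (posroot_prop pb pe (oner_neq0 _) (y := coord b i)); rewrite mulr1z.
Qed.

Lemma posroot_w w b : weyl C w -> posroot b -> nonneg (w b) -> posroot (w b).
Proof. by move=> hw [r _] h; split=> //; exact: real_weyl. Qed.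
Lemma nonneg_dec w b : weyl C w -> posroot b -> nonneg (w b) \/ nonneg (- w b).
Proof. by move=> hw [r _]; apply: real_sign; exact: real_weyl. Qed.

Lemma exchange u b : posroot b -> nonneg (- act u b) ->
  exists u1 i u2, [/\ u = u1 ++ i :: u2, b = (act u2)^-1%g (e i)
   & (act u * refl b)%g = act (u1 ++ u2)].
Proof.
elim: u => [|i u IH] pb h; first by case: (posroot_opp pb); move: h; rewrite act_nil.
have [hp|hn] := nonneg_dec (weyl_act u) pb; last first.
  have [u1 [k [u2 [-> bE hE]]]] := IH pb hn.
  exists (i :: u1), k, u2; split=> //.
  by rewrite act_cons -mulgA hE -act_cons.
have E : act u b = e i by apply: sr_flip; [exact: posroot_w (weyl_act _) _ _ | move: h; rewrite act_cons zmulE].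
exists [::], i, u; split=> //; first by rewrite -E zinvK.
rewrite /= -[b](zinvK (act u)) E -refl_weyl_conj; last exact: real_e.
  rewrite act_cons invgK !mulgA -(mulgA (sr i)) mulgV mulg1.
  by rewrite sr_invo mul1g.
by apply: weylV; exact: weyl_act.
Qed.

Lemma finite_inv w : weyl C w -> exists s : seq C, forall b, posroot b -> nonneg (- w b) -> b \in s.
Proof.
rewrite weylE => -[u ->]; elim: u => [|i u [s hs]].
  by exists [::] => b pb; rewrite act_nil => /(posroot_opp pb).
exists ((act u)^-1%g (e i) :: s) => b pb h; rewrite inE.
have [hp|hn] := nonneg_dec (weyl_act u) pb; last by rewrite hs ?orbT.
have E : act u b = e i by apply: sr_flip; [exact: posroot_w (weyl_act _) _ _ | move: h; rewrite act_cons zmulE].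
by rewrite -E zinvK eqxx.
Qed.

Definition is_len w n := (exists2 u, act u = w & size u = n) /\ forall u, act u = w -> (n <= size u)%N.
Definition len w : nat := xget 0%N (is_len w).
Lemma lenP w : weyl C w -> is_len w (len w).
Proof.
rewrite weylE => -[u0 hu0]; apply: xgetPex.
have ex : exists n, `[< exists2 u, act u = w & size u = n >].
  by exists (size u0); apply/asboolP; exists u0.
have [n /asboolP hn nmin] := ex_minnP ex; exists n; split=> // u hu.
by apply: nmin; apply/asboolP; exists u.
Qed.

Lemma len_lt w b : weyl C w -> posroot b -> nonneg (- w b) -> (len (w * refl b)%g < len w)%N.
Proof.
move=> hw pb h; have [[u uw su] _] := lenP hw.
rewrite -uw in h; have [u1 [i [u2 [uE _ E]]]] := exchange pb h.
have hw' : weyl C (w * refl b)%g by apply: weylM => //; apply: refl_weyl; case: pb.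
have [_ mn] := lenP hw'; have := mn (u1 ++ u2); rewrite -E uw => /(_ erefl).
rewrite -su uE !size_cat /=; lia.
Qed.
Lemma len_gt w b : weyl C w -> posroot b -> nonneg (w b) -> (len w < len (w * refl b)%g)%N.
Proof.
move=> hw pb h; have rb := posroot_root pb.
have hw' : weyl C (w * refl b)%g by apply: weylM => //; apply: refl_weyl; case: pb.
have := len_lt hw' pb; rewrite -mulgA refl_invo // mulg1; apply.
by rewrite zmulE refl_a // zautN opprK.
Qed.

Definition posroots (s : seq C) := forall a, a \in s -> posroot a.
Definition reflprod (s : seq C) : zaut C := prodg (map (@refl C) s).

(** The braid group action on sequences of reflections, transcribed to their positive roots; the
    inverse generators come from [hurwitz_sym]. *)
Inductive hurwitz : seq C -> seq C -> Prop :=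
| hurwitz_refl s : hurwitz s s
| hurwitz_sym s t : hurwitz s t -> hurwitz t s
| hurwitz_trans s t r : hurwitz s t -> hurwitz t r -> hurwitz s r
| hurwitz_mv xs a b ys : posroot a -> posroot b ->
    hurwitz (xs ++ a :: b :: ys) (xs ++ pabs (refl a b) :: a :: ys).

Lemma reflprod_cat s t : reflprod (s ++ t) = (reflprod s * reflprod t)%g.
Proof. by rewrite /reflprod map_cat prodg_cat. Qed.
Lemma reflprod_cons a s : reflprod (a :: s) = (refl a * reflprod s)%g.
Proof. by rewrite /reflprod /= prodg_cons. Qed.
Lemma reflprod_nil : reflprod [::] = 1%g. Proof. exact: prodg_nil. Qed.
Lemma reflprod_rcons a s : reflprod (rcons s a) = (reflprod s * refl a)%g.
Proof. by rewrite -cats1 reflprod_cat reflprod_cons reflprod_nil mulg1. Qed.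
Lemma posroots_cons a s : posroots (a :: s) <-> posroot a /\ posroots s.
Proof.
split=> [h|[pa ps] x]; last by rewrite inE => /orP [/eqP -> //|/ps].
by split=> [|x xs]; apply: h; rewrite inE ?eqxx ?xs ?orbT.
Qed.
Lemma posroots_cat s t : posroots (s ++ t) <-> posroots s /\ posroots t.
Proof.
split=> [h|[hs height] x]; last by rewrite mem_cat => /orP [/hs|/height].
by split=> x xs; apply: h; rewrite mem_cat xs ?orbT.
Qed.
Lemma reflprod_weyl s : posroots s -> weyl C (reflprod s).
Proof.
elim: s => [|a s IH]; first by rewrite reflprod_nil => _; exact: weyl1.
by move=> /posroots_cons [[ra _] ps]; rewrite reflprod_cons; apply: weylM (IH ps); exact: refl_weyl.
Qed.

Lemma hurwitz_pair a b : posroot a -> posroot b -> (refl (pabs (refl a b)) * refl a)%g = (refl a * refl b)%g.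
Proof.
move=> [ra pa] [rb pb]; rewrite refl_pabs; last exact: refl_real.
rewrite -refl_weyl_conj //; last exact: refl_weyl.
by rewrite -!mulgA mulVg mulg1.
Qed.

Lemma hurwitz_size s t : hurwitz s t -> size s = size t.
Proof. by elim=> [//|? ? _ ->|? ? ? _ -> _ ->|xs a b ys _ _] //; rewrite !size_cat. Qed.
Lemma hurwitz_rp s t : hurwitz s t -> reflprod s = reflprod t.
Proof.
elim=> [//|? ? _ ->|? ? ? _ -> _ ->|xs a b ys pa pb] //.
by rewrite !reflprod_cat !reflprod_cons !mulgA -(mulgA (reflprod xs) (refl (pabs _))) hurwitz_pair // !mulgA.
Qed.
Lemma hurwitz_prs s t : hurwitz s t -> posroots s <-> posroots t.
Proof.
elim=> [//|? ? _ H|? ? ? _ H1 _ H2|xs a b ys pa pb]; first by split=> /H.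
  by split=> [/H1/H2|/H2/H1].
split=> /posroots_cat [h1] /posroots_cons [h2] /posroots_cons [h3 h4]; apply/posroots_cat; split=> //;
  apply/posroots_cons; split=> //; try (by apply/posroots_cons).
apply: pabs_pr; apply: refl_real; by [case: pa | case: pb].
Qed.
Lemma hurwitz_ctx xs ys s t : hurwitz s t -> hurwitz (xs ++ s ++ ys) (xs ++ t ++ ys).
Proof.
elim=> [?|? ? _ H|? ? ? _ H1 _ H2|us a b vs pa pb].
- exact: hurwitz_refl.
- exact: hurwitz_sym.
- exact: hurwitz_trans H1 H2.
- have := hurwitz_mv (xs ++ us) (vs ++ ys) pa pb; by rewrite -!catA.
Qed.
Lemma hurwitz_catr ys s t : hurwitz s t -> hurwitz (s ++ ys) (t ++ ys).
Proof. exact: (@hurwitz_ctx [::]). Qed.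
Lemma hurwitz_catl xs s t : hurwitz s t -> hurwitz (xs ++ s) (xs ++ t).
Proof. by move=> h; have := @hurwitz_ctx xs [::] _ _ h; rewrite !cats0. Qed.

Lemma pabs_refl2 a b : posroot a -> posroot b -> pabs (refl a (pabs (refl a b))) = b.
Proof.
move=> [ra pa] pb; have [rb _] := pb.
rewrite pabs_w ?reflK; [exact: pabs_id|exact: real_root_root|exact: refl_weyl|exact: refl_real].
Qed.

Lemma hurwitz_mv2 xs a b ys : posroot a -> posroot b ->
  hurwitz (xs ++ a :: b :: ys) (xs ++ b :: pabs (refl b a) :: ys).
Proof.
move=> pa pb; apply: hurwitz_sym.
have pc : posroot (pabs (refl b a)) by apply: pabs_pr; apply: refl_real; [case: pb | case: pa].
by have := hurwitz_mv xs ys pb pc; rewrite pabs_refl2.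
Qed.

Lemma hurwitz_right a X : posroot a -> posroots X -> hurwitz (a :: X) (X ++ [:: pabs (reflprod (rev X) a)]).
Proof.
elim: X a => [|b X IH] a pa; first by move=> _; rewrite reflprod_nil zoneE pabs_id //; exact: hurwitz_refl.
move=> /posroots_cons [pb pX]; apply: hurwitz_trans (@hurwitz_mv2 [::] a b X pa pb) _.
have pc : posroot (pabs (refl b a)) by apply: pabs_pr; apply: refl_real; [case: pb | case: pa].
have := @hurwitz_catl [:: b] _ _ (IH _ pc pX).
rewrite pabs_w ?rev_cons ?reflprod_rcons //.
  by apply: reflprod_weyl => x; rewrite mem_rev; exact: pX.
by apply: refl_real; [case: pb | case: pa].
Qed.
End Hurwitz.

(** * Heights, peaks in the Bruhat graph and Hurwitz transitivity *)

Section Bruhat.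
Variable C : cartan_lattice.
Notation e := (@sroot C).
Notation act := (@act C).
Notation nonneg := (@nonneg C).
Notation coord := (@coord C).
Notation posroot := (@posroot C).
Notation posroots := (@posroots C).
Notation hurwitz := (@hurwitz C).
Notation reflprod := (@reflprod C).
Implicit Types (a b x y : C) (w : zaut C).

Definition height x : int := \sum_i coord x i.
Lemma heightD x y : height (x + y) = height x + height y.
Proof. by rewrite /height -big_split; apply: eq_bigr => i _; rewrite coordD. Qed.
Lemma heightM x k : height (x *~ k) = k * height x.
Proof. by rewrite /height mulr_sumr; apply: eq_bigr => i _; rewrite coordM. Qed.
Lemma heightN x : height (- x) = - height x.
Proof. by rewrite -mulrN1z heightM mulN1r. Qed.
Lemma height_ge0 x : nonneg x -> 0 <= height x.
Proof. by move=> h; apply: sumr_ge0. Qed.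
Lemma height_eq0 x : nonneg x -> height x = 0 -> x = 0.
Proof.
move=> h /eqP; rewrite psumr_eq0 // => /allP z; apply: coord_inj => i; rewrite coord0.
by apply/eqP; apply: z; rewrite mem_index_enum.
Qed.
Lemma height_pr x : posroot x -> 0 < height x.
Proof.
move=> [r p]; rewrite lt_neqAle height_ge0 // andbT; apply/eqP => h.
by apply: (real_neq0 r); apply: height_eq0.
Qed.
Lemma height_real_pos x : real_root x -> 0 < height x -> posroot x.
Proof.
move=> r h; split=> //; case: (real_sign r) => // /height_ge0; rewrite heightN; lia.
Qed.

(* The roots of the dihedral group generated by two reflections, listed along the chain
   z_(j+1) = - s_(z_j) z_(j-1). *)
Definition cnext (pq : C * C) : C * C := (pq.2, - refl pq.2 pq.1).

Lemma cnext_equiv w (p : C * C) : weyl C w -> real_root p.1 -> real_root p.2 ->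
  cnext (w p.1, w p.2) = (w (cnext p).1, w (cnext p).2).
Proof.
move=> hw r1 r2; rewrite /cnext /= -(refl_weyl_conj hw r2) !zmulE zinvK; congr pair.
by rewrite zautN.
Qed.

Lemma sym_reflr (q p : C) : is_root q -> sym_form q (refl q p) = - sym_form q p.
Proof. by move=> rq; rewrite -symNl -(@isom_refl _ q (- q) p) zautN refl_a // opprK. Qed.

(** With c = [refl_coef p.2 p.1], the next root of the chain has height c * [height p.2] -
    [height p.1]. The third condition says that this is at least [height p.1]; the fourth, that the
    dihedral group is infinite, makes the third persist. *)
Definition cinv (p : C * C) := [/\ posroot p.1, posroot p.2, 2 * height p.1 <= refl_coef p.2 p.1 * height p.2
  & 4 <= refl_coef p.2 p.1 * refl_coef p.1 p.2].

Lemma cinv_next p : cinv p -> cinv (cnext p).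
Proof.
case: p => p q [/= pp pq h k4]; have reflprod := posroot_root pp; have rq := posroot_root pq.
pose r := - refl q p.
have rE : r = q *~ refl_coef q p - p by rewrite /r reflE // opprB.
have hr : height r = refl_coef q p * height q - height p by rewrite rE heightD heightN heightM.
have posroot_r : posroot r.
  apply: height_real_pos; last by have := height_pr pp; rewrite hr; lia.
  by apply: real_rootN; apply: refl_real; [case: pq | case: pp].
have rr := posroot_root posroot_r.
have e1 : refl_coef r q = refl_coef p q.
  apply: refl_coef_uniq => //; rewrite /r bformNl bformNr opprK (isom_bxx _ (@isom_refl _ q)).
  by rewrite cfE // symNr sym_reflr // opprK.
have e2 : refl_coef q r = refl_coef q p by rewrite rE cfD // cfN // cfM // cfaa //; ring.
split=> //=; rewrite -/r e1 ?e2 ?(mulrC (refl_coef p q)) //.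
have q0 := height_pr pq; have p0 := height_pr pp.
have kp : 0 < refl_coef q p.
  rewrite ltNge; apply/negP => le; have : refl_coef q p * height q <= 0 by apply: mulr_le0_ge0 => //; lia.
  lia.
have kq : 0 < refl_coef p q by rewrite -(pmulr_rgt0 _ kp); lia.
rewrite hr.
have u1 : 0 <= refl_coef p q * (refl_coef q p * height q - 2 * height p) by apply: mulr_ge0; lia.
have u2 : 0 <= (refl_coef q p * refl_coef p q - 4) * height q by apply: mulr_ge0; lia.
lia.
Qed.

Lemma cinv_iter p k : cinv p -> cinv (iter k cnext p).
Proof. by move=> h; elim: k => //= k IH; exact: cinv_next. Qed.

(* Infinitely many roots of the chain would be inversions of s_a. *)
Lemma height_refl_lt a b : posroot a -> posroot b -> a <> b -> 0 < sym_form a b ->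
  height (pabs (refl a b)) < height b \/ height (pabs (refl b a)) < height a.
Proof.
move=> pa pb ab s0; apply: contrapT => /not_orP [/negP n1 /negP n2].
rewrite -leNgt in n1; rewrite -leNgt in n2.
have ra := posroot_root pa; have rb := posroot_root pb.
have ha := height_pr pa; have hb := height_pr pb.
have ka : 0 < refl_coef a b.
  by rewrite -(pmulr_lgt0 _ (_ : 0 < bform a a)) ?cfE //; [rewrite symC | case: ra].
have kb : 0 < refl_coef b a.
  by rewrite -(pmulr_lgt0 _ (_ : 0 < bform b b)) ?cfE //; case: rb.
have rab : real_root (refl a b) by apply: refl_real; [case: pa | case: pb].
have rba : real_root (refl b a) by apply: refl_real; [case: pb | case: pa].
have e1 : pabs (refl a b) = - refl a b.
  case: (pabs_cases (refl a b)) => // e1; move: n1; rewrite e1 reflE // heightD heightN heightM.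
  have : 0 < refl_coef a b * height a by apply: mulr_gt0.
  lia.
have e2 : pabs (refl b a) = - refl b a.
  case: (pabs_cases (refl b a)) => // e2; move: n2; rewrite e2 reflE // heightD heightN heightM.
  have : 0 < refl_coef b a * height b by apply: mulr_gt0.
  lia.
rewrite e1 reflE // heightN heightD heightN heightM in n1.
rewrite e2 reflE // heightN heightD heightN heightM in n2.
have k4 : 4 <= refl_coef b a * refl_coef a b.
  have u1 : 0 <= refl_coef b a * (refl_coef a b * height a - 2 * height b) by apply: mulr_ge0; lia.
  rewrite leNgt; apply/negP => lt.
  have : (refl_coef b a * refl_coef a b - 4) * height a < 0 by rewrite nmulr_rlt0 //; lia.
  lia.
have c1 : cinv (a, b) by split=> //=; lia.
pose z := - refl a b.
have zE : z = a *~ refl_coef a b - b by rewrite /z reflE // opprB.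
have pz : posroot z by rewrite /z -e1; exact: pabs_pr.
have hz : height b <= height z by rewrite zE heightD heightN heightM; lia.
have c2 : cinv (a, z).
  have e3 : refl_coef z a = refl_coef b a.
    apply: refl_coef_uniq; first exact: posroot_root.
    rewrite /z bformNl bformNr opprK (isom_bxx _ (@isom_refl _ a)).
    by rewrite cfE // symNr sym_reflr // opprK.
  have e4 : refl_coef a z = refl_coef a b by rewrite zE cfD // cfN // cfM // cfaa //; ring.
  split=> //=; rewrite e3 ?e4 //.
  have : 0 <= refl_coef b a * (height z - height b) by apply: mulr_ge0; lia.
  lia.
have real_iter p k : real_root p.1 -> real_root p.2 ->
   real_root (iter k cnext p).1 /\ real_root (iter k cnext p).2.
  move=> r1 r2; elim: k => //= k [h1 h2]; split=> //.
  by apply: real_rootN; exact: refl_real.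
have rfl : weyl C (refl a) by apply: refl_weyl; case: pa.
have rflb : weyl C (refl b) by apply: refl_weyl; case: pb.
(* The chain through (a, z) is the image under - s_a of the chain through (a, b). As both chains
   consist of positive roots, all roots of the second are inversions of s_a. *)
have neg k : (iter k cnext (a, z)) = (- refl a (iter k cnext (a, b)).1, - refl a (iter k cnext (a, b)).2).
  elim: k => [|k IH]; first by rewrite /= refl_a // opprK.
  rewrite !iterS IH; have [h1 h2] := real_iter (a, b) k pa.1 pb.1.
  have := cnext_equiv rfl h1 h2; case: (iter k cnext (a, b)) h1 h2 => p q /= h1 h2.
  rewrite /cnext /= => -[E]; congr pair.
  have rq : is_root (refl a q) by apply: real_root_root; apply: refl_real => //; case: pa.
  by rewrite reflNa // zautN E.
pose T := (refl b * refl a)%g.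
have hT : weyl C T by exact: weylM.
have shift k : iter k.*2 cnext (a, b) = ((T ^+ k)%g a, (T ^+ k)%g b).
  have wTk k' : weyl C (T ^+ k')%g.
    by elim: k' => [|k' IH]; [exact: weyl1 | rewrite expgS; exact: weylM].
  elim: k => // k IH; rewrite doubleS !iterS IH.
  have := cnext_equiv (wTk k) (p := (a, b)) pa.1 pb.1 => /= ->.
  have := cnext_equiv (wTk k) (p := cnext (a, b)) pb.1 _ => /= ->; last exact: real_rootN.
  rewrite expgSr !zmulE; congr pair; congr ((T ^+ k)%g _).
    by rewrite refl_a // zautN.
  have rba' : is_root (refl b a) by exact: real_root_root.
  by rewrite reflNa // -(refl_weyl_conj rflb pa.1) !zmulE reflV // refl_a // !zautN opprK.
pose g k := (T ^+ k)%g b.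
have gp k : posroot (g k) by have [_] := cinv_iter k.*2 c1; rewrite shift.
have gn k : nonneg (- refl a (g k)).
  by have [_ [_ h] _ _] := cinv_iter k.*2 c2; move: h; rewrite neg shift.
have [s hs] := finite_inv rfl.
have gs k : g k \in s by exact: hs.
(* The inversions of s_a are finitely many, so the roots [g k] repeat. *)
have [m [m0 hm]] : exists m, (0 < m)%N /\ (T ^+ m)%g b = b.
  have [i [j [ij E]]] : exists i j, (i < j)%N /\ g i = g j.
    apply: contrapT => H.
    have inj : injective (fun k : 'I_(size s).+1 => g k).
      move=> i j E; apply: contrapT => ne; apply: H.
      have [lt|lt|/val_inj //] := ltngtP i j; [by exists i, j | by exists j, i].
    have U : uniq (map (fun k : 'I_(size s).+1 => g k) (enum 'I_(size s).+1)).
      by rewrite map_inj_uniq ?enum_uniq.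
    have Sb : {subset map (fun k : 'I_(size s).+1 => g k) (enum 'I_(size s).+1) <= s}.
      by move=> x /mapP [k _ ->].
    by have := uniq_leq_size U Sb; rewrite size_map size_enum_ord ltnn.
  exists (j - i)%N; rewrite subn_gt0 ij; split=> //.
  have : (T ^+ j)%g b = (T ^+ i)%g ((T ^+ (j - i))%g b) by rewrite -zmulE -expgnDr subnKC // ltnW.
  by move: E; rewrite /g => <- /(congr1 ((T ^+ i)^-1)%g); rewrite !zinvK.
pose S := \sum_(k < m) g k.
have TS : T S = S.
  rewrite /S zaut_sum; case: m m0 hm @S => // m _ hm S.
  rewrite big_ord_recr [RHS]big_ord_recl [LHS]addrC; congr (_ + _).
    by rewrite /g -zmulE -expgS hm expg0 zoneE.
  by apply: eq_bigr => k _; rewrite /g -zmulE -expgS.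
(* S is fixed by T = s_b s_a, hence s_a S = s_b S; a nonzero coefficient would make [a] and [b]
   proportional. But s_a makes every summand of S negative, so fixing S forces S = 0, against its
   positive height. *)
have sS : refl a S = S.
  have := TS; rewrite zmulE => h; have h' : refl a S = refl b S by rewrite -[in RHS]h reflK.
  have := h'; rewrite !reflE // => /addrI /oppr_inj E.
  have [c0|c0] := eqVneq (refl_coef a S) 0; first by rewrite c0 mulr0z subr0.
  by case: ab; apply: (posroot_prop pa pb c0 E).
have nS : nonneg S.
  by rewrite /S; elim/big_ind: _ => [i|x y|k _]; [rewrite coord0 | exact: nnD | case: (gp k)].
have nS' : nonneg (- S).
  rewrite -sS /S zaut_sum -sumrN.
  by elim/big_ind: _ => [i|x y|k _]; [rewrite coord0 | exact: nnD | exact: gn].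
have S0 := nonneg_anti nS nS'.
have : 0 < height S.
  rewrite /S (big_morph height heightD (_ : height 0 = 0)); last by rewrite /height big1 // => i _; rewrite coord0.
  case: (m) m0 => // m' _; rewrite big_ord_recl; apply: ltr_wpDr; last exact: height_pr (gp _).
  by apply: sumr_ge0 => k _; rewrite ltW // height_pr.
by rewrite S0 /height big1 ?ltxx // => i _; rewrite coord0.
Qed.

(** While the pair is acute, one of the two Hurwitz moves lowers the sum of heights by
    [height_refl_lt]. The strict decrease is needed later to orthogonalize exceptional sequences. *)
Lemma hurwitz_obtuse a b : posroot a -> posroot b -> a <> b -> exists a' b',
  [/\ hurwitz [:: a; b] [:: a'; b'], posroot a' /\ posroot b', sym_form a' b' <= 0
    & height a' + height b' <= height a + height b /\ (0 < sym_form a b -> height a' + height b' < height a + height b)].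
Proof.
have [n] := ubnP (absz (height a + height b)); elim: n a b => // n IH a b lt pa pb ab.
have [s0|s0] := lerP (sym_form a b) 0.
  by exists a, b; split; [exact: hurwitz_refl | | | split=> //; lia].
have ha := height_pr pa; have hb := height_pr pb.
have rab : real_root (refl a b) by apply: refl_real; [case: pa | case: pb].
have rba : real_root (refl b a) by apply: refl_real; [case: pb | case: pa].
case: (height_refl_lt pa pb ab s0) => h.
  have pc := pabs_pr rab; have hc := height_pr pc.
  have [|//|//||a' [b' [h1 h2 h3 [h4 _]]]] := IH (pabs (refl a b)) a.
  - lia.
  - move=> E; apply: ab; have := pabs_refl2 pa pb; rewrite E refl_a; last exact: posroot_root.
    by rewrite pabsN ?pabs_id //; case: pa.
  exists a', b'; split=> //; last by split=> [|_]; lia.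
  exact: hurwitz_trans (@hurwitz_mv _ [::] a b [::] pa pb) h1.
have pc := pabs_pr rba; have hc := height_pr pc.
have [|//|//||a' [b' [h1 h2 h3 [h4 _]]]] := IH b (pabs (refl b a)).
- lia.
- move=> E; apply: ab; have := pabs_refl2 pb pa; rewrite -E refl_a; last exact: posroot_root.
  by rewrite pabsN ?pabs_id //; case: pb.
exists a', b'; split=> //; last by split=> [|_]; lia.
exact: hurwitz_trans (@hurwitz_mv2 _ [::] a b [::] pa pb) h1.
Qed.

(* A list F of positive roots is viewed as the path w, w s_1, w s_1 s_2, ... in the Bruhat graph. *)
Fixpoint ascending w (F : seq C) : Prop :=
  if F is a :: F' then nonneg (w a) /\ ascending (w * refl a)%g F' else True.
Fixpoint path_length w (F : seq C) : nat :=
  if F is a :: F' then (len (w * refl a)%g + path_length (w * refl a)%g F')%N else 0%N.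

Lemma path_length_cat w s t : path_length w (s ++ t) = (path_length w s + path_length (w * reflprod s)%g t)%N.
Proof.
elim: s w => [|a s IH] w /=; first by rewrite reflprod_nil mulg1.
by rewrite IH reflprod_cons mulgA addnA.
Qed.
Lemma ascending_rcons w F f : ascending w (rcons F f) <-> ascending w F /\ nonneg ((w * reflprod F)%g f).
Proof.
elim: F w => [|a F IH] w /=; first by rewrite reflprod_nil; split=> -[].
rewrite IH reflprod_cons; split=> [[h [h1 h2]]|[[h h1] h2]]; by repeat split.
Qed.

Lemma peak w F : weyl C w -> posroots F -> (forall a F', F = a :: F' -> nonneg (w a)) -> ~ ascending w F ->
  exists xs a b ys, [/\ F = xs ++ a :: b :: ys, nonneg ((w * reflprod xs)%g a) &
     nonneg (- ((w * reflprod xs * refl a)%g b))].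
Proof.
elim: F w => [|a F IH] w hw pF hF ni; first by case: ni.
have [pa pF'] := (posroots_cons _ _).1 pF.
have ha := hF _ _ erefl.
have hwa : weyl C (w * refl a)%g by apply: weylM => //; apply: refl_weyl; case: pa.
case: F IH pF pF' hF ni => [|b F] IH pF pF' hF ni; first by case: ni.
have [pb pF''] := (posroots_cons _ _).1 pF'.
have [hb|hb] := nonneg_dec hwa pb; last first.
  by exists [::], a, b, F; rewrite reflprod_nil mulg1.
have [||||xs [c [d [ys [E h1 h2]]]]] := IH (w * refl a)%g _ _ _ _ => //.
- by move=> c F' [<- _].
- by move=> h; apply: ni.
exists (a :: xs), c, d, ys; split; first by rewrite E.
  by rewrite reflprod_cons; exact: h1.
by rewrite reflprod_cons; exact: h2.
Qed.

(** At a peak the two steps are replaced by a Hurwitz equivalent pair through a lower vertex, so the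
    sum of lengths drops. Equal steps cancel instead, which accounts for the alternative with two
    roots fewer. *)
Lemma normalize F : posroots F -> exists F', posroots F' /\
  ((hurwitz F F' /\ ascending 1%g F') \/ ((size F').+2 = size F /\ reflprod F' = reflprod F)).
Proof.
have [n] := ubnP (path_length 1%g F); elim: n F => // n IH F lt pF.
have [i|ni] := pselect (ascending 1%g F).
  by exists F; split=> //; left; split=> //; exact: hurwitz_refl.
have [|xs [a [b [ys [E h1 h2]]]]] := peak (@weyl1 C) pF _ ni.
  by move=> a F' E; have := pF a; rewrite E inE eqxx => /(_ isT) [].
subst F; have [pxs /posroots_cons [pa /posroots_cons [pb pys]]] := (posroots_cat _ _).1 pF.
rewrite !mul1g in h1 h2; have hw := reflprod_weyl pxs.
set w := reflprod xs in h1 h2 hw *.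
have hwa : weyl C (w * refl a)%g by apply: weylM => //; apply: refl_weyl; case: pa.
have [ab|ab] := pselect (a = b).
  exists (xs ++ ys); split; first by apply/posroots_cat.
  right; rewrite !size_cat /= !addnS; split=> //.
  by rewrite !reflprod_cat !reflprod_cons ab (mulgA (refl b)) refl_invo ?mul1g //; exact: posroot_root.
have [a0 [b0 [hab [pa0 pb0] s0 _]]] := hurwitz_obtuse pa pb ab.
have rb := posroot_root pb; have rb0 := posroot_root pb0; have ra0 := posroot_root pa0.
have l1 := len_gt hw pa h1.
have l2 := len_lt hwa pb h2.
have hr := hurwitz_rp hab; rewrite !reflprod_cons reflprod_nil !mulg1 in hr.
have c0 : refl_coef a0 b0 <= 0.
  have := cfE b0 ra0; rewrite symC => h; have [d _] := ra0.
  by rewrite -(pmulr_lle0 _ d) h.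
have na1 : nonneg (refl a0 b0).
  rewrite reflE // -mulrNz; apply: nnD; first by case: pb0.
  by apply: nnM; [rewrite oppr_ge0 | case: pa0].
pose a1 := refl a0 b0.
have pa1 : posroot a1 by split=> //; apply: refl_real; [case: pa0 | case: pb0].
have main a' b' : hurwitz [:: a; b] [:: a'; b'] -> posroot a' -> posroot b' ->
   (len (w * refl a')%g < len (w * refl a)%g)%N -> exists F', posroots F' /\
  ((hurwitz (xs ++ [:: a, b & ys]) F' /\ ascending 1%g F') \/
   ((size F').+2 = size (xs ++ [:: a, b & ys]) /\ reflprod F' = reflprod (xs ++ [:: a, b & ys]))).
  move=> h pa' pb' ll.
  have h' : hurwitz (xs ++ [:: a, b & ys]) (xs ++ [:: a', b' & ys]).
    exact: (hurwitz_ctx xs ys h).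
  have pF' := (hurwitz_prs h').1 pF.
  have hr' := hurwitz_rp h; rewrite !reflprod_cons reflprod_nil !mulg1 in hr'.
  have [|F' [pF2 H]] := IH _ _ pF'.
    move: lt; rewrite !path_length_cat /= !mul1g -/w -!mulgA -hr'.
    move: ll (path_length 1%g xs) (len (w * (refl a * refl b))%g) (path_length (w * (refl a * refl b))%g ys).
    by move: (len (w * refl a')%g) (len (w * refl a)%g) => p q pq r s t; lia.
  exists F'; split=> //; case: H => [[H1 H2]|[H1 H2]].
    by left; split=> //; exact: hurwitz_trans H1.
  by right; rewrite H1 H2 (hurwitz_size h') (hurwitz_rp h').
have yb0 : ((w * refl a * refl b)%g b0) = - w a1.
  by rewrite -mulgA hr !zmulE (refl_a rb0) !zautN.
have hwab : weyl C (w * refl a * refl b)%g by apply: weylM => //; apply: refl_weyl; case: pb.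
(* Obtuseness of (a0, b0) makes a1 = s_a0 b0 positive. If w a1 is positive, the path through w s_a0
   passes below w s_a s_b; if it is negative, the path through w s_a1 passes below w. Both ends lie
   below the peak w s_a. *)
have [h|h] := nonneg_dec hw pa1.
  apply: (main a0 b0) => //; apply: ltn_trans l2.
  have -> : (w * refl a0 = w * refl a * refl b * refl b0)%g.
    by rewrite -!mulgA (mulgA (refl a)) hr -!mulgA refl_invo // mulg1.
  by apply: len_lt => //; rewrite yb0 opprK.
apply: (main a1 a0) => //.
  apply: hurwitz_trans hab _; have := hurwitz_mv [::] [::] pa0 pb0.
  by rewrite (pabs_nn na1).
by apply: ltn_trans l1; exact: len_lt.
Qed.

Lemma act_coord u i x : i \notin u -> coord (act u x) i = coord x i.
Proof.
elim: u => [|j u IH]; first by rewrite act_nil.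
rewrite inE negb_or => /andP [ij iu]; rewrite act_cons zmulE /(sr _) reflE; last exact: sroot_root.
rewrite coordD coordN coordM coord_e eq_sym (negPf ij) mulr0 subr0; exact: IH.
Qed.

Lemma act_uniq1 u : uniq u -> act u = 1%g -> u = [::].
Proof.
case/lastP: u => // u i; rewrite rcons_uniq => /andP [iu _] h; exfalso.
have := congr1 (fun f : zaut C => coord (f (e i)) i) h.
rewrite act_rcons zmulE sr_ei zautN coordN (act_coord _ iu) zoneE coord_e eqxx; lia.
Qed.

Definition simple_roots u : seq C := map e u.
Lemma posroot_e i : posroot (e i). Proof. by split; [exact: real_e | exact: nonneg_e]. Qed.
Lemma simples_prs u : posroots (simple_roots u).
Proof. by move=> x /mapP [i _ ->]; exact: posroot_e. Qed.
Lemma reflprod_simples u : reflprod (simple_roots u) = act u.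
Proof. by rewrite /reflprod /simple_roots -map_comp. Qed.

(** The last step of an ascending path deletes a letter of [u] by exchange, and the remaining
    letters are still distinct, so induction applies to the rest. Hurwitz moves then carry the
    deleted simple root from its place in [u] to the end, where it becomes [f]. *)
Lemma ascending_word u F : uniq u -> posroots F -> ascending 1%g F -> reflprod F = act u -> hurwitz F (simple_roots u).
Proof.
elim/last_ind: F u => [|F f IH] u uu pF iF h.
  by rewrite (act_uniq1 uu) -?h ?reflprod_nil //; exact: hurwitz_refl.
move: pF; rewrite -cats1 => /posroots_cat [pF /posroots_cons [pf _]].
have [iF' nf] := (ascending_rcons _ _ _).1 iF; rewrite mul1g in nf.
have rf := posroot_root pf.
have : nonneg (- act u f).
  by rewrite -h reflprod_rcons zmulE refl_a // zautN opprK.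
move=> /(exchange pf) [u1 [i [u2 [uE fE hE]]]].
have hF : reflprod F = act (u1 ++ u2).
  by rewrite -hE -h reflprod_rcons -mulgA refl_invo // mulg1.
have uu' : uniq (u1 ++ u2).
  by move: uu; rewrite uE; apply: subseq_uniq; apply: cat_subseq => //; exact: subseq_cons.
have H := IH _ uu' pF iF' hF.
apply: hurwitz_trans (hurwitz_catr [:: f] H) _; apply: hurwitz_sym.
rewrite uE /simple_roots !map_cat /= -catA; apply: hurwitz_catl.
have := hurwitz_right (posroot_e i) (@simples_prs u2).
have -> : reflprod (rev (simple_roots u2)) (e i) = f.
  by rewrite fE /simple_roots -map_rev reflprod_simples act_rev.
by rewrite pabs_id.
Qed.

(** The bound and the transitivity support each other: if normalization cancels two roots, the
    shorter factorization still has at least [rk C] of them, so this cannot happen to one of length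
    [rk C]. *)
Lemma cox_factorization_hurwitz F : posroots F -> reflprod F = cox C ->
  (rk C <= size F)%N /\ (size F = rk C -> hurwitz F (cl_seq C)).
Proof.
have [n] := ubnP (size F); elim: n F => // n IH F lt pF h.
have [F' [pF' [[H1 H2]|[H1 H2]]]] := normalize pF.
  have H := @ascending_word (enum 'I_(rk C)) F' (enum_uniq _) pF' H2.
  rewrite -(hurwitz_rp H1) h cox_act in H.
  have {}H := hurwitz_trans H1 (H erefl).
  rewrite (hurwitz_size H) size_map size_enum_ord; split=> // _.
  by rewrite map_nth_sroot.
have sF' : (size F' < n)%N by lia.
have [h1 _] := IH F' sF' pF' (etrans H2 h).
by split; lia.
Qed.
End Bruhat.

(** * Exceptional sequences of dimension vectors *)

Fixpoint allp (T : Type) (P : T -> Prop) (s : seq T) : Prop :=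
  if s is x :: s' then P x /\ allp P s' else True.

Section Allp.
Variable T : Type.
Implicit Types (P : T -> Prop) (s t : seq T).
Lemma allp_cat P s t : allp P (s ++ t) <-> allp P s /\ allp P t.
Proof.
elim: s => [|x s IH] /=; first by split=> [|[]].
by rewrite IH; split=> [[h [h1 h2]]|[[h h1] h2]].
Qed.
Lemma allp_nth P s x0 : allp P s <-> forall i, (i < size s)%N -> P (nth x0 s i).
Proof.
elim: s => [|x s IH] //=; split=> [[h /IH h'] [|i] //|h]; first by move=> /h'.
by split; [exact: (h 0%N) | apply/IH => i hi; exact: (h i.+1)].
Qed.
Lemma allp_impl P P' s : (forall x, P x -> P' x) -> allp P s -> allp P' s.
Proof. by move=> h; elim: s => //= x s IH [/h ? /IH]. Qed.
End Allp.

Section Span.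
Variable C : cartan_lattice.
Implicit Types (x y a b : C) (F G : seq C).

Fixpoint zspan F x : Prop :=
  if F is a :: F' then exists k : int, zspan F' (x - a *~ k) else x = 0.

Lemma zspan_cat F G x : zspan (F ++ G) x <-> exists y, zspan F y /\ zspan G (x - y).
Proof.
elim: F x => [|a F IH] x /=.
  by split=> [h|[y [-> h]]]; [exists 0; rewrite subr0 | rewrite subr0 in h].
split=> [[k /IH [y [h1 h2]]]|[y [[k h1] h2]]].
  exists (y + a *~ k); split; first by exists k; rewrite addrK.
  by rewrite opprD addrA addrAC.
exists k; apply/IH; exists (y - a *~ k); split=> //.
by rewrite opprB addrA subrK.
Qed.

Lemma zspan_sum F x : zspan F x <-> exists c : nat -> int, x = \sum_(i < size F) F`_i *~ c i.
Proof.
elim: F x => [|a F IH] x /=.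
  by split=> [->|[c ->]]; [exists (fun=> 0)|]; rewrite big_ord0.
split=> [[k /IH [c h]]|[c ->]].
  exists (fun i => if i is i'.+1 then c i' else k).
  by rewrite big_ord_recl /= -h addrC subrK.
exists (c 0%N); apply/IH; exists (fun i => c i.+1).
by rewrite big_ord_recl /= addrC addKr.
Qed.

Lemma zspanD F x y : zspan F x -> zspan F y -> zspan F (x + y).
Proof.
elim: F x y => [|a F IH] x y /=; first by move=> -> ->; rewrite addr0.
by move=> [k h1] [l h2]; exists (k + l); rewrite mulrzDr opprD addrACA; exact: IH.
Qed.
Lemma zspan_in F a : a \in F -> forall k, zspan F (a *~ k).
Proof.
have z G : zspan G 0 by elim: G => //= b G IH; exists 0; rewrite mulr0z subr0.
elim: F => //= b F IH; rewrite inE => /orP [/eqP ->|aF] k; first by exists k; rewrite subrr.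
by exists 0; rewrite mulr0z subr0; exact: IH.
Qed.

Lemma zspan_sub F G : (forall a, a \in F -> forall k, zspan G (a *~ k)) -> forall x, zspan F x -> zspan G x.
Proof.
move=> h x; elim: F h x => [|a F IH] h x /=.
  by move=> ->; elim: G {h} => //= b G IH; exists 0; rewrite mulr0z subr0.
case=> k hk; rewrite -(subrK (a *~ k) x); apply: zspanD.
  by apply: IH => // b bF; apply: h; rewrite inE bF orbT.
by apply: h; rewrite inE eqxx.
Qed.

Lemma zspan_hurw F G : hurwitz F G -> forall x, zspan F x <-> zspan G x.
Proof.
elim=> [//|s t _ H|s t r _ H1 _ H2|xs a b ys pa pb] x; first by rewrite H.
  by rewrite H1.
have ra := posroot_root pa; have rb := posroot_root pb.
have E : refl a b = b - a *~ refl_coef a b by rewrite reflE.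
split; apply: zspan_sub => c; rewrite mem_cat !inE => /orP [cx|/or3P [/eqP ->|/eqP ->|cy]] k.
- by apply: zspan_in; rewrite mem_cat cx.
- by apply: zspan_in; rewrite mem_cat !inE eqxx !orbT.
- have : pabs (refl a b) \in xs ++ [:: pabs (refl a b), a & ys] by rewrite mem_cat !inE eqxx !orbT.
  have : a \in xs ++ [:: pabs (refl a b), a & ys] by rewrite mem_cat !inE eqxx !orbT.
  move: (xs ++ _) => L aL inL.
  have -> : b *~ k = refl a b *~ k + a *~ (refl_coef a b * k) by rewrite E mulrzBl -mulrzA subrK.
  apply: zspanD; last exact: zspan_in.
  have [E'|E'] := pabs_cases (refl a b); rewrite E' in inL; first exact: zspan_in.
  by rewrite -[refl a b]opprK mulNrz -mulrNz; exact: zspan_in.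
- by apply: zspan_in; rewrite mem_cat !inE cy !orbT.
- by apply: zspan_in; rewrite mem_cat cx.
- have H l : zspan (xs ++ [:: a, b & ys]) (refl a b *~ l).
    rewrite E mulrzBl; apply: zspanD; first by apply: zspan_in; rewrite mem_cat !inE eqxx !orbT.
    by rewrite -mulrzA -mulrNz; apply: zspan_in; rewrite mem_cat !inE eqxx !orbT.
  by have [->|->] := pabs_cases (refl a b); rewrite ?mulNrz -?mulrNz.
- by apply: zspan_in; rewrite mem_cat !inE eqxx !orbT.
- by apply: zspan_in; rewrite mem_cat !inE cy !orbT.
Qed.

Lemma zspan_cl x : zspan (cl_seq C) x.
Proof.
have [c ->] := lat_span x; apply/zspan_sum.
exists (fun i => if insub i is Some j then c j else 0).
by apply: eq_bigr => i _; rewrite /sroot valK.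
Qed.

Definition num_exc F := (forall a, a \in F -> is_root a) /\
  forall i j, (j < i < size F)%N -> bform F`_i F`_j = 0.
Definition orth F := forall i j, (i < size F)%N -> (j < size F)%N -> i != j -> bform F`_i F`_j <= 0.

Lemma num_exc_split F (c : nat -> int) k : num_exc F -> (k < size F)%N ->
  bform F`_k (\sum_(i < size F) F`_i *~ c i) =
  c k * bform F`_k F`_k + \sum_(i < size F | (k < i)%N) c i * bform F`_k F`_i.
Proof.
move=> [_ h] hk; rewrite bform_sumr (bigD1 (Ordinal hk)) //= bformMzr; congr (_ + _).
rewrite (bigID (fun i : 'I__ => (k < i)%N)) /= [X in _ + X]big1 ?addr0.
  apply: eq_big => [i|i _]; last by rewrite bformMzr.
  by case: eqVneq => [->|] //=; rewrite ltnn.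
move=> i /andP [ne le]; rewrite bformMzr h ?mulr0 // hk andbT.
by rewrite ltn_neqAle -val_eqE /= in ne *; rewrite ne leqNgt le.
Qed.

(** Descending induction along the triangular Gram matrix. Vanishing of the left pairings with F is
    enough, so this also says that the form is non-degenerate on the span of F. *)
Lemma num_exc_free F (c : nat -> int) : num_exc F ->
  (forall k, (k < size F)%N -> bform F`_k (\sum_(i < size F) F`_i *~ c i) = 0) ->
  forall k, (k < size F)%N -> c k = 0.
Proof.
move=> hF h; suff H m k : (size F - k <= m)%N -> (k < size F)%N -> c k = 0.
  by move=> k; exact: (H (size F - k)%N).
elim: m k => [|m IH] k hm hk; first by lia.
have := h k hk; rewrite num_exc_split // big1 ?addr0; last first.
  by move=> i ki; rewrite IH ?mul0r //; have := ltn_ord i; lia.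
move=> /eqP; rewrite mulf_eq0 => /orP [/eqP //|].
by have [/(_ _ (mem_nth 0 hk)) [/lt0r_neq0 /negPf -> _] _] := hF.
Qed.

(** A triangular matrix with positive diagonal and nonpositive entries elsewhere has a nonnegative
    inverse. *)
Lemma num_exc_neg F (c : nat -> int) : num_exc F -> orth F ->
  (forall k, (k < size F)%N -> bform F`_k (\sum_(i < size F) F`_i *~ c i) <= 0) ->
  forall k, (k < size F)%N -> c k <= 0.
Proof.
move=> hF oF h; suff H m k : (size F - k <= m)%N -> (k < size F)%N -> c k <= 0.
  by move=> k; exact: (H (size F - k)%N).
elim: m k => [|m IH] k hm hk; first by lia.
have := h k hk; rewrite num_exc_split // => le.
have p : 0 <= \sum_(i < size F | (k < i)%N) c i * bform F`_k F`_i.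
  apply: sumr_ge0 => i ki; apply: mulr_le0; first by apply: IH; have := ltn_ord i; lia.
  by apply: oF => //; rewrite ltn_eqF.
have [/(_ _ (mem_nth 0 hk)) [d _] _] := hF.
by rewrite -(pmulr_lle0 _ d); apply: le_trans le; rewrite lerDl.
Qed.

Lemma num_exc_cat F G : num_exc (F ++ G) <-> [/\ num_exc F, num_exc G &
  forall f g, f \in F -> g \in G -> bform g f = 0].
Proof.
split=> [[h1 h2]|[[f1 f2] [g1 g2] h]].
  split.
  - split=> [a aF|i j ij]; first by apply: h1; rewrite mem_cat aF.
    have /andP [ji hi] := ij; have hj := ltn_trans ji hi.
    by have := h2 i j; rewrite !nth_cat size_cat hi hj ji ltn_addr //=; apply.
  - split=> [a aF|i j ij]; first by apply: h1; rewrite mem_cat aF orbT.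
    have := h2 (size F + i)%N (size F + j)%N; rewrite !nth_cat size_cat.
    rewrite ltn_add2l ltn_add2l ij => /(_ isT).
    by rewrite !ltnNge !leq_addr /= !addKn.
  - move=> f g /(nthP 0) [j hj <-] /(nthP 0) [i hi <-].
    have := h2 (size F + i)%N j; rewrite !nth_cat size_cat ltn_add2l hi hj.
    rewrite ltn_addr //= => /(_ isT).
    by rewrite ltnNge leq_addr /= addKn.
split=> [a|i j]; first by rewrite mem_cat => /orP [/f1|/g1].
rewrite size_cat !nth_cat => /andP [ji hi].
have [hi'|hi'] := ltnP i (size F).
  by rewrite (ltn_trans ji hi'); apply: f2; rewrite ji.
have [hj|hj] := ltnP j (size F).
  by apply: h; apply: mem_nth => //; rewrite ltn_subLR.
by apply: g2; rewrite ltn_sub2r //= ?ltn_subLR //; exact: leq_ltn_trans hj ji.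
Qed.
End Span.

(** * Realising factorizations of the Coxeter element by exceptional representations *)

Section Realize.
Variable C : cartan_lattice.
Notation e := (@sroot C).
Notation nonneg := (@nonneg C).
Notation coord := (@coord C).
Notation posroot := (@posroot C).
Notation posroots := (@posroots C).
Notation hurwitz := (@hurwitz C).
Variables (Q : species) (v : 'I_(rk C) -> sI Q).
Hypothesis vb : bijective v.
Hypothesis va : forall a : sA Q, exists i j : 'I_(rk C), [/\ (i < j)%N, src a = v i & tgt a = v j].

Definition clsf (w : sI Q -> nat) : C := \sum_i e i *~ (w (v i))%:Z.
Hypothesis veul : forall x y : sI Q -> nat, eul x y = bform (clsf x) (clsf y).
Notation rep := (rep Q).
Definition cls (V : rep) : C := clsf V.

Lemma coord_clsf w i : coord (clsf w) i = (w (v i))%:Z.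
Proof. by rewrite (@coord_uniq _ (clsf w) (fun i => (w (v i))%:Z)). Qed.
Lemma nonneg_cls V : nonneg (cls V).
Proof. by move=> i; rewrite coord_clsf. Qed.
Lemma cls_lin (L V W : rep) (s t : int) :
  (forall i, (L i)%:Z = s * (V i)%:Z + t * (W i)%:Z) -> cls L = cls V *~ s + cls W *~ t.
Proof.
move=> h; apply: coord_inj => i; rewrite coordD !coordM !coord_clsf h; ring.
Qed.
Lemma cls_inj (V W : rep) : cls V = cls W -> forall i, rdim V i = rdim W i.
Proof.
move=> h i; have [u vK uK] := vb; rewrite -(uK i); apply/eqP; rewrite -eqz_nat; apply/eqP.
by rewrite -!coord_clsf -/(cls V) h.
Qed.
Lemma rootdim_cls V : is_root (cls V) -> rootdim V.
Proof.
case=> d r; split; first by rewrite veul.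
by move=> w; rewrite !veul; exact: r.
Qed.
Lemma cls0 V : cls V = 0 -> dim0 V.
Proof.
move=> h i; have [u vK uK] := vb; rewrite -(uK i); apply/eqP; rewrite -eqz_nat; apply/eqP.
by rewrite -coord_clsf -/(cls V) h coord0.
Qed.

Fixpoint exseq (Ms : seq rep) : Prop :=
  if Ms is M :: Ms' then [/\ exc M, allp (fun N => perp N M) Ms' & exseq Ms'] else True.

Lemma exseq_cat s t : exseq (s ++ t) <->
  [/\ exseq s, exseq t & allp (fun M => allp (fun N => perp N M) t) s].
Proof.
elim: s => [|M s IH] /=; first by split=> [|[]].
split=> [[h1 /allp_cat [h2 h3] /IH [h4 h5 h6]] //|[[h1 h2 h3] h4 [h5 h6]]].
by split=> //; [apply/allp_cat | apply/IH].
Qed.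

Definition realized F := exists Ms, map cls Ms = F /\ exseq Ms.

Lemma map_cls_cat Ms F G : map cls Ms = F ++ G -> exists s t, [/\ Ms = s ++ t, map cls s = F & map cls t = G].
Proof.
move=> h; exists (take (size F) Ms), (drop (size F) Ms); rewrite cat_take_drop map_take map_drop h.
by rewrite take_size_cat // drop_size_cat.
Qed.

Lemma realized_pre F G : realized (F ++ G) -> realized F.
Proof. by case=> Ms [/map_cls_cat [s [t [-> <- _]]] /exseq_cat [h _ _]]; exists s. Qed.

Lemma perp_bform V W : perp V W -> bform (cls V) (cls W) = 0.
Proof. by move/perp_eul; rewrite veul. Qed.

Lemma realized_nexc F : posroots F -> realized F -> num_exc F.
Proof.
move=> pF [Ms [h ex]]; split=> [a /pF /posroot_root //|i j /andP [ji hi]].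
elim: Ms F h ex pF i j ji hi => [|M Ms IH] F <- //= [h1 h2 h3] pF [|i] [|j] //= ji hi.
  move: hi; rewrite ltnS size_map => hi.
  rewrite (nth_map M) //; apply: perp_bform.
  by have /(allp_nth _ _ M) := h2; apply.
by apply: (IH (map cls Ms)) => // a ha; apply: pF; rewrite inE ha orbT.
Qed.

Lemma nonneg_pabs x y : real_root x -> nonneg y -> (y = x \/ y = - x) -> pabs x = y.
Proof.
move=> r h [E|E]; first by rewrite -E pabs_nn.
by rewrite -[x]opprK -E pabsN ?pabs_nn // E; exact: real_rootN.
Qed.

Lemma exseq_replace s t A B A' B' : exseq (s ++ A :: B :: t) ->
  exc A' -> exc B' -> perp B' A' ->
  (forall Z, (perp Z A -> perp Z B -> perp Z A') /\ (perp A Z -> perp B Z -> perp A' Z)) ->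
  (forall Z, (perp Z A -> perp Z B -> perp Z B') /\ (perp A Z -> perp B Z -> perp B' Z)) ->
  exseq (s ++ A' :: B' :: t).
Proof.
move=> /exseq_cat [hs /= [eA [pBA pAt] [eB pBt height]] hst] eA' eB' p' tA tB.
apply/exseq_cat; split=> //=.
  split=> //; first split=> //.
    elim: (t) pAt pBt => //= N t' IH [h1 h2] [h3 h4]; split; last exact: IH.
    by apply: (tA N).1.
  split=> //.
  elim: (t) pAt pBt => //= N t' IH [h1 h2] [h3 h4]; split; last exact: IH.
  by apply: (tB N).1.
apply: allp_impl hst => N /= [h1 [h2 h3]]; split; first by apply: (tA N).2.
by split=> //; apply: (tB N).2.
Qed.

(** The class of a mutation is the reflected class up to a sign depending on the case of the
    mutation. Being nonnegative, it is the positive one of the two roots, which is what [pabs]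
    selects in the Hurwitz move. *)
Lemma realized_hurw F G : hurwitz F G -> realized F <-> realized G.
Proof.
elim=> [//|s t _ H|s t r _ H1 _ H2|xs a b ys pa pb]; first by rewrite H.
  by rewrite H1.
have ra := posroot_root pa; have rb := posroot_root pb.
have rab : real_root (refl a b) by apply: refl_real; [case: pa | case: pb].
split=> -[Ms [/map_cls_cat [s [t' [-> Es]]]]].
  case: t' => [|A [|B t]] //= [EA EB Et] ex.
  have /exseq_cat [_ /= [eA [pBA _] [eB _ _]] _] := ex.
  have [L [eL pAL thL [sg [k [ss kE LE]]]]] := left_mutation eA eB pBA.
  exists (s ++ L :: A :: t); split; last first.
    by apply: (exseq_replace ex) => // Z; split.
  rewrite map_cat /= Es EA Et; congr (_ ++ _ :: _); apply: esym.
  apply: nonneg_pabs => //; first exact: nonneg_cls.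
  have kc : refl_coef a b = k.
    apply: refl_coef_uniq => //; move: kE; rewrite !veul -/(cls A) -/(cls B) EA EB => ->.
    by have z := perp_bform pBA; rewrite EA EB in z; rewrite /sym_form z add0r.
  rewrite (cls_lin LE) reflE // EA EB kc.
  have [->|->] : sg = 1 \/ sg = -1 by nia.
    by left; rewrite mulr1z mul1r mulrNz.
  by right; rewrite mulrN1z !mulN1r opprK opprB addrC.
case: t' => [|A [|B t]] //= [EA EB Et] ex.
have /exseq_cat [_ /= [eA [pBA _] [eB _ _]] _] := ex.
have [R [eR pRB thR [sg [k [ss kE RE]]]]] := right_mutation eA eB pBA.
exists (s ++ B :: R :: t); split; last first.
  by apply: (exseq_replace ex) => // Z; split.
rewrite map_cat /= Es EB Et; congr (_ ++ _ :: _ :: _).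
rewrite -[RHS](pabs_refl2 pa pb); apply: esym.
have rc : real_root (pabs (refl a b)) by case: (pabs_pr rab).
apply: nonneg_pabs; [apply: refl_real => //; by case: pa | exact: nonneg_cls |].
have kc : refl_coef a (pabs (refl a b)) = k.
  apply: refl_coef_uniq => //; move: kE; rewrite !veul -/(cls A) -/(cls B) EA EB => ->.
  by have z := perp_bform pBA; rewrite EA EB in z; rewrite /sym_form z addr0.
rewrite (cls_lin RE) reflE // EA EB kc.
have [->|->] : sg = 1 \/ sg = -1 by nia.
  by left; rewrite mulr1z mul1r mulrNz.
by right; rewrite mulrN1z !mulN1r opprK opprB addrC.
Qed.

Lemma cls_simple i : cls (simple (v i)) = e i.
Proof.
have vi := bij_inj vb.
rewrite /cls /clsf (bigD1 i) //= eqxx mulr1z big1 ?addr0 // => j ji.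
by rewrite (inj_eq vi) (negPf ji) mulr0z.
Qed.

Lemma realized_cl : realized (cl_seq C).
Proof.
have vi := bij_inj vb.
exists (map (fun i => simple (v i)) (enum 'I_(rk C))); split.
  rewrite [RHS]map_nth_sroot -map_comp; apply: eq_map => i /=; exact: cls_simple.
have exs i : exc (simple (v i)).
  split; last by apply: rootdim_cls; rewrite cls_simple; exact: sroot_root.
  apply: simple_ext0 => a; have [j [k [lt -> ->]]] := va a.
  by move=> /vi E; rewrite E ltnn in lt.
have prp (i j : 'I_(rk C)) : (i < j)%N -> perp (simple (v j)) (simple (v i)).
  move=> ij; apply: simple_perp.
    by rewrite (inj_eq vi); apply: contraTneq ij => ->; rewrite ltnn.
  move=> a; have [k [l [lt -> ->]]] := va a => /vi kj /vi li; subst.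
  by move: (ltn_trans lt ij); rewrite ltnn.
have : sorted ltn (map val (enum 'I_(rk C))) by rewrite val_enum_ord iota_ltn_sorted.
rewrite sorted_map.
elim: (enum _) => //= i s IH.
rewrite path_sortedE; last by move=> x y z; exact: ltn_trans.
move=> /andP [/allP h1 h2]; split=> //; last exact: IH.
elim: s h1 {IH h2} => //= j s IH h; split; first by apply: prp; apply: h; rewrite inE eqxx.
by apply: IH => k ks; apply: h; rewrite inE ks orbT.
Qed.

Lemma realized_cox F : posroots F -> reflprod F = cox C -> size F = rk C -> realized F.
Proof.
by move=> pF h s; have [_ H] := cox_factorization_hurwitz pF h; apply/(realized_hurw (H s)); exact: realized_cl.
Qed.

Definition total_height (F : seq C) : int := \sum_(a <- F) height a.
Lemma total_height_cat F G : total_height (F ++ G) = total_height F + total_height G.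
Proof. by rewrite /total_height big_cat. Qed.
Lemma total_height_cons a F : total_height (a :: F) = height a + total_height F.
Proof. by rewrite /total_height big_cons. Qed.
Lemma total_height_nil : total_height [::] = 0. Proof. by rewrite /total_height big_nil. Qed.
Lemma total_height_ge0 F : posroots F -> 0 <= total_height F.
Proof.
elim: F => [|a F IH]; first by rewrite total_height_nil.
by move=> /posroots_cons [pa /IH h]; rewrite total_height_cons addr_ge0 // ltW // height_pr.
Qed.

Lemma swap_left a c xs ys : posroot a -> posroot c -> bform a c = 0 -> bform c a = 0 ->
  hurwitz (xs ++ a :: c :: ys) (xs ++ c :: a :: ys).
Proof.
move=> pa pc h1 h2; have := hurwitz_mv xs ys pa pc.
have -> : refl a c = c; last by rewrite pabs_id.
have ra := posroot_root pa; rewrite reflE // (refl_coef_uniq (k := 0)) ?mulr0z ?subr0 //.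
by rewrite mul0r /sym_form h1 h2 addr0.
Qed.

(** For neighbours a, b this is [hurwitz_obtuse]. Otherwise [hom_middle] makes the form nonnegative
    between a and its right neighbour, or between b and its left neighbour. A positive value there
    gives a closer pair to reduce; value zero means that the two roots commute, and swapping them
    shortens [mid]. *)
Lemma reduce_pair s1 a mid b s2 : posroots (s1 ++ a :: mid ++ b :: s2) ->
  realized (s1 ++ a :: mid ++ b :: s2) -> 0 < bform a b ->
  exists F', hurwitz (s1 ++ a :: mid ++ b :: s2) F' /\ total_height F' < total_height (s1 ++ a :: mid ++ b :: s2).
Proof.
have [n] := ubnP (size mid); elim: n s1 a mid b s2 => // n IH s1 a mid b s2 lt pF rF ab.
have [ps1 /posroots_cons [pa /posroots_cat [pm /posroots_cons [pb ps2]]]] := (posroots_cat _ _).1 pF.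
have [Ms [/map_cls_cat [S1 [T [-> ES1]]]]] := rF.
case: T => [|A T] //= [EA] /map_cls_cat [Mid [T2 [-> EMid]]].
case: T2 => [|B T2] //= [EB ET2] /exseq_cat [_ /= [eA /allp_cat [pMA /= [pBA _]]]].
move=> /exseq_cat [_ /= [eB _ _] pBM] _.
have ba : bform b a = 0 by rewrite -EA -EB; exact: perp_bform.
case: mid => [|c mid] in lt pF rF pm EMid *.
  have [|a' [b' [h1 [pa' pb'] _ [_ h2]]]] := hurwitz_obtuse pa pb.
    by move=> E; move: ab; rewrite -E in ba *; rewrite ba ltxx.
  exists (s1 ++ a' :: b' :: s2); split; first exact: (hurwitz_ctx s1 s2 h1).
  have := h2 _; rewrite /sym_form ba addr0 => /(_ ab).
  by rewrite !total_height_cat /= !total_height_cons; lia.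
have HAB : ~ Hom0 A B by apply: pos_hom; rewrite veul -/(cls A) -/(cls B) EA EB.
have nF := realized_nexc pF rF.
have zero (x y : C) (t1 t2 t3 : seq C) : s1 ++ a :: (c :: mid) ++ b :: s2 = t1 ++ x :: t2 ++ y :: t3 ->
    bform y x = 0.
  move=> E; move: nF; rewrite E => /num_exc_cat [_ + _] => /(num_exc_cat [:: x]) [_ _]; apply.
    by rewrite inE.
  by rewrite mem_cat inE eqxx orbT.
case: (hom_middle eA eB pBA HAB) => key.
  case: Mid => [|X Mid] //= in EMid pMA pBM *; case: EMid => EX EMid.
  have Eac : 0 <= bform a c.
    rewrite -EA -EX -veul; apply: ext0_eul; apply: key; by case: pBM => -[].
  have [ac|ac] := eqVneq (bform a c) 0; last first.
    have := IH s1 a [::] c (mid ++ b :: s2); rewrite /= => H.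
    have [||||F' h] := H _ _ _ _; rewrite ?lt_neqAle ?Eac ?andbT ?[0 == _]eq_sym //; first by move: lt => /=; lia.
    by exists F'.
  have [pc pmid] := (posroots_cons _ _).1 pm.
  have ca : bform c a = 0 by apply: (zero a c s1 [::] (mid ++ b :: s2)).
  have h1 := swap_left s1 (mid ++ b :: s2) pa pc ac ca.
  have := IH (rcons s1 c) a mid b s2; rewrite cat_rcons => H.
  have [||||F' [h2 h3]] := H _ _ _ _ => //.
  - exact/(hurwitz_prs h1).
  - exact/(realized_hurw h1).
  exists F'; split; first exact: hurwitz_trans h1 h2.
  by move: h3; rewrite !total_height_cat /= !total_height_cons; lia.
have [X [Mid' EX]] : exists X Mid', Mid = rcons Mid' X.
  by case/lastP: Mid EMid {pMA pBM} => // Mid' X _; exists X, Mid'.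
have [d [mid' Ed]] : exists d mid', c :: mid = rcons mid' d.
  by case/lastP: mid {lt pF rF pm EMid zero nF} => [|m d]; [exists c, [::] | exists d, (c :: m)].
rewrite Ed in lt pF rF pm EMid zero nF *.
subst Mid; move: EMid; rewrite map_rcons => /rcons_inj [EMid EXd].
have Edb : 0 <= bform d b.
  rewrite -EB -EXd -veul; apply: ext0_eul; apply: key.
  by move: pMA; rewrite -cats1 => /allp_cat [_ []].
have E1 : (s1 ++ a :: mid') ++ [:: d, b & s2] = s1 ++ a :: rcons mid' d ++ b :: s2.
  by rewrite -cats1 -!catA.
have [db|db] := eqVneq (bform d b) 0; last first.
  have H2 := IH (s1 ++ a :: mid') d [::] b s2; rewrite /= E1 in H2.
  apply: H2 => //; first by move: lt; rewrite size_rcons; lia.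
  by rewrite lt_neqAle Edb eq_sym db.
have [pmid [pd _]] : posroots mid' /\ posroot d /\ True.
  by move: pm; rewrite -cats1 => /posroots_cat [? /posroots_cons []].
have bd : bform b d = 0.
  by apply: (zero d b (s1 ++ a :: mid') [::] s2); rewrite -cats1 -!catA.
have h1 := swap_left (s1 ++ a :: mid') s2 pd pb db bd.
have E2 : (s1 ++ a :: mid') ++ [:: b, d & s2] = s1 ++ a :: mid' ++ b :: d :: s2.
  by rewrite -!catA.
rewrite E1 E2 in h1.
have [||||F' [h2 h3]] := IH s1 a mid' b (d :: s2) => //.
- by move: lt; rewrite size_rcons; lia.
- exact/(hurwitz_prs h1).
- exact/(realized_hurw h1).
exists F'; split; first exact: hurwitz_trans h1 h2.
by move: h3; rewrite !(total_height_cat, total_height_cons, =^~ cats1) total_height_nil; lia.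
Qed.

Lemma orthogonalize F X : posroots (F ++ X) -> realized (F ++ X) -> exists E, hurwitz F E /\ orth E.
Proof.
have [n] := ubnP (absz (total_height F)); elim: n F => // n IH F lt pFX rFX.
have [pF pX] := (posroots_cat _ _).1 pFX.
have rF := realized_pre rFX.
have [o|no] := pselect (orth F); first by exists F; split=> //; exact: hurwitz_refl.
have [i [j [hi hj ij pos]]] : exists i j, [/\ (i < size F)%N, (j < size F)%N, i != j & 0 < bform F`_i F`_j].
  move: no; rewrite /orth => /existsNP [i /existsNP [j /not_implyP [hi /not_implyP [hj /not_implyP [ij /negP]]]]].
  by rewrite -ltNge => pos; exists i, j.
have nF := realized_nexc pF rF.
have lij : (i < j)%N.
  rewrite ltn_neqAle ij leqNgt; apply/negP => ji.
  by case: nF => _ /(_ i j); rewrite ji hi => /(_ isT) z; rewrite z ltxx in pos.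
have FE : F = take i F ++ F`_i :: take (j - i.+1) (drop i.+1 F) ++ F`_j :: drop j.+1 F.
  rewrite -{1}(cat_take_drop i F) (drop_nth 0 hi); congr (_ ++ _ :: _).
  rewrite -{1}(cat_take_drop (j - i.+1) (drop i.+1 F)); congr (_ ++ _).
  by rewrite drop_drop subnK // (drop_nth 0 hj).
have := pF; have := rF; rewrite FE => r' p'.
have [F' []] := reduce_pair p' r' pos.
rewrite -FE => h1 h2.
have h3 := hurwitz_catr X h1.
have pF' := (hurwitz_prs h1).1 pF.
have [|||E [h4 h5]] := IH F'.
- have := total_height_ge0 pF; have := total_height_ge0 pF'; lia.
- exact/(hurwitz_prs h3).
- exact/(realized_hurw h3).
by exists E; split=> //; exact: hurwitz_trans h1 h4.
Qed.

End Realize.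

(** * Orthogonal sequences with a common tail *)

Section Realize2.
Variable C : cartan_lattice.
Notation e := (@sroot C).
Notation nonneg := (@nonneg C).
Notation coord := (@coord C).
Notation posroot := (@posroot C).
Notation posroots := (@posroots C).
Notation hurwitz := (@hurwitz C).
Variables (Q : species) (v : 'I_(rk C) -> sI Q).
Hypothesis vb : bijective v.
Hypothesis va : forall a : sA Q, exists i j : 'I_(rk C), [/\ (i < j)%N, src a = v i & tgt a = v j].
Notation clsf := (clsf (C:=C) v).
Hypothesis veul : forall x y : sI Q -> nat, eul x y = bform (clsf x) (clsf y).
Notation rep := (rep Q).
Notation cls := (cls (C:=C) v).
Notation realized := (realized (C:=C) v).

Lemma exseq_nth (M0 : rep) Ms : exseq Ms -> forall i, (i < size Ms)%N ->
  exc (nth M0 Ms i) /\ forall j, (j < i)%N -> perp (nth M0 Ms i) (nth M0 Ms j).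
Proof.
elim: Ms => //= M Ms IH [h1 h2 h3] [|i] hi /=; first by split.
have [h4 h5] := IH h3 i hi; split=> // -[|j] /=; last exact: h5.
by move=> _; have /(allp_nth _ _ M0) := h2; apply.
Qed.

(** The representations of an orthogonal F serve as the simple objects of the right perpendicular
    category of those of X, and the members of G lie in that category. *)
Lemma filt_nn (F G X : seq C) : orth F -> posroots (F ++ X) -> realized (F ++ X) ->
  (forall x, zspan (F ++ X) x) -> realized (G ++ X) ->
  forall g, g \in G -> exists m : nat -> nat, g = \sum_(i < size F) F`_i *~ (m i)%:Z.
Proof.
move=> oF pFX rFX sp rGX g gG.
have nFX := realized_nexc veul pFX rFX.
have [nF nX zX] := (num_exc_cat _ _).1 nFX.
have [Ms [/map_cls_cat [SF [SX [-> EF EX]]]]] := rFX.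
have [Ns [/map_cls_cat [SG [SY [-> EG EY]]]]] := rGX.
move=> /exseq_cat [exG exY xGY] /exseq_cat [exF exX xFX].
have sF : size SF = size F by rewrite -EF size_map.
have sX : size SX = size X by rewrite -EX size_map.
have sY : size SY = size X by rewrite -EY size_map.
move: gG; rewrite -EG => /(nthP 0) [k]; rewrite size_map => hk.
have [Y0 _] : exists Y0 : rep, True by case: SG {EG exG xGY} hk => // Y _ _; exists Y.
rewrite (nth_map Y0) //; set Y := nth Y0 SG k => <-.
pose P (Z : rep) := exists2 i, (i < size SX)%N & Z = nth Y0 SX i.
pose M (i : 'I_(size F)) := nth Y0 SF i.
have hM (i : 'I_(size F)) : (i < size SF)%N by rewrite sF.
have cM i : cls (M i) = F`_i by have := nth_map Y0 0 cls (hM i); rewrite EF => ->.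
have eM i : exc (M i) by case: (exseq_nth Y0 exF (hM i)).
have pM (i j : 'I_(size F)) : (j < i)%N -> perp (M i) (M j).
  by move=> ji; have [_] := exseq_nth Y0 exF (hM i); apply.
have [|||| m hm] := @filtration Q P (size F) M eM _ _ _ Y.
- move=> i j ij; have [ji|ji|ji] := ltngtP j i.
  + by case: (pM _ _ ji).
  (* A nonzero morphism would force Ext = 0 and hence a positive value of the form, which
     orthogonality of F excludes. *)
  + apply: contrapT => h; have h1 := hom_ext0 (eM i) (eM j) (pM _ _ ji) h.
    have := ext0_pos h1 h; rewrite veul -/(cls (M i)) -/(cls (M j)) !cM.
    by rewrite ltNge oF // val_eqE.
  + by move: ij; rewrite (val_inj ji) eqxx.
- move=> i Z [j hj ->]; have /(allp_nth _ _ Y0) := xFX => /(_ i (hM i)).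
  by move/(allp_nth _ _ Y0) => /(_ j hj).
(* If no member of F maps to Z, the class z pairs nonpositively with F and to zero with X. The
   X-part of z then vanishes, and its coefficients on F are nonpositive by [num_exc_neg]; being also
   nonnegative as a class, z is zero. *)
- move=> Z nZ hP; apply: contrapT => /forallNP h; apply: nZ.
  have {}h i : Hom0 (M i) Z by apply: contrapT; exact: h.
  pose z := cls Z.
  have hz i : (i < size F)%N -> bform F`_i z <= 0.
    by move=> hi; have /hom0_eul := h (Ordinal hi); rewrite veul -/(cls (M _)) cM.
  have hx i : (i < size X)%N -> bform X`_i z = 0.
    move=> hi; rewrite -EX (nth_map Y0) ?sX //; apply: (perp_bform veul).
    by apply: hP; exists i; rewrite ?sX.
  have [y [/zspan_sum [c yE] /zspan_sum [c' yE']]] := (zspan_cat _ _ _).1 (sp z).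
  have xy i : (i < size X)%N -> bform X`_i y = 0.
    move=> hi; rewrite yE bform_sumr big1 // => j _; rewrite bformMzr zX ?mulr0 //; exact: mem_nth.
  have c'0 : forall i, (i < size X)%N -> c' i = 0.
    apply: (num_exc_free nX) => i hi; rewrite -yE' bformDr bformNr hx // xy //.
  have zy : z = y.
    apply/eqP; rewrite -subr_eq0 yE' big1 // => i _; by rewrite c'0 // mulr0z.
  have c0 : forall i, (i < size F)%N -> c i <= 0.
    by apply: (num_exc_neg nF oF) => i hi; rewrite -yE -zy; exact: hz.
  apply: (cls0 vb); apply: nonneg_anti; first exact: nonneg_cls.
  rewrite -/z zy yE -sumrN => i.
  have [pF _] := (posroots_cat _ _).1 pFX.
  elim/big_rec: _ => [|j x _ hx']; first by rewrite coord0.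
  rewrite coordD addr_ge0 // -mulrNz coordM mulr_ge0 ?oppr_ge0 ?c0 //.
  by have [_] : posroot F`_j; [apply: pF; exact: mem_nth | apply].
(* The two given realisations may represent X differently, so [exc_same] carries perpendicularity
   from one to the other. *)
- move=> Z [i hi ->].
  have hi' : (i < size SY)%N by rewrite sY -sX.
  have [e1 _] := exseq_nth Y0 exX hi; have [e2 _] := exseq_nth Y0 exY hi'.
  have cc : cls (nth Y0 SX i) = cls (nth Y0 SY i).
    by rewrite -!(nth_map Y0 0 cls) // EX EY.
  have [_ _] := exc_same e2 e1 (cls_inj vb (esym cc)) Y.
  have [h _] := exc_same e2 e1 (cls_inj vb (esym cc)) Y; apply: h.
  have /(allp_nth _ _ Y0) := xGY => /(_ k hk).
  by move/(allp_nth _ _ Y0) => /(_ i hi').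
exists (fun i => if insub i is Some j then m j else 0%N).
apply: coord_inj => i; rewrite coord_clsf hm raddf_sum /=.
have cs (f : 'I_(size F) -> C) : coord (\sum_j f j) i = \sum_j coord (f j) i.
  elim/big_rec2: _ => [|j x y _ <-]; [exact: coord0 | exact: coordD].
rewrite cs; apply: eq_bigr => j _; rewrite valK coordM -cM coord_clsf PoszM //.
Qed.

Lemma num_exc_indep (F : seq C) (c c' : nat -> int) : num_exc F ->
  \sum_(i < size F) F`_i *~ c i = \sum_(i < size F) F`_i *~ c' i ->
  forall i, (i < size F)%N -> c i = c' i.
Proof.
move=> nF E i hi; apply/eqP; rewrite -subr_eq0; apply/eqP.
apply: (num_exc_free (c := fun i => c i - c' i) nF) => // k hk.
have -> : \sum_(i < size F) F`_i *~ (c i - c' i) = 0; last exact: bform0r.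
rewrite (eq_bigr (fun i : 'I_(size F) => F`_i *~ c i - F`_i *~ c' i)); last by move=> j _; rewrite mulrzBr.
by rewrite sumrB E subrr.
Qed.

Lemma orth_sub (F G X : seq C) : orth F -> orth G -> posroots (F ++ X) -> posroots (G ++ X) ->
  realized (F ++ X) -> realized (G ++ X) ->
  (forall x, zspan (F ++ X) x) -> (forall x, zspan (G ++ X) x) ->
  forall f, f \in F -> f \in G.
Proof.
move=> oF oG pFX pGX rFX rGX sF sG f fF.
have [nF _ _] := (num_exc_cat _ _).1 (realized_nexc veul pFX rFX).
have [pF _] := (posroots_cat _ _).1 pFX; have [pG _] := (posroots_cat _ _).1 pGX.
have [n fE] := filt_nn oG pGX rGX sG rFX fF.
have H (j : 'I_(size G)) : exists m : nat -> nat, G`_j = \sum_(i < size F) F`_i *~ (m i)%:Z.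
  by apply: (filt_nn oF pFX rFX sF rGX); exact: mem_nth.
have [m GE] := choice H.
have := fF => /(nthP 0) [i hi fi].
have [j nj] : exists j : 'I_(size G), n j != 0%N.
  apply: contrapT => /forallNP h; have := real_neq0 (pF f fF).1; apply.
  by rewrite fE big1 // => j _; have /negP := h j; rewrite negbK => /eqP ->; rewrite mulr0z.
have co : forall l, (l < size F)%N -> (l == i)%:Z = \sum_(j < size G) (n j)%:Z * (m j l)%:Z.
  apply: (num_exc_indep (c := fun l => (l == i)%:Z) (c' := fun l => \sum_(j < size G) (n j)%:Z * (m j l)%:Z) nF).
  transitivity f.
    rewrite (bigD1 (Ordinal hi)) //= eqxx mulr1z fi big1 ?addr0 // => l li.
    by rewrite -val_eqE /= in li; rewrite (negPf li) mulr0z.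
  rewrite fE (eq_bigr (fun j : 'I_(size G) => \sum_(l < size F) F`_l *~ ((n j)%:Z * (m j l)%:Z))); last first.
    move=> k _; rewrite GE mulrz_suml; apply: eq_bigr => l _; by rewrite -mulrzA mulrC.
  by rewrite exchange_big; apply: eq_bigr => l _; rewrite mulrz_sumr.
have z l : (l < size F)%N -> l != i -> m j l = 0%N.
  move=> hl li; have := co l hl; rewrite (negPf li) (bigD1 j) //=.
  have : 0 <= \sum_(i0 < size G | i0 != j) (n i0)%:Z * (m i0 l)%:Z by apply: sumr_ge0 => k _; rewrite mulr_ge0.
  set s := \sum_(i0 < size G | i0 != j) _; move: (m j l) (n j) s nj => a b s; nia.
have Gj : G`_j = f *~ (m j i)%:Z.
  rewrite GE (bigD1 (Ordinal hi)) //= fi big1 ?addr0 // => l li.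
  by rewrite -val_eqE /= in li; rewrite z ?mulr0z.
have pj : posroot G`_j by apply: pG; exact: mem_nth.
have -> : f = G`_j; last exact: mem_nth.
by apply: esym; apply: (posroot_prop (x := 1) (y := (m j i)%:Z)) => //; exact: pF.
Qed.
End Realize2.

(** * Uniqueness of factorizations with a given tail *)

Section Factorizations.
Variable C : cartan_lattice.
Notation e := (@sroot C).
Notation posroot := (@posroot C).
Notation posroots := (@posroots C).
Notation reflprod := (@reflprod C).
Notation hurwitz := (@hurwitz C).
Implicit Types (F G X : seq C).

(** The arrows are oriented by the triangular shape of the form, and orthogonality gives the sign in
    [eul]. The root conditions on [e i] and [e j] are the divisibilities under which the fields at
    both ends embed into the field of the arrow. *)
Lemma realization : exists (Q : species) (v : 'I_(rk C) -> sI Q),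
  [/\ bijective v, forall a : sA Q, exists i j : 'I_(rk C), [/\ (i < j)%N, src a = v i & tgt a = v j]
   & forall x y : sI Q -> nat, eul x y = bform (clsf v x) (clsf v y)].
Proof.
pose d (i : 'I_(rk C)) := absz (bform (e i) (e i)).
pose m (i j : 'I_(rk C)) := absz (bform (e i) (e j)).
have d0 i : (0 < d i)%N by rewrite absz_gt0 lt0r_neq0 // sroot_pos.
have dv (i j : 'I_(rk C)) : (i < j)%N -> (d i %| m i j)%N /\ (d j %| m i j)%N.
  by move=> _; have [_ /(_ (e j)) [h _]] := sroot_root i; have [_ /(_ (e i)) [_ h']] := sroot_root j.
have [Q [v [vb va E]]] := species_exists d0 dv; exists Q, v; split=> // x y.
rewrite E /clsf bform_suml.
rewrite [RHS](eq_bigr (fun i => (d i)%:Z * ((x (v i))%:Z * (y (v i))%:Z) -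
   \sum_(j < rk C | (i < j)%N) (m i j)%:Z * ((x (v i))%:Z * (y (v j))%:Z))) ?sumrB //.
move=> i _; rewrite bform_sumr (bigD1 i) //= bformMzl bformMzr; congr (_ + _).
  by rewrite /d gez0_abs ?ltW ?sroot_pos //; ring.
rewrite (bigID (fun j : 'I_(rk C) => (i < j)%N)) /= [X in _ + X]big1 ?addr0; last first.
  move=> j /andP [ji lt]; rewrite bformMzl bformMzr sroot_tri ?mulr0 //.
  by rewrite ltn_neqAle leqNgt lt andbT.
rewrite -sumrN; apply: eq_big => [j|j /andP [ji lt]].
  by case: ltnP => [lt|] //=; rewrite ?andbF ?andbT // -val_eqE gtn_eqF.
rewrite bformMzl bformMzr /m lez0_abs; last by apply: sroot_orth; rewrite eq_sym.
by ring.
Qed.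

Definition cox_fact F := [/\ posroots F, reflprod F = cox C & size F = rk C].

Lemma cox_fact_hurw F G : hurwitz F G -> cox_fact F -> cox_fact G.
Proof.
by move=> h [h1 h2 h3]; split; rewrite -?(hurwitz_rp h) -?(hurwitz_size h) //; apply/(hurwitz_prs h).
Qed.
Lemma cox_fact_cl F : cox_fact F -> hurwitz F (cl_seq C).
Proof. by case=> h1 h2 h3; have [_] := cox_factorization_hurwitz h1 h2; apply. Qed.
Lemma cox_fact_spn F : cox_fact F -> forall x, zspan F x.
Proof. by move/cox_fact_cl/zspan_hurw => h x; apply/h; exact: zspan_cl. Qed.
Lemma cox_fact_nexc F : cox_fact F -> num_exc F.
Proof.
have [Q [v [vb va veul]]] := realization; case=> h1 h2 h3.
by apply: (realized_nexc veul) => //; exact: realized_cox.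
Qed.

Lemma cox_fact_orth F X : cox_fact (F ++ X) -> exists E, hurwitz F E /\ orth E.
Proof.
have [Q [v [vb va veul]]] := realization; case=> h1 h2 h3.
by apply: (orthogonalize veul h1); exact: realized_cox.
Qed.

Lemma cox_fact_uniq F G X : cox_fact (F ++ X) -> cox_fact (G ++ X) ->
  exists E H, [/\ hurwitz F E, hurwitz G H, orth E & E =i H].
Proof.
have [Q [v [vb va veul]]] := realization => fF fG.
have [E [hE oE]] := cox_fact_orth fF; have [H [hH oH]] := cox_fact_orth fG.
exists E, H; split=> // x.
have fE := cox_fact_hurw (hurwitz_catr X hE) fF; have fH := cox_fact_hurw (hurwitz_catr X hH) fG.
have sE := cox_fact_spn fE; have sH := cox_fact_spn fH.
case: fE fH => pE rE zE [pH rH zH].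
have lE := realized_cox vb va veul pE rE zE; have lH := realized_cox vb va veul pH rH zH.
by apply/idP/idP; [exact: (orth_sub vb veul oE oH pE pH lE lH sE sH)
  | exact: (orth_sub vb veul oH oE pH pE lH lE sH sE)].
Qed.
End Factorizations.

(** * From numerically exceptional sequences to factorizations *)

Section NumericExceptional.
Variable C : cartan_lattice.
Notation posroot := (@posroot C).
Notation posroots := (@posroots C).
Notation reflprod := (@reflprod C).
Notation hurwitz := (@hurwitz C).
Implicit Types (F G X : seq C) (a x y : C).

Lemma zspanN F x : zspan F x -> zspan F (- x).
Proof.
elim: F x => [|a F IH] x /=; first by move=> ->; rewrite oppr0.
by case=> k h; exists (- k); rewrite mulrNz -opprD; exact: IH.
Qed.
Lemma zspan_mem F a : a \in F -> zspan F a.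
Proof. by move=> h; have := zspan_in h 1; rewrite mulr1z. Qed.
Lemma zspan_orth F x y : (forall a, a \in F -> bform a y = 0) -> zspan F x -> bform x y = 0.
Proof.
elim: F x => [|a F IH] x h /=; first by move=> ->; exact: bform0l.
case=> k /(IH _ _) hk; rewrite -(subrK (a *~ k) x) bformDl bformMzl hk.
  by rewrite h ?mem_head // mulr0 addr0.
by move=> b bF; apply: h; rewrite inE bF orbT.
Qed.

Lemma num_exc_cons a F : num_exc (a :: F) ->
  [/\ is_root a, num_exc F & forall f, f \in F -> bform f a = 0].
Proof.
move/(num_exc_cat [:: a]) => [[h _] h2 h3]; split=> //; first by apply: h; rewrite inE.
by move=> f fF; apply: h3 => //; rewrite inE.
Qed.

(* Euler-Serre duality on the span: <y, s_F x> = - <x, y>, hence s_F depends only on the span of F *)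
Lemma reflprod_serre F x : num_exc F -> zspan F (reflprod F x - x) /\
  forall y, zspan F y -> bform y (reflprod F x) = - bform x y.
Proof.
elim: F => [|a F IH] nF; first by rewrite reflprod_nil subrr; split=> // y ->; rewrite bform0l bform0r oppr0.
have [ra nF' h] := num_exc_cons nF; have [IH1 IH2] := IH nF'.
rewrite reflprod_cons zmulE reflE //; set z := reflprod F x in IH1 IH2 *; split.
  exists (- refl_coef a z); rewrite mulrNz opprK addrAC subrK //.
have ha : bform (z - x) a = 0 by apply: zspan_orth h IH1.
have E2 : bform z a = bform x a by apply/eqP; rewrite -subr_eq0 -bformNl -bformDl ha.
move=> y [k]; rewrite -{2 3}(subrK (a *~ k) y); move: (y - a *~ k) => y' hy.
have hy' := IH2 _ hy; have E := cfE z ra.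
rewrite bformDl bformMzl !bformDr !bformNr !bformMzr hy' (zspan_orth h hy) mulr0 E /sym_form E2.
ring.
Qed.

Lemma reflprod_span F G : num_exc F -> num_exc G -> (forall x, zspan F x <-> zspan G x) -> reflprod F = reflprod G.
Proof.
move=> nF nG FG; apply: zautP => x.
have [h1 h2] := reflprod_serre x nF; have [h3 h4] := reflprod_serre x nG.
have /zspan_sum [c dE] : zspan F (reflprod F x - reflprod G x).
  rewrite -(subrK x (reflprod F x)) -addrA; apply: zspanD => //.
  by rewrite -[x - _]opprB; apply: zspanN; apply/FG.
have z : forall k, (k < size F)%N -> c k = 0.
  apply: (num_exc_free nF) => k hk; have hF := zspan_mem (mem_nth 0 hk).
  by rewrite -dE bformDr bformNr h2 // h4 ?subrr //; apply/FG.
by apply/eqP; rewrite -subr_eq0 dE big1 // => i _; rewrite z ?mulr0z.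
Qed.

Lemma num_exc_size F G : num_exc F -> (forall f, f \in F -> zspan G f) -> (forall g, g \in G -> zspan F g) ->
  (size F <= size G)%N.
Proof.
move=> nF h1 h2.
have H1 (i : 'I_(size F)) : exists c : nat -> int, F`_i = \sum_(j < size G) G`_j *~ c j.
  by apply/zspan_sum; apply: h1; exact: mem_nth.
have H2 (j : 'I_(size G)) : exists c : nat -> int, G`_j = \sum_(i < size F) F`_i *~ c i.
  by apply/zspan_sum; apply: h2; exact: mem_nth.
have [A AE] := choice H1; have [B BE] := choice H2.
apply: (@mulmx1_min int _ _ (\matrix_(i, j) A i j) (\matrix_(j, i) B j i)).
apply/matrixP => i l; rewrite mxE [RHS]mxE.
transitivity (\sum_(j < size G) A i j * B j l); first by apply: eq_bigr => j _; rewrite !mxE.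
transitivity ((i == l :> nat)%:Z : int); last by rewrite -val_eqE /=; case: (_ == _).
apply: (num_exc_indep (c := fun l => \sum_(j < size G) A i j * B j l) (c' := fun l => (i == l :> nat)%:Z) nF) => //.
transitivity (F`_i).
  rewrite [RHS]AE [RHS](eq_bigr (fun j : 'I_(size G) => \sum_(l < size F) F`_l *~ (A i j * B j l))); last first.
    by move=> k _; rewrite {1}BE mulrz_suml; apply: eq_bigr => l' _; rewrite -mulrzA mulrC.
  by rewrite exchange_big; apply: eq_bigr => l' _; rewrite mulrz_sumr.
rewrite (bigD1 i) //= eqxx mulr1z big1 ?addr0 // => j ji.
by rewrite -val_eqE eq_sym /= in ji; rewrite (negPf ji) mulr0z.
Qed.

Lemma reflprod_pabs F : (forall a, a \in F -> real_root a) -> reflprod (map (@pabs C) F) = reflprod F.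
Proof.
elim: F => //= a F IH h; rewrite !reflprod_cons IH; first by rewrite refl_pabs //; apply: h; rewrite mem_head.
by move=> b bF; apply: h; rewrite inE bF orbT.
Qed.
Lemma posroots_pabs F : (forall a, a \in F -> real_root a) -> posroots (map (@pabs C) F).
Proof. by move=> h _ /mapP [a aF ->]; apply: pabs_pr; exact: h. Qed.

Lemma zspan_pabs F x : zspan (map (@pabs C) F) x <-> zspan F x.
Proof.
split; apply: zspan_sub.
  move=> _ /mapP [a aF ->] k.
  by have [->|->] := pabs_cases a; rewrite ?mulNrz -?mulrNz; exact: zspan_in.
move=> a aF k.
have h : pabs a \in map (@pabs C) F by exact: map_f.
have [E|E] := pabs_cases a; first by rewrite -E; exact: zspan_in.
by rewrite -[a]opprK -E mulNrz -mulrNz; exact: zspan_in.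
Qed.

Lemma int_span F x : inIntSpan (in_tuple F) x <-> zspan F x.
Proof.
rewrite zspan_sum; split=> [[c ->]|[c ->]].
  exists (fun i => if insub i is Some j then c j else 0).
  by apply: eq_bigr => i _; rewrite valK.
by exists [ffun i : 'I_(size F) => c i]; apply: eq_bigr => i _; rewrite ffunE.
Qed.

Lemma num_exc_cl : num_exc (cl_seq C).
Proof. by case: (cl_complete C). Qed.

(** F and the simple roots are both exceptional and span the lattice, so Serre duality gives them
    the same product; signs of roots do not affect reflections. *)
Lemma complete_cox_fact F : complete_exceptional F -> (forall a, a \in F -> real_root a) ->
  cox_fact (map (@pabs C) F).
Proof.
move=> [nF sF] rF; have {}sF x : zspan F x by apply/int_span.
split; first exact: posroots_pabs.
  rewrite reflprod_pabs // /cox; apply: (reflprod_span nF num_exc_cl) => x; split=> _; [exact: zspan_cl | exact: sF].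
rewrite size_map; apply/eqP; rewrite eqn_leq; apply/andP; split; apply: num_exc_size => //.
- by move=> f _; exact: zspan_cl.
- exact: num_exc_cl.
- by move=> f _; exact: zspan_cl.
Qed.

(** Each root of E outside F is pushed to the right past the collected part of F, at the price of a
    change of that root only. *)
Lemma subseq_hurw F E : posroots E -> subseq F E -> exists X, hurwitz E (F ++ X).
Proof.
elim: E F => [|a E IH] F pE.
  by rewrite subseq0 => /eqP ->; exists [::]; exact: hurwitz_refl.
have [pa pE'] := (posroots_cons _ _).1 pE.
have drop (F' : seq C) : subseq F' E -> exists X, hurwitz (a :: E) (F' ++ X).
  move=> /(IH _ pE') [X hX].
  have pFX := (hurwitz_prs hX).1 pE'; have [pF pX] := (posroots_cat _ _).1 pFX.
  exists ([:: pabs (reflprod (rev F') a)] ++ X).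
  apply: hurwitz_trans (hurwitz_catl [:: a] hX) _.
  by have := hurwitz_catr X (hurwitz_right pa pF); rewrite -catA.
case: F => [|b F]; first by move=> _; exists (a :: E); exact: hurwitz_refl.
rewrite /=; case: eqVneq => [->|_]; last exact: drop.
by move=> /(IH _ pE') [X hX]; exists X; exact: (hurwitz_catl [:: a] hX).
Qed.

Lemma real_exceptional_fact F : real_exceptional F ->
  exists X, cox_fact (map (@pabs C) F ++ X).
Proof.
case=> E [cE rE FE]; have fE := complete_cox_fact cE rE.
have [pE _ _] := fE; have [X hX] := subseq_hurw pE (map_subseq (@pabs C) FE); exists X.
exact: cox_fact_hurw hX fE.
Qed.
End NumericExceptional.

(** * Reflection length *)

Section ReflLength.
Variable G : groupType.
Variables (W S : set G).
Hypothesis WS : W = gen_subgroup S.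
Hypothesis S2 : forall s, S s -> (s * s)%g = 1%g.
Notation R := (reflections W S).
Implicit Types (A B : seq G) (u v w c : G).

Lemma subW : subgroup_set W. Proof. by rewrite WS; exact: (gen_subgroupP S).1. Qed.
Lemma SW s : S s -> W s. Proof. by rewrite WS; exact: (gen_subgroupP S).2. Qed.
Lemma W_1 : W 1%g. Proof. by case: subW. Qed.
Lemma S_refl s : S s -> R s.
Proof. by move=> h; exists 1%g; [exact: W_1|]; exists s => //; rewrite mul1g invg1 mulg1. Qed.
Lemma refl_W t : R t -> W t.
Proof.
case=> w Ww [s Ss <-]; apply: subgroupM; [exact: subW | | exact: subgroupV subW Ww].
by apply: subgroupM; [exact: subW | | exact: SW].
Qed.
Lemma refl_conjR w t : W w -> R t -> R (w * t * w^-1)%g.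
Proof.
move=> Ww [x Wx [s Ss <-]]; exists (w * x)%g; first exact: subgroupM subW _ _.
by exists s => //; rewrite invgM !mulgA.
Qed.

Lemma refl_length_ex w : W w -> is_refl_length W S w (refl_length W S w).
Proof.
move=> Ww; apply: xgetPex.
have [n0 hn0] : exists n, `[< exists t : seq G, [/\ [set` t] `<=` R, size t = n & prodg t = w] >].
  have := Ww; rewrite [X in X w -> _]WS gen_subgroup_words; last exact: S2. move=> [s [sS ws]].
  exists (size s); apply/asboolP; exists s; split=> //; by move=> x /sS /S_refl.
have ex : exists n, `[< exists t : seq G, [/\ [set` t] `<=` R, size t = n & prodg t = w] >] by exists n0.
exists (ex_minn ex); case: ex_minnP => n /asboolP h1 h2; split=> // t tR pt.
by apply: h2; apply/asboolP; exists t.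
Qed.
Lemma refl_length_le (t : seq G) : [set` t] `<=` R -> (refl_length W S (prodg t) <= size t)%N.
Proof.
move=> tR; have [|_] := @refl_length_ex (prodg t); last exact.
by apply: subgroup_prodg; [exact: subW | move=> x /tR /refl_W].
Qed.
Lemma refl_length_fact w : W w -> exists t : seq G, [/\ [set` t] `<=` R, size t = refl_length W S w & prodg t = w].
Proof. by case/refl_length_ex. Qed.
Lemma refl_length1 : refl_length W S 1%g = 0%N.
Proof.
by apply/eqP; rewrite -leqn0; have := @refl_length_le [::]; rewrite prodg_nil; apply.
Qed.

Lemma set_cat A B : [set` A ++ B] `<=` R <-> [set` A] `<=` R /\ [set` B] `<=` R.
Proof.
split=> [h|[h1 h2] x /=]; last by rewrite mem_cat => /orP [/h1|/h2].
by split=> x /= xh; apply: h; rewrite /= mem_cat xh ?orbT.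
Qed.
Lemma prod_W A : [set` A] `<=` R -> W (prodg A).
Proof. by move=> h; apply: subgroup_prodg subW _ => x /h /refl_W. Qed.

Lemma abs_le_fact w v : W w -> W v -> abs_le W S w v ->
  exists A B, [/\ [set` A] `<=` R, [set` B] `<=` R, prodg A = w, prodg (A ++ B) = v
   & size (A ++ B) = refl_length W S v].
Proof.
move=> Ww Wv; rewrite /abs_le => E.
have [A [hA sA pA]] := refl_length_fact Ww.
have [B [hB sB pB]] := refl_length_fact (subgroupM subW (subgroupV subW Ww) Wv).
by exists A, B; split=> //; [rewrite prodg_cat pA pB mulgA mulgV mul1g | rewrite size_cat sA sB].
Qed.

Lemma fact_abs_le A B : [set` A] `<=` R -> [set` B] `<=` R ->
  size (A ++ B) = refl_length W S (prodg (A ++ B)) ->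
  refl_length W S (prodg A) = size A /\ abs_le W S (prodg A) (prodg (A ++ B)).
Proof.
move=> hA hB E; rewrite /abs_le -E.
have -> : ((prodg A)^-1 * prodg (A ++ B) = prodg B)%g by rewrite prodg_cat mulgA mulVg mul1g.
have h1 := refl_length_le hA; have h2 := refl_length_le hB.
have Wi := prod_W hA; have Wj := prod_W hB.
have [A' [hA' sA' pA']] := refl_length_fact Wi.
have [B' [hB' sB' pB']] := refl_length_fact Wj.
have hAB : [set` A' ++ B'] `<=` R by apply/set_cat.
have h3 := refl_length_le hAB; move: h3 E.
by rewrite !prodg_cat pA' pB' !size_cat sA' sB'; lia.
Qed.

Lemma NC_P c w : W c -> NC W S c w <->
  exists A B, [/\ [set` A] `<=` R, [set` B] `<=` R, prodg A = w, prodg (A ++ B) = c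
   & size (A ++ B) = refl_length W S c].
Proof.
move=> Wc; split=> [[Ww _ h]|[A [B [hA hB <- pc sc]]]]; first exact: abs_le_fact.
split; first exact: prod_W.
  by rewrite /abs_le refl_length1 invg1 mul1g add0n.
have := fact_abs_le hA hB; rewrite pc sc => /(_ erefl); by case.
Qed.

(* s_k <= s_1 ... s_m: move s_k to the front, conjugating the letters before it. *)
Lemma letter_NC (s : seq G) x : [set` s] `<=` S -> refl_length W S (prodg s) = size s -> x \in s ->
  NC W S (prodg s) x.
Proof.
move=> sS E xs; have sR : [set` s] `<=` R by move=> y /sS /S_refl.
have Wc := prod_W sR; apply/NC_P => //.
case/splitPr: xs sS E sR Wc => p1 p2 sS E sR Wc.
have [hp /(set_cat [:: x]) [hx hp2]] := (set_cat _ _).1 sR.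
have Rx : R x by apply: hx; rewrite /= inE.
pose p1' := map (fun y => x^-1 * y * x^-1^-1)%g p1.
exists [:: x], (p1' ++ p2); split=> //.
- apply/set_cat; split=> // y /= /mapP [z zp ->].
  apply: refl_conjR; [exact: subgroupV subW (refl_W Rx) | exact: hp].
- by rewrite prodg_cons prodg_nil mulg1.
- rewrite /= prodg_cons !prodg_cat prodg_cons.
  have -> : prodg p1' = (x^-1 * prodg p1 * x)%g.
    rewrite /p1'; elim: (p1) => [|y q IH] /=; first by rewrite !prodg_nil mulg1 mulVg.
    by rewrite !prodg_cons IH invgK !mulgA mulgK.
  by rewrite !mulgA mulgV mul1g.
- by rewrite E /= !size_cat size_map /= addnS.
Qed.
End ReflLength.

Lemma has_order_uniq (G : groupType) (g : G) m n : has_order g m -> has_order g n -> m = n.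
Proof.
move=> [m0 hm] [n0 hn]; apply/eqP; rewrite eqn_dvd.
by rewrite (hm n).1 ?(hn m).1 //; [apply/hm | apply/hn].
Qed.

(** * Transport of Coxeter systems along maps that are injective homomorphisms on W *)

Section Transfer.
Variables (G H : groupType) (W S : set G) (h : G -> H).
Hypothesis cW : coxeter_system W S.
Hypothesis hM : forall u v, W u -> W v -> h (u * v)%g = (h u * h v)%g.
Hypothesis hI : forall u v, W u -> W v -> h u = h v -> u = v.

Lemma tr_S2 s : S s -> (s * s)%g = 1%g.
Proof.
have [_ + _] := cW => /[apply] -[_ /(_ 2%N)]; rewrite expgS expg1 => ->; exact: dvdnn.
Qed.
Let WS : W = gen_subgroup S. Proof. by case: cW. Qed.
Let sW := subW WS.
Lemma tr_1 : h 1%g = 1%g.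
Proof.
have W1 : W 1%g by case: sW.
by apply: (mulgI (h 1%g)); rewrite -hM // !mulg1.
Qed.
Lemma tr_prod s : (forall x, x \in s -> W x) -> h (prodg s) = prodg (map h s).
Proof.
elim: s => [|x s IH] hs; first by rewrite !prodg_nil tr_1.
rewrite /= !prodg_cons hM ?IH //; first by move=> y ys; apply: hs; rewrite inE ys orbT.
  by apply: hs; rewrite inE eqxx.
by apply: subgroup_prodg sW _ => y ys; apply: hs; rewrite inE ys orbT.
Qed.
Lemma tr_exp x k : W x -> h (x ^+ k)%g = (h x ^+ k)%g /\ W (x ^+ k)%g.
Proof.
move=> Wx; elim: k => [|k [IH1 IH2]]; first by rewrite !expg0 tr_1; split=> //; case: sW.
by rewrite !expgS hM // IH1; split=> //; exact: subgroupM sW _ _.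
Qed.
Lemma tr_order x k : W x -> has_order x k -> has_order (h x) k.
Proof.
move=> Wx [k0 hk]; split=> // l; rewrite -hk; have [<- Wl] := tr_exp l Wx.
by split=> [|->]; [rewrite -tr_1 => /hI; apply=> //; case: sW | exact: tr_1].
Qed.
Lemma tr_S s : S s -> W s. Proof. exact: SW WS _. Qed.
Lemma tr_lift (u : seq H) : [set` u] `<=` h @` S -> exists v, [set` v] `<=` S /\ map h v = u.
Proof.
elim: u => [|x u IH] hu; first by exists [::].
have [v [vS vu]] : exists v, [set` v] `<=` S /\ map h v = u.
  by apply: IH => y yu; apply: hu; rewrite /= inE (yu : y \in u) orbT.
have [y Sy yx] := hu x (mem_head _ _).
exists (y :: v); rewrite /= yx vu; split=> // z /=; rewrite inE => /orP [/eqP ->|/vS] //.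
Qed.
Lemma tr_cong u v : cox_cong S u v -> cox_cong (h @` S) (map h u) (map h v).
Proof.
elim=> [w|? ? _ ?|? ? ? _ ? _ ?|a b s t m Ss St o].
- exact: cox_cong_refl.
- exact: cox_cong_sym.
- by apply: cox_cong_trans; eauto.
rewrite !map_cat; have -> : map h (flatten (nseq m [:: s; t])) = flatten (nseq m [:: h s; h t]).
  by elim: m {o} => //= m ->.
apply: cox_cong_rel; [by exists s | by exists t |].
by rewrite -hM; [apply: tr_order o; apply: subgroupM sW _ _ | |]; exact: tr_S.
Qed.
Lemma tr_gen : h @` W = gen_subgroup (h @` S).
Proof.
rewrite gen_subgroup_words; last first.
  by move=> _ [s Ss <-]; rewrite -hM; [rewrite tr_S2 // tr_1 // | |]; exact: tr_S.
apply/seteqP; split=> [_ [w Ww <-]|_ [s [/tr_lift [u [uS <-]] ->]]].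
  move: Ww; rewrite {1}WS gen_subgroup_words; last exact: tr_S2.
  move=> [s [sS ->]]; exists (map h s); split.
    by move=> _ /= /mapP [x xs ->]; exists x => //; exact: sS.
  by apply: tr_prod => x /sS /tr_S.
exists (prodg u); last by apply: tr_prod => x /uS /tr_S.
by apply: subgroup_prodg sW _ => x /uS /tr_S.
Qed.
Lemma coxeter_system_transfer : coxeter_system (h @` W) (h @` S).
Proof.
split; first exact: tr_gen.
  by move=> _ [s Ss <-]; apply: tr_order; [exact: tr_S | have [_ + _] := cW; apply].
move=> _ _ /tr_lift [u [uS <-]] /tr_lift [v [vS <-]].
have hw w : [set` w] `<=` S -> forall x, x \in w -> W x by move=> wS x /wS /tr_S.
rewrite -!tr_prod; try exact: hw.
move=> E; apply: tr_cong; have [_ _] := cW; apply=> //.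
by apply: hI => //; apply: subgroup_prodg sW _; exact: hw.
Qed.
Lemma coxeter_element_transfer c : coxeter_element S c -> coxeter_element (h @` S) (h c).
Proof.
case=> s [us sS ->]; exists (map h s).
have hs x : x \in s -> S x by move=> xs; rewrite -sS.
split; last by apply: tr_prod => x /hs /tr_S.
  by rewrite map_inj_in_uniq // => x y /hs /tr_S ? /hs /tr_S ?; exact: hI.
apply/seteqP; split=> [_ /= /mapP [x xs ->]|_ [x Sx <-]]; first by exists x => //; exact: hs.
by apply/mapP; exists x => //; move: Sx; rewrite -sS.
Qed.
End Transfer.

(** * A geometric representation of an abstract Coxeter group *)

Section ReflMatrix.
Variables (F : fieldType) (n : nat).
Implicit Types (e x : 'rV[F]_n) (l : 'cV[F]_n).

Definition rmx e l : 'M[F]_n := 1%:M - l *m e.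
Definition pair e l : F := (e *m l) 0 0.

Lemma pairE e l : e *m l = (pair e l)%:M.
Proof. by rewrite /pair {1}[e *m l]mx11_scalar. Qed.
Lemma rmxE x e l : x *m rmx e l = x - pair x l *: e.
Proof. by rewrite /rmx mulmxBr mulmx1 mulmxA pairE mul_scalar_mx. Qed.
Lemma pairD x y a l : pair (x + a *: y) l = pair x l + a * pair y l.
Proof. by rewrite /pair mulmxDl -scalemxAl mxE [X in _ + X = _]mxE. Qed.
Lemma rmx_invo e l : pair e l = 2%:R -> rmx e l *m rmx e l = 1%:M.
Proof.
move=> h; apply/row_matrixP => i; rewrite !rowE mulmxA mulmx1 !rmxE.
set x := delta_mx 0 i; rewrite -[x - _ *: e]/(x + - (_ *: e)) -scaleNr pairD h.
by apply/rowP => j; rewrite !mxE; ring.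
Qed.

(* The product P has eigenvectors e - z e' and e - e' for z and 1/z, and its image minus identity lies in their span. *)
Lemma rmx_braid e e' l l' (z : F) k : pair e l = 2%:R -> pair e' l' = 2%:R ->
  pair e l' = 1 + z -> pair e' l = 1 + z^-1 -> z != 0 -> z != 1 -> z ^+ k = 1 ->
  iter k (mulmx (rmx e l *m rmx e' l')) 1%:M = 1%:M.
Proof.
move=> h1 h2 h3 h4 z0 z1 zk; set P := rmx e l *m _.
pose v1 := e - z *: e'; pose v2 := e - e'.
have E x : x *m P = x - pair x l *: e - (pair x l' - pair x l * (1 + z)) *: e'.
  rewrite /P mulmxA !rmxE; congr (_ - _ *: _).
  by rewrite -scaleNr pairD h3 mulNr.
have P1 : v1 *m P = z *: v1.
  rewrite E /v1 -scaleNr !pairD h1 h2 h3 h4.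
  by apply/rowP => j; rewrite !mxE; field.
have P2 : v2 *m P = z^-1 *: v2.
  rewrite E /v2 -[- e']scaleN1r !pairD h1 h2 h3 h4.
  by apply/rowP => j; rewrite !mxE; field.
have Pk (v : 'rV[F]_n) y j : v *m P = y *: v -> v *m iter j (mulmx P) 1%:M = y ^+ j *: v.
  move=> h; elim: j => [|j IH]; first by rewrite mulmx1 scale1r.
  by rewrite iterS mulmxA h -scalemxAl IH scalerA -exprS.
have geo (y : F) : y != 1 -> y ^+ k = 1 -> \sum_(j < k) y ^+ j = 0.
  move=> y1 yk; apply/eqP; have := subrX1 y k; rewrite yk subrr => /esym/eqP.
  by rewrite mulf_eq0 subr_eq0 (negPf y1).
apply/row_matrixP => i; rewrite !rowE mulmx1; set x := delta_mx 0 i.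
have [a [b xP]] : exists a b, x *m P = x + a *: v1 + b *: v2.
  have z1' : 1 - z != 0 by rewrite subr_eq0 eq_sym.
  pose c := - pair x l; pose d := - (pair x l' - pair x l * (1 + z)).
  exists ((c + d) / (1 - z)), (c - (c + d) / (1 - z)).
  by rewrite E /v1 /v2 /c /d; apply/rowP => j; rewrite !mxE; field.
have H j : x *m iter j (mulmx P) 1%:M =
    x + (a * \sum_(i < j) z ^+ i) *: v1 + (b * \sum_(i < j) z^-1 ^+ i) *: v2.
  elim: j => [|j IH]; first by rewrite !big_ord0 !mulr0 !scale0r !addr0 mulmx1.
  rewrite iterS mulmxA xP !mulmxDl IH -!scalemxAl (Pk _ _ _ P1) (Pk _ _ _ P2) !scalerA.
  rewrite !big_ord_recr /= !mulrDr !scalerDl !addrA.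
  by congr (_ + _); rewrite -!addrA; congr (_ + (_ + _)); rewrite addrC.
by rewrite H !geo ?mulr0 ?scale0r ?addr0 ?exprVn ?zk ?invr1 ?invr_eq1.
Qed.

Lemma rank_mulB1 (A B : 'M[F]_n) : (\rank (A *m B - 1%:M)%R <= \rank (A - 1%:M)%R + \rank (B - 1%:M)%R)%N.
Proof.
have -> : A *m B - 1%:M = (A - 1%:M) *m B + (B - 1%:M).
  by rewrite mulmxBl mul1mx addrA subrK.
apply: leq_trans (mxrank_add _ _) _; rewrite leq_add2r; exact: mxrankM_maxl.
Qed.
End ReflMatrix.

Section CoxeterReflLength.
Variable G : groupType.
Variables (W S : set G) (s0 : seq G).
Hypothesis cW : coxeter_system W S.
Hypotheses (us0 : uniq s0) (s0S : [set` s0] = S).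
Let m := size s0.
Notation F := algC.
Let g (i : 'I_m) : G := nth 1%g s0 i.

Let S2 s : S s -> (s * s)%g = 1%g. Proof. exact: tr_S2 cW s. Qed.
Let WS : W = gen_subgroup S. Proof. by case: cW. Qed.

Lemma gS i : S (g i). Proof. by rewrite -s0S; exact: mem_nth. Qed.
Lemma g_inj : injective g.
Proof. by move=> i j /eqP; rewrite nth_uniq // => /eqP /val_inj. Qed.
Lemma gE s : S s -> exists i, s = g i.
Proof.
rewrite -s0S /= => h; have hi : (index s s0 < m)%N by rewrite index_mem.
by exists (Ordinal hi); rewrite /g nth_index.
Qed.

Lemma gV i : (g i)^-1%g = g i.
Proof. by apply: (mulgI (g i)); rewrite mulgV S2 //; exact: gS. Qed.

(* The Cartan matrix used below has entries 1 + z_ij with z_ij a root of unity of order m_ij and z_ji = 1 / z_ij. *)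
Lemma zeta_ex (i j : 'I_m) : exists z : F, z != 0 /\
  forall k, i != j -> has_order (g i * g j)%g k -> z ^+ k = 1 /\ z != 1.
Proof.
(* Without a finite order there is no relation to satisfy, and 1 serves as default. *)
have [[k [hk ij]]|no] := pselect (exists k, has_order (g i * g j)%g k /\ i != j); last first.
  by exists 1; rewrite oner_neq0; split=> // k ij hk; case: no; exists k.
have [k0 hk'] := hk.
have [z pz] := C_prim_root_exists k0; exists z; split.
  by apply: contra_eq_neq (prim_expr_order pz) => ->; rewrite expr0n gtn_eqF // eq_sym oner_neq0.
move=> l _ hl; rewrite -(has_order_uniq hk hl) (prim_expr_order pz); split=> //.
apply/negP => z1; have k1 : (k %| 1)%N by rewrite (prim_order_dvd pz) expr1.
move/negP: ij; apply; apply/eqP/g_inj; have /(hk' 1%N).2 := k1.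
by rewrite expg1 => /(congr1 (fun x => x * g j)%g); rewrite -mulgA S2 ?mul1g ?mulg1 //; exact: gS.
Qed.

Definition zeta (i j : 'I_m) : F := if (i < j)%N then sval (cid (zeta_ex i j))
  else (sval (cid (zeta_ex j i)))^-1.

Lemma has_orderV (x : G) k : has_order x k -> has_order (x^-1)%g k.
Proof.
case=> k0 hk; split=> // l; rewrite -hk expVgn; split=> [/(congr1 (fun x => x^-1)%g)|->].
  by rewrite invgK invg1.
by rewrite invg1.
Qed.

Lemma ztP (i j : 'I_m) : i != j -> [/\ zeta i j != 0, zeta j i = (zeta i j)^-1 &
  forall k, has_order (g i * g j)%g k -> zeta i j ^+ k = 1 /\ zeta i j != 1].
Proof.
move=> ij; have ji : j != i by rewrite eq_sym.
have [lt|lt|E] := ltngtP i j; last by move: ij; rewrite (val_inj E) eqxx.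
  rewrite /zeta lt ltnNge ltnW //=; case: (cid _) => z /= [z0 hz]; split=> // k; exact: hz.
rewrite /zeta lt ltnNge ltnW //=; case: (cid _) => z /= [z0 hz]; rewrite invr_eq0 invrK; split=> // k hk.
have [] := hz k ji _; first by have := has_orderV hk; rewrite invgM !gV.
by move=> E z1; rewrite exprVn E invr1 invr_eq1.
Qed.

(* The second summand makes the linear forms independent. *)
Definition cvec (i : 'I_m) : 'rV[F]_(m + m) := row_mx (delta_mx 0 i) 0.
Definition cform (i : 'I_m) : 'cV[F]_(m + m) :=
  col_mx (\col_j (if j == i then 2%:R else 1 + zeta j i)) (delta_mx i 0).
Lemma pair_cvec i j : pair (cvec j) (cform i) = if j == i then 2%:R else 1 + zeta j i.
Proof. by rewrite /pair /cvec /cform mul_row_col mul0mx addr0 -rowE !mxE. Qed.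

Definition lmx (x : G) : 'M[F]_(m + m) :=
  if insub (index x s0) is Some i then rmx (cvec i) (cform i) else 1%:M.
Lemma lmx_g i : lmx (g i) = rmx (cvec i) (cform i).
Proof. by rewrite /lmx /g index_uniq // valK. Qed.
Definition wmx (u : seq G) : 'M[F]_(m + m) := foldr (fun x M => lmx x *m M) 1%:M u.
Lemma wmx_cat u v : wmx (u ++ v) = wmx u *m wmx v.
Proof. by elim: u => [|x u IH] /=; rewrite ?mul1mx // IH mulmxA. Qed.

Lemma wmx_cong u v : cox_cong S u v -> wmx u = wmx v.
Proof.
elim=> [//|? ? _ -> //|? ? ? _ -> _ -> //|a b s t k /gE [i ->] /gE [j ->] o].
rewrite !wmx_cat; suff -> : wmx (flatten (nseq k [:: g i; g j])) = 1%:M by rewrite mul1mx.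
have -> : wmx (flatten (nseq k [:: g i; g j])) = iter k (mulmx (lmx (g i) *m lmx (g j))) 1%:M.
  by elim: (k) => //= l ->; rewrite mulmxA.
rewrite !lmx_g; have [E|ij] := eqVneq i j.
  rewrite E rmx_invo; first by elim: (k) => //= l ->; rewrite mul1mx.
  by rewrite pair_cvec eqxx.
have [z0 zV zk] := ztP ij; have [h1 h2] := zk k o.
by apply: (rmx_braid (z := zeta i j)); rewrite // pair_cvec ?eqxx ?(negPf ij) // eq_sym (negPf ij) zV.
Qed.

Lemma wmx_coord u (x : 'rV[F]_(m + m)) (i : 'I_m) : g i \notin u ->
  (x *m wmx u) 0 (lshift m i) = x 0 (lshift m i).
Proof.
elim: u x => [|y u IH] x; first by rewrite mulmx1.
rewrite inE negb_or => /andP [yi iu] /=; rewrite mulmxA IH // /lmx.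
case: insubP => [j jl jE|_]; last by rewrite mulmx1.
rewrite rmxE [LHS]mxE [X in _ + X]mxE [X in - X]mxE /cvec row_mxEl mxE eqxx /=.
have -> : (i == j) = false; last by rewrite mulr0 subr0.
apply: contraNF yi => /eqP ->; apply/eqP.
by move: jl; rewrite /m index_mem => hy; rewrite /g [nat_of_ord j]jE nth_index.
Qed.

(** The letters of [u] are distinct, so a multiple of [cvec j] is subtracted only once along the
    word; it shows in the j-th coordinate of the result and must vanish for a fixed vector. Later
    letters then meet the same [x]. *)
Lemma wmx_fix u (x : 'rV[F]_(m + m)) : uniq u -> [set` u] `<=` S -> x *m wmx u = x ->
  forall i, g i \in u -> pair x (cform i) = 0.
Proof.
elim: u x => [//|y u IH] x /= /andP [yu uu] uS h i.
have [j Ej] : exists j, y = g j by apply: gE; apply: uS; exact: mem_head.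
subst y; rewrite mulmxA lmx_g rmxE in h.
have xj : pair x (cform j) = 0.
  have := congr1 (fun M : 'rV_(m + m) => M 0 (lshift m j)) h; rewrite wmx_coord //.
  rewrite [LHS]mxE [X in _ + X]mxE [X in - X]mxE /cvec row_mxEl mxE !eqxx mulr1 => /eqP.
  by rewrite -subr_eq0 addrAC subrr add0r oppr_eq0 => /eqP.
rewrite inE => /orP [/eqP /g_inj -> //|iu].
apply: IH iu => //; first by move=> z zu; apply: uS; rewrite /= inE (zu : z \in u) orbT.
by rewrite xj scale0r subr0 in h.
Qed.

(** A vector fixed by the product of all letters is killed by all m forms [cform], which are
    independent because of their lower halves. *)
Lemma rank_wmx : (m <= \rank (wmx s0 - 1%:M)%R)%N.
Proof.
pose L : 'M[F]_(m + m, m) := \matrix_(i, j) cform j i 0.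
have rL : \rank L = m.
  have E : row_mx 0 1%:M *m L = 1%:M.
    apply/matrixP => i j; have -> : L = col_mx (\matrix_(k, j) cform j (lshift m k) 0) 1%:M.
      apply/matrixP => k l; case: (split_ordP k) => k' ->.
        by rewrite col_mxEu !mxE.
      by rewrite col_mxEd [LHS]mxE /cform col_mxEd !mxE eqxx andbT.
    by rewrite mul_row_col mul0mx add0r mul1mx.
  by apply/eqP; rewrite eqn_leq rank_leq_col /= -{1}(mxrank1 F m) -E mxrankM_maxr.
have kL : (kermx (wmx s0 - 1%:M) <= kermx L)%MS.
  apply/row_subP => i; set x := row i _; apply/sub_kermxP.
  have /eqP : x *m (wmx s0 - 1%:M) = 0.
    by apply/sub_kermxP; exact: row_sub.
  rewrite mulmxBr mulmx1 subr_eq0 => /eqP h.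
  apply/rowP => j; rewrite mxE [RHS]mxE.
  have := wmx_fix us0 _ h (i := j); rewrite s0S => /(_ (@subset_refl _ _) (mem_nth _ _)).
  move=> H; transitivity (pair x (cform j)); last exact: H.
  by rewrite /pair [RHS]mxE; apply: eq_bigr => k _; rewrite [L _ _]mxE.
have := mxrankS kL; rewrite !mxrank_ker rL; have := rank_leq_row (wmx s0 - 1%:M); lia.
Qed.

Lemma wmx_refl t : reflections W S t -> exists u, [/\ [set` u] `<=` S, prodg u = t
  & (\rank (wmx u - 1%:M)%R <= 1)%N].
Proof.
case=> w Ww [s Ss <-]; move: Ww; rewrite {1}WS gen_subgroup_words // => -[u [uS ->]].
have u2 x : x \in u -> (x * x)%g = 1%g by move=> /uS; exact: S2.
exists (u ++ s :: rev u); split.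
- move=> x /=; rewrite mem_cat inE mem_rev => /or3P [/uS //|/eqP -> //|/uS //].
- by rewrite prodg_cat prodg_cons -prodg_revV // !mulgA.
have uV : wmx u *m wmx (rev u) = 1%:M.
  elim: u uS {u2} => [|y u IH] uS; first by rewrite mulmx1.
  rewrite rev_cons -cats1 wmx_cat /= mulmx1 -mulmxA [wmx u *m _]mulmxA IH ?mul1mx; last first.
    by move=> z zu; apply: uS; rewrite /= inE (zu : z \in u) orbT.
  have [j ->] : exists j, y = g j by apply: gE; apply: uS; exact: mem_head.
  by rewrite lmx_g rmx_invo // pair_cvec eqxx.
have [j ->] := gE Ss.
rewrite wmx_cat /= lmx_g /rmx mulmxBl mul1mx mulmxBr uV addrAC subrr add0r mxrank_opp -!mulmxA.
apply: leq_trans (mxrankM_maxr _ _) _.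
apply: leq_trans (mxrankM_maxr _ _) _; exact: rank_leq_row.
Qed.

(** The rank of w - 1 is subadditive, at most 1 on reflections and at least m on the Coxeter
    element. Matrices are attached to words, so the Coxeter presentation is needed to pass from the
    word of t to [s0]. *)
Lemma coxeter_refl_bound (t : seq G) : [set` t] `<=` reflections W S ->
  prodg t = prodg s0 -> (m <= size t)%N.
Proof.
move=> tR pt.
have [u [uS pu ru]] : exists u, [/\ [set` u] `<=` S, prodg u = prodg t
    & (\rank (wmx u - 1%:M)%R <= size t)%N].
  elim: t tR {pt} => [|x t IH] tR; first by exists [::]; rewrite subrr mxrank0.
  have [|u [uS pu ru]] := IH; first by move=> y yt; apply: tR; rewrite /= inE (yt : y \in t) orbT.
  have [v [vS pv rv]] : exists v, [/\ [set` v] `<=` S, prodg v = x & (\rank (wmx v - 1%:M)%R <= 1)%N].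
    by apply: wmx_refl; apply: tR; exact: mem_head.
  exists (v ++ u); split.
  - by move=> y /=; rewrite mem_cat => /orP [/vS|/uS].
  - by rewrite prodg_cat prodg_cons pu pv.
  by rewrite wmx_cat; apply: leq_trans (rank_mulB1 _ _) _; rewrite (leq_add rv ru).
apply: leq_trans rank_wmx (leq_trans _ ru); rewrite (wmx_cong (u := s0) (v := u)) //.
have [_ _] := cW; apply=> //; first by rewrite s0S.
by rewrite pu pt.
Qed.
End CoxeterReflLength.

(** * Subobjects and subgroups *)

Section WeylMap.
Variables (C' C : cartan_lattice) (phi : cl_morphism C' C).
Notation e := (@sroot C').
Notation sr := (@sr C').
Notation act := (@act C').

Lemma clm0 : phi 0 = 0.
Proof. by apply: (addIr (phi 0)); rewrite -clm_add !add0r. Qed.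
Lemma clmN x : phi (- x) = - phi x.
Proof. by apply: (addIr (phi x)); rewrite -clm_add !addNr clm0. Qed.
Lemma clmM x k : phi (x *~ k) = phi x *~ k.
Proof.
elim/int_rect: k => [|n IH|n IH]; first by rewrite !mulr0z clm0.
  by rewrite intS !mulrzDr clm_add IH.
by rewrite intS opprD !mulrzDr clm_add IH !mulrN1z clmN.
Qed.
Lemma clm_inj : injective phi.
Proof.
move=> x y h; apply/eqP; rewrite -subr_eq0; apply/eqP; apply: (bform_ndl (b := C')) => z.
by rewrite -(clm_form phi) clm_add clmN h subrr bform0l.
Qed.

Lemma clm_e_real a : a \in cl_seq C' -> real_root (phi a).
Proof. by have [E [_ rE /mem_subseq sE]] := clm_real phi => h; apply/rE/sE/map_f. Qed.
Lemma clm_e_root i : is_root (phi (e i)).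
Proof. by apply/real_root_root/clm_e_real/sroot_in. Qed.
Lemma clm_sym x y : sym_form (phi x) (phi y) = sym_form x y.
Proof. by rewrite /sym_form !clm_form. Qed.
Lemma clm_cf a b : refl_coef (phi a) (phi b) = refl_coef a b.
Proof. by rewrite /refl_coef !clm_sym. Qed.
Lemma clm_refl a b : is_root a -> is_root (phi a) -> refl (phi a) (phi b) = phi (refl a b).
Proof. by move=> ra rpa; rewrite !reflE // clm_cf clm_add clmN clmM. Qed.

Definition simg (s : zaut C') : zaut C :=
  if pselect (exists i, s = sr i) is left h then refl (phi (e (sval (cid h)))) else 1%g.
Lemma simgE i : simg (sr i) = refl (phi (e i)).
Proof.
rewrite /simg; case: pselect => [h|]; last by case; exists i.
by case: (cid _) => j /= /sr_inj ->.
Qed.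
Definition wimg (u : seq 'I_(rk C')) : zaut C := prodg (map (fun i => refl (phi (e i))) u).

Lemma prodg_rel (G : groupType) (f : G -> zaut C) (s t : G) k :
  prodg (map f (flatten (nseq k [:: s; t]))) = ((f s * f t) ^+ k)%g.
Proof. by rewrite -prodg_nseq; congr prodg; elim: k => //= k ->. Qed.

(* A finite order forces the Cartan product below 4, where the order depends on the Cartan entries only. *)
Lemma simg_order i j k : has_order (sr i * sr j)%g k -> ((refl (phi (e i)) * refl (phi (e j))) ^+ k)%g = 1%g.
Proof.
move=> hk; have [E|ij] := eqVneq i j.
  by rewrite E refl_invo ?expg1n //; exact: clm_e_root.
have ri := clm_e_root i; have rj := clm_e_root j.
have [lt|ge] := ltP (cartan_entry i j * cartan_entry j i) 4.
  have [m0 [cases hm0]] := order_pq ij lt; rewrite (has_order_uniq hk hm0).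
  have := dihedral_order ri rj; rewrite !clm_cf -/(cartan_entry i j) -/(cartan_entry j i) => -[d2 [d3 [d4 d6]]].
  case: cases => [[-> [h1 h2]]|[[-> h]|[[-> h]|[-> h]]]].
  - by apply: d2; rewrite h1 h2 mul0r.
  - exact: d3.
  - exact: d4.
  - exact: d6.
exfalso; have [k0 /(_ k) hk'] := hk.
have E : act (alt i j k.*2) = 1%g.
  rewrite -flatten_alt /act; have -> : map sr (flatten (nseq k [:: i; j])) = flatten (nseq k [:: sr i; sr j]).
    by elim: (k) => //= l ->.
  by rewrite prodg_nseq; apply/hk'; exact: dvdnn.
have Ek : (k.*2 = 1 + (k.*2).-1)%N by rewrite add1n prednK // double_gt0.
have od : odd (k.*2).-1 by rewrite -[odd _]negbK -oddS prednK ?double_gt0 // odd_double.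
rewrite Ek alt_cat od /= act_cons in E.
have [a [b [a0 b0 Ec]]] := alt_cone_big (k.*2).-1 ij ge.
have : act (alt i j (k.*2).-1) (e i) = - e i.
  have : act (alt i j (k.*2).-1) = sr i.
    by apply: (mulgI (sr i)); rewrite E sr_invo.
  by move=> ->; rewrite sr_ei.
rewrite Ec => /(congr1 (fun x => coord x i)).
by rewrite coordD !coordM coordN !coord_e eqxx eq_sym (negPf ij) mulr0 addr0 mulr1; lia.
Qed.

Lemma simg_cong (u v : seq (zaut C')) : cox_cong (simple_refl C') u v ->
  prodg (map simg u) = prodg (map simg v).
Proof.
elim=> [//|? ? _ -> //|? ? ? _ -> _ -> //|a b s t k /simple_reflP [i ->] /simple_reflP [j ->] o].
by rewrite !map_cat !prodg_cat prodg_rel !simgE simg_order // mul1g.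
Qed.
(** An equality in W(C') controls the products in W(C) directly on the image of [phi] only. On the
    rest of C it is carried over by the presentation of W(C'). *)
Lemma wimg_act u v : act u = act v -> wimg u = wimg v.
Proof.
move=> /act_faithful /simg_cong; rewrite /wimg -!map_comp.
by rewrite !(eq_map (f := simg \o sr) (g := fun i => refl (phi (e i)))) //; exact: simgE.
Qed.
Lemma wimg_cat u v : wimg (u ++ v) = (wimg u * wimg v)%g.
Proof. by rewrite /wimg map_cat prodg_cat. Qed.
Lemma wimg_weyl u : weyl C (wimg u).
Proof.
apply: subgroup_prodg (weyl_sg C) _ => _ /mapP [i _ ->].
by apply: refl_weyl; apply: clm_e_real; exact: sroot_in.
Qed.
Lemma wimg_phi u x : wimg u (phi x) = phi (act u x).
Proof.
elim: u x => [|i u IH] x; first by rewrite /wimg /= prodg_nil act_nil.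
rewrite /wimg /= prodg_cons act_cons !zmulE -/(wimg u) IH.
by rewrite clm_refl //; [exact: sroot_root | exact: clm_e_root].
Qed.
Lemma wimg_rev u : wimg (rev u) = (wimg u)^-1%g.
Proof.
rewrite /wimg prodg_revV ?map_rev // => _ /mapP [i _ ->].
by rewrite refl_invo //; exact: clm_e_root.
Qed.

Lemma weyl_map_ex : exists h, is_weyl_map phi h.
Proof.
have H w : exists u : zaut C, weyl C' w -> exists2 v, w = act v & u = wimg v.
  have [Ww|] := pselect (weyl C' w); last by exists 1%g.
  by move: (Ww); rewrite weylE => -[v E]; exists (wimg v) => _; exists v.
have [h hP] := choice H.
have hE u : h (act u) = wimg u.
  by have [v E ->] := hP _ (weyl_act u); apply: wimg_act.
exists h; split.
- by move=> u /hP [v _ ->]; exact: wimg_weyl.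
- by move=> u v; rewrite weylE => -[a ->] [b ->]; rewrite -act_cat !hE wimg_cat.
- move=> a /real_rootP [u [i ->]].
  have -> : refl (act u (e i)) = act (u ++ i :: rev u).
    rewrite act_cat act_cons act_rev mulgA refl_weyl_conj //; [exact: weyl_act | exact: real_e].
  rewrite hE wimg_cat -cat1s wimg_cat wimg_rev mulgA -wimg_phi.
  have -> : wimg [:: i] = refl (phi (e i)) by rewrite /wimg /= prodg_cons prodg_nil mulg1.
  by rewrite refl_weyl_conj //; [exact: wimg_weyl | apply: clm_e_real; exact: sroot_in].
Qed.

Let h := weyl_map phi.
Lemma weyl_mapP : is_weyl_map phi h.
Proof. exact: xgetPex weyl_map_ex. Qed.
Lemma weyl_map_weyl u : weyl C' u -> weyl C (h u). Proof. by case: weyl_mapP => + _ _; apply. Qed.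
Lemma weyl_mapM u v : weyl C' u -> weyl C' v -> h (u * v)%g = (h u * h v)%g.
Proof. by case: weyl_mapP => _ + _; apply. Qed.
Lemma weyl_map_refl (a : C') : real_root a -> h (refl a) = refl (phi a).
Proof. by case: weyl_mapP => _ _; apply. Qed.
Lemma weyl_map1 : h 1%g = 1%g.
Proof. by apply: (mulgI (h 1%g)); rewrite -weyl_mapM ?mulg1 //; exact: weyl1. Qed.
Lemma weyl_map_rp (F : seq C') : (forall a, a \in F -> real_root a) -> h (reflprod F) = reflprod (map phi F).
Proof.
elim: F => [|a F IH] hF; first by rewrite !reflprod_nil weyl_map1.
have ra : real_root a by apply: hF; rewrite mem_head.
have rF b : b \in F -> real_root b by move=> bF; apply: hF; rewrite inE bF orbT.
rewrite /= !reflprod_cons weyl_mapM ?weyl_map_refl ?IH //; first exact: refl_weyl.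
by apply: subgroup_prodg (weyl_sg C') _ => _ /mapP [b /rF rb ->]; exact: refl_weyl.
Qed.
Lemma weyl_map_act u : h (act u) = wimg u.
Proof.
rewrite -reflprod_simples weyl_map_rp; first by rewrite /reflprod /wimg /simple_roots -!map_comp.
by move=> _ /mapP [i _ ->]; exact: real_e.
Qed.
Lemma weyl_map_phi w x : weyl C' w -> h w (phi x) = phi (w x).
Proof. by rewrite weylE => -[u ->]; rewrite weyl_map_act wimg_phi. Qed.
Lemma weyl_map_inj u v : weyl C' u -> weyl C' v -> h u = h v -> u = v.
Proof.
move=> Wu Wv E; apply: zautP => x; apply: clm_inj.
by rewrite -!weyl_map_phi // E.
Qed.
Lemma weyl_map_real (a : C') : real_root a -> real_root (phi a).
Proof.
move=> [w [b [Ww bE ->]]]; rewrite -weyl_map_phi //.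
by apply: real_weyl; [exact: weyl_map_weyl | exact: clm_e_real].
Qed.
End WeylMap.

Lemma hurwitz_closed (C : cartan_lattice) (P : C -> Prop) : (forall a, P a -> P (- a)) ->
  (forall a b, is_root a -> P a -> P b -> P (refl a b)) ->
  forall F G, hurwitz F G -> (forall a, a \in F -> P a) <-> (forall a, a \in G -> P a).
Proof.
move=> PN Pr F G; elim=> [//|s t _ H|s t r _ H1 _ H2|xs a b ys pa pb]; first by rewrite H.
  by rewrite H1.
have Pp x : P x -> P (pabs x) by have [->|->] := pabs_cases x => //; exact: PN.
split=> h c; rewrite mem_cat !inE => /or4P [cx|/eqP ->|/eqP ->|cy].
- by apply: h; rewrite mem_cat cx.
- by apply/Pp/Pr; [exact: posroot_root | |]; apply: h; rewrite mem_cat !inE eqxx ?orbT.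
- by apply: h; rewrite mem_cat !inE eqxx ?orbT.
- by apply: h; rewrite mem_cat !inE cy ?orbT.
- by apply: h; rewrite mem_cat cx.
- by apply: h; rewrite mem_cat !inE eqxx ?orbT.
- rewrite -(pabs_refl2 pa pb); apply/Pp/Pr; [exact: posroot_root | |];
  by apply: h; rewrite mem_cat !inE eqxx ?orbT.
- by apply: h; rewrite mem_cat !inE cy ?orbT.
Qed.

Section CoxeterLetters.
Variables (G : groupType) (W S : set G) (c : G).
Hypothesis pW : pointed_coxeter W S c.

Lemma pointed_letters : S `<=` NC W S c.
Proof.
move: pW => [cW [s [us sS ->]]] x Sx.
have [WS _ _] := cW; have S2 := @tr_S2 _ _ _ cW.
apply: letter_NC => //; [by rewrite sS | | by move: Sx; rewrite -sS].
have sR : [set` s] `<=` reflections W S by rewrite sS => y; exact: S_refl.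
apply/eqP; rewrite eqn_leq refl_length_le //=.
have [t [tR <- pt]] := refl_length_fact WS S2 (prod_W WS sR).
exact: (coxeter_refl_bound cW us sS tR).
Qed.
Lemma pointed_top : NC W S c c.
Proof.
move: pW => [cW [s [us sS E]]]; have [WS _ _] := cW; have S2 := @tr_S2 _ _ _ cW.
split; last by rewrite /abs_le mulVg refl_length1 // addn0.
  rewrite E; apply: subgroup_prodg (subW WS) _ => x xs; apply: (SW WS); by rewrite -sS.
by rewrite /abs_le refl_length1 // invg1 mul1g.
Qed.
Lemma pointed_subgroup_set : subgroup_set W.
Proof. by case: pW => [[WS _ _] _]; apply: (subW WS). Qed.
End CoxeterLetters.

(** * Roots, reflections and noncrossing partitions of a subobject *)

Section Subobject.
Variable C : cartan_lattice.
Notation posroot := (@posroot C).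
Notation posroots := (@posroots C).
Notation reflprod := (@reflprod C).
Notation hurwitz := (@hurwitz C).
Implicit Types (p q : mor_to C) (F X : seq C) (a b : C).

Definition simple_in p := weyl_map p @` simple_refl (mor_dom p).
Definition seq_in p : seq C := map (@pabs C) (map p (cl_seq (mor_dom p))).
Definition roots_in p : set C := [set p b | b in @real_root (mor_dom p)].

Lemma cl_real (C0 : cartan_lattice) (a : C0) : a \in cl_seq C0 -> real_root a.
Proof. by move=> h; exists 1%g, a; split=> //; exact: weyl1. Qed.
Lemma img_real p a : a \in map p (cl_seq (mor_dom p)) -> real_root a.
Proof. by move=> /mapP [b bE ->]; exact: clm_e_real. Qed.
Lemma seq_in_prs p : posroots (seq_in p).
Proof. by apply: posroots_pabs => a; exact: img_real. Qed.
Lemma size_seq_in p : size (seq_in p) = rk (mor_dom p).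
Proof. by rewrite !size_map. Qed.
Lemma cox_inE p : cox_in p = reflprod (map p (cl_seq (mor_dom p))).
Proof. by rewrite /cox_in weyl_map_rp // => a; exact: cl_real. Qed.
Lemma reflprod_seq_in p : reflprod (seq_in p) = cox_in p.
Proof. by rewrite cox_inE reflprod_pabs // => a; exact: img_real. Qed.
Lemma seq_in_fact p : exists X, cox_fact (seq_in p ++ X).
Proof. exact: real_exceptional_fact (clm_real p). Qed.
Lemma seq_in_nexc p : num_exc (seq_in p).
Proof. by have [X /cox_fact_nexc /num_exc_cat []] := seq_in_fact p. Qed.

Lemma roots_in_real p a : roots_in p a -> real_root a.
Proof. by case=> b rb <-; exact: weyl_map_real. Qed.
Lemma roots_inN p a : roots_in p a -> roots_in p (- a).
Proof. by case=> b rb <-; exists (- b); [exact: real_rootN | exact: clmN]. Qed.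
Lemma roots_in_refl p a b : is_root a -> roots_in p a -> roots_in p b -> roots_in p (refl a b).
Proof.
move=> ra [a' ra' E] [b' rb' <-]; exists (refl a' b'); first exact: refl_real.
by rewrite -E clm_refl //; [exact: real_root_root | rewrite E].
Qed.
Lemma seq_in_roots p a : a \in seq_in p -> roots_in p a.
Proof.
move=> /mapP [b /mapP [b' hb ->] ->].
have h : roots_in p (p b') by exists b' => //; exact: cl_real.
by have [->|->] := pabs_cases (p b') => //; exact: roots_inN.
Qed.

Lemma cox_in_bound p F : posroots F -> reflprod F = cox_in p -> (rk (mor_dom p) <= size F)%N.
Proof.
move=> pF rF; have [X [pS rS sS]] := seq_in_fact p.
have [_ pX] := (posroots_cat _ _).1 pS.
have [] := @cox_factorization_hurwitz C (F ++ X); first by apply/posroots_cat.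
  by rewrite -rS !reflprod_cat rF reflprod_seq_in.
by rewrite -sS !size_cat size_seq_in leq_add2r.
Qed.

(** Completed by the same tail X, both F and [seq_in p] give factorizations of [cox C], so Hurwitz
    moves make their members equal. The roots of p are stable under these moves in either
    direction. *)
Lemma cox_in_roots p F : posroots F -> reflprod F = cox_in p -> size F = rk (mor_dom p) ->
  forall a, a \in F -> roots_in p a.
Proof.
move=> pF rF sF; have [X fS] := seq_in_fact p.
have fF : cox_fact (F ++ X).
  case: fS => [pS rS sS]; have [_ pX] := (posroots_cat _ _).1 pS.
  split; first by apply/posroots_cat.
    by rewrite -rS !reflprod_cat rF reflprod_seq_in.
  by rewrite -sS !size_cat size_seq_in sF.
have [E [H [hE hH _ EH]]] := cox_fact_uniq fF fS.
apply/(hurwitz_closed (@roots_inN p) (@roots_in_refl p) hE) => a; rewrite EH; move: a.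
by apply/(hurwitz_closed (@roots_inN p) (@roots_in_refl p) hH) => a; exact: seq_in_roots.
Qed.

Lemma pointed_in p : pointed_coxeter (weyl_in p) (simple_in p) (cox_in p).
Proof.
have [cW eW] := pointed_coxeter_weyl (mor_dom p).
have hM := @weyl_mapM _ _ p; have hI := @weyl_map_inj _ _ p.
split; first exact: (coxeter_system_transfer cW hM hI).
exact: (coxeter_element_transfer cW hM hI).
Qed.
Lemma in_WS p : weyl_in p = gen_subgroup (simple_in p).
Proof. by have [[-> _ _] _] := pointed_in p. Qed.
Lemma in_S2 p s : simple_in p s -> (s * s)%g = 1%g.
Proof. by have [cW _] := pointed_in p; exact: (tr_S2 cW). Qed.
Lemma cox_in_W p : weyl_in p (cox_in p).
Proof. by have [] := pointed_top (pointed_in p). Qed.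

Lemma reflections_in p : reflections (weyl_in p) (simple_in p) = [set refl a | a in roots_in p].
Proof.
apply/seteqP; split=> [_ [_ [w Ww <-] [_ [_ [a /= aE <-] <-] <-]]|_ [_ [a ra <-] <-]].
  have ra := cl_real aE; exists (p (w a)); first by exists (w a) => //; exact: real_weyl.
  rewrite -weyl_map_phi // -refl_weyl_conj //; last exact: clm_e_real.
    by rewrite weyl_map_refl.
  exact: weyl_map_weyl.
case: ra => w [b [Ww bE ->]]; exists (weyl_map p w); first by exists w.
exists (weyl_map p (refl b)); first by exists (refl b) => //; exists b.
rewrite weyl_map_refl; last exact: cl_real.
rewrite refl_weyl_conj ?weyl_map_phi //; [exact: weyl_map_weyl | exact: clm_e_real].
Qed.

Lemma refl_list p (t : seq (zaut C)) : [set` t] `<=` reflections (weyl_in p) (simple_in p) <->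
  exists F, [/\ posroots F, forall a, a \in F -> roots_in p a & t = map (@refl C) F].
Proof.
rewrite reflections_in; split=> [|[F [pF rF ->]] _ /mapP [a aF ->]]; last by exists a => //; exact: rF.
elim: t => [|x t IH] h; first by exists [::].
have [|F [pF rF ->]] := IH; first by move=> y yt; apply: h; rewrite /= inE (yt : y \in t) orbT.
have [a ra <-] := h x (mem_head _ _); have rr := roots_in_real ra.
exists (pabs a :: F); split=> /=; last by rewrite refl_pabs.
  by apply/posroots_cons; split=> //; exact: pabs_pr.
move=> b; rewrite inE => /orP [/eqP ->|/rF //].
by have [->|->] := pabs_cases a => //; exact: roots_inN.
Qed.

Lemma refl_length_cox_in p : refl_length (weyl_in p) (simple_in p) (cox_in p) = rk (mor_dom p).
Proof.
apply/eqP; rewrite eqn_leq; apply/andP; split.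
  rewrite -reflprod_seq_in -size_seq_in /reflprod -(size_map (@refl C)).
  apply: refl_length_le; [exact: in_WS | exact: in_S2 |].
  by apply/refl_list; exists (seq_in p); split=> //; [exact: seq_in_prs | exact: seq_in_roots].
have [t [/refl_list [F [pF _ ->]] <- pt]] := refl_length_fact (in_WS p) (@in_S2 p) (cox_in_W p).
by rewrite size_map; exact: cox_in_bound.
Qed.

(** By [cox_in_roots] the factors belong to p automatically, so no condition on them remains. In
    this form the noncrossing partitions of different subobjects can be compared inside C. *)
Lemma NC_in p w : NC (weyl_in p) (simple_in p) (cox_in p) w <->
  exists F X, [/\ posroots (F ++ X), reflprod F = w, reflprod (F ++ X) = cox_in p & size (F ++ X) = rk (mor_dom p)].
Proof.
rewrite (NC_P (in_WS p) (@in_S2 p) _ (cox_in_W p)) refl_length_cox_in; split.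
  case=> _ [_ [/refl_list [F [pF rF ->]] /refl_list [X [pX rX ->]] wE pE sE]].
  exists F, X; split=> //; first by apply/posroots_cat.
    by rewrite /reflprod map_cat.
  by rewrite -sE !size_cat !size_map.
case=> F [X [pFX wE pE sE]]; have rFX := cox_in_roots pFX pE sE.
have [pF pX] := (posroots_cat _ _).1 pFX.
exists (map (@refl C) F), (map (@refl C) X); split=> //.
- by apply/refl_list; exists F; split=> // a aF; apply: rFX; rewrite mem_cat aF.
- by apply/refl_list; exists X; split=> // a aF; apply: rFX; rewrite mem_cat aF orbT.
- by rewrite -map_cat.
- by rewrite -map_cat size_map.
Qed.

Lemma weyl_in_sub p q : factors_through p q -> weyl_in p `<=` weyl_in q.
Proof.
case=> psi pE; rewrite in_WS; apply: gen_subgroup_min; first exact: subW (in_WS q).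
move=> _ [_ [a /= aE <-] <-]; rewrite weyl_map_refl; last exact: cl_real.
have ra : real_root (psi a) by exact: clm_e_real.
by rewrite pE -weyl_map_refl //; exists (refl (psi a)) => //; exact: refl_weyl.
Qed.

Lemma factors_ext p q : factors_through p q -> exists X, [/\ posroots X,
  reflprod (seq_in p ++ X) = cox_in q & size (seq_in p ++ X) = rk (mor_dom q)].
Proof.
case=> psi pE; have [X [pX rX sX]] := real_exceptional_fact (clm_real psi).
have [p1 p2] := (posroots_cat _ _).1 pX.
have rX' a : a \in map q X -> real_root a.
  by move=> /mapP [b bX ->]; apply: weyl_map_real; case: (p2 b bX).
exists (map (@pabs C) (map q X)); split; first exact: posroots_pabs.
  rewrite reflprod_cat reflprod_seq_in reflprod_pabs // /cox_in -rX weyl_map_rp; last by move=> a aF; case: (pX a aF).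
  rewrite map_cat reflprod_cat; congr (_ * _)%g; rewrite -/(cox_in p) cox_inE.
  rewrite -[RHS]weyl_map_rp; last by move=> a aF; case: (p1 a aF).
  rewrite reflprod_pabs; last by move=> _ /mapP [a aE ->]; exact: clm_e_real.
  rewrite weyl_map_rp; last by move=> _ /mapP [a aE ->]; exact: clm_e_real.
  by rewrite -map_comp; congr reflprod; apply: eq_map.
by rewrite -sX !size_cat !size_map.
Qed.

(** A minimal factorization of [cox_in p] extended by the tail X' is one of [cox_in q]; so its
    factors are reflections of q, and the lengths of p and q agree below [cox_in p]. Conversely a
    factorization of [cox_in p] of length [rk (mor_dom p)] in q is already one in p. *)
Lemma pointed_subgroup_in p q : factors_through p q ->
  pointed_subgroup (weyl_in p) (simple_in p) (cox_in p) (weyl_in q) (simple_in q) (cox_in q).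
Proof.
move=> pq; split; [exact: pointed_in | exact: weyl_in_sub |].
have [X' [pX' rX' sX']] := factors_ext pq.
have pSX : posroots (seq_in p ++ X') by apply/posroots_cat; split=> //; exact: seq_in_prs.
have rq := cox_in_roots pSX rX' sX'.
have lst F : posroots F -> (forall a, a \in F -> roots_in q a) ->
    [set` map (@refl C) F] `<=` reflections (weyl_in q) (simple_in q).
  by move=> pF rF; apply/refl_list; exists F.
have lp : refl_length (weyl_in q) (simple_in q) (cox_in p) = rk (mor_dom p).
  have [] := @fact_abs_le _ _ _ (in_WS q) (@in_S2 q) (map (@refl C) (seq_in p)) (map (@refl C) X').
  - by refine (lst _ (@seq_in_prs p) _) => a aS; apply: rq; rewrite mem_cat aS.
  - by refine (lst _ pX' _) => a aS; apply: rq; rewrite mem_cat aS orbT.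
  - by rewrite -map_cat size_map -/(reflprod _) rX' sX' refl_length_cox_in.
  by rewrite -/(reflprod _) reflprod_seq_in size_map size_seq_in.
apply/seteqP; split=> w.
  move=> /NC_in [F [X [pFX wE pE sE]]].
  have pFX' : posroots (F ++ X ++ X') by rewrite catA; apply/posroots_cat.
  have rFX' : reflprod (F ++ X ++ X') = cox_in q by rewrite catA reflprod_cat pE -rX' reflprod_cat reflprod_seq_in.
  have sFX' : size (F ++ X ++ X') = rk (mor_dom q) by rewrite catA size_cat sE -sX' size_cat size_seq_in.
  split; first by apply/NC_in; exists F, (X ++ X').
  have rr := cox_in_roots pFX' rFX' sFX'.
  have [pF pX] := (posroots_cat _ _).1 pFX.
  have [] := @fact_abs_le _ _ _ (in_WS q) (@in_S2 q) (map (@refl C) F) (map (@refl C) X).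
  - by refine (lst _ pF _) => a aS; apply: rr; rewrite mem_cat aS.
  - by refine (lst _ pX _) => a aS; apply: rr; rewrite !mem_cat aS orbT.
  - by rewrite -map_cat size_map -/(reflprod _) pE sE lp.
  by rewrite -map_cat -!/(reflprod _) wE pE.
case=> -[Ww _ _] wc.
have Wc : weyl_in q (cox_in p) by apply: (weyl_in_sub pq); exact: cox_in_W.
have [_ [_ [/refl_list [F [pF _ ->]] /refl_list [X [pX _ ->]] wE pE sE]]] :=
  abs_le_fact (in_WS q) (@in_S2 q) Ww Wc wc.
apply/NC_in; exists F, X; split=> //; first by apply/posroots_cat.
  by rewrite /reflprod map_cat.
by rewrite -lp -sE !size_cat !size_map.
Qed.
End Subobject.

Section Identity.
Variable C : cartan_lattice.
Lemma id_real : real_exceptional (map (@id C) (cl_seq C)).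
Proof.
exists (cl_seq C); split; [exact: cl_complete | exact: cl_real | by rewrite map_id].
Qed.
(** The whole lattice as one of its own subobjects: statements on a pair of subobjects then cover
    the comparison with W(C) itself. *)
Definition id_mor : cl_morphism C C := @CLMorphism C C id (fun _ _ => erefl) (fun _ _ => erefl) id_real.
Definition id_to : mor_to C := MorTo id_mor.
Lemma weyl_map_id w : weyl C w -> weyl_map id_mor w = w.
Proof. by move=> Ww; apply: zautP => x; exact: (weyl_map_phi id_mor x Ww). Qed.
Lemma weyl_map_id_img (A : set (zaut C)) : A `<=` weyl C -> weyl_map id_mor @` A = A.
Proof.
move=> h; apply/seteqP; split=> [_ [w /[dup] /h Ww Aw <-]|w Aw]; first by rewrite weyl_map_id.
by exists w => //; rewrite weyl_map_id //; exact: h.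
Qed.
Lemma weyl_in_id : weyl_in id_to = weyl C. Proof. exact: weyl_map_id_img. Qed.
Lemma simple_in_id : simple_in id_to = simple_refl C.
Proof. by apply: weyl_map_id_img; exact: (gen_subgroupP _).2. Qed.
Lemma cox_in_id : cox_in id_to = cox C.
Proof. by apply: weyl_map_id; rewrite cox_act; exact: weyl_act. Qed.
End Identity.

(** * The Coxeter element as a complete invariant of a subobject *)

Section Classes.
Variable C : cartan_lattice.
Notation posroots := (@posroots C).
Notation reflprod := (@reflprod C).
Implicit Types (p q : mor_to C).

Lemma factors_id p : factors_through p (id_to C).
Proof. by exists (mor_arrow p). Qed.

Lemma zspan_map (C1 C2 : cartan_lattice) (f : cl_morphism C1 C2) (F : seq C1) x :
  zspan F x -> zspan (map f F) (f x).
Proof.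
elim: F x => [|a F IH] x /=; first by move=> ->; exact: clm0.
by case=> k /IH h; exists k; rewrite -clmM -clmN -clm_add.
Qed.
Lemma zspan_img p (F : seq C) x : (forall a, a \in F -> exists y, p y = a) -> zspan F x -> exists y, p y = x.
Proof.
elim: F x => [|a F IH] x h /=; first by move=> ->; exists 0; exact: clm0.
case=> k /IH [b bF|y yE]; first by apply: h; rewrite inE bF orbT.
have [z zE] := h a (mem_head _ _); exists (y + z *~ k).
by rewrite clm_add clmM yE zE subrK.
Qed.
Lemma zspan_seq_in p x : zspan (seq_in p) x <-> exists y, p y = x.
Proof.
split=> [h|[y <-]]; last by apply/zspan_pabs/zspan_map/zspan_cl.
by apply: zspan_img h => a /seq_in_roots [b _ <-]; exists b.
Qed.

Lemma cox_in_eq p q : factors_through p q -> factors_through q p -> cox_in p = cox_in q.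
Proof.
move=> [f fE] [g gE]; rewrite -!reflprod_seq_in; apply: reflprod_span; try exact: seq_in_nexc.
move=> x; rewrite !zspan_seq_in; split=> -[y <-]; [by exists (f y); rewrite fE | by exists (g y); rewrite gE].
Qed.

Lemma rk_in_eq p q : cox_in p = cox_in q -> rk (mor_dom p) = rk (mor_dom q).
Proof.
move=> E; apply/eqP; rewrite eqn_leq -{2}size_seq_in -{1}size_seq_in.
by rewrite !size_seq_in; apply/andP; split; [rewrite -(size_seq_in q) | rewrite -(size_seq_in p)];
  apply: cox_in_bound; rewrite ?reflprod_seq_in //; exact: seq_in_prs.
Qed.

(** Equal Coxeter elements force equal roots of the sequences up to membership in the other
    subobject, so p and q have the same image in C. The map with p after f equal to q is an
    isometry, and it carries the simple roots of q to a complete exceptional sequence of real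
    roots. *)
Lemma cox_in_factors p q : cox_in p = cox_in q -> factors_through q p.
Proof.
move=> E; have rE := rk_in_eq E.
have qp : forall a, a \in seq_in q -> roots_in p a.
  by apply: cox_in_roots; rewrite ?reflprod_seq_in ?size_seq_in //; exact: seq_in_prs.
have pq : forall a, a \in seq_in p -> roots_in q a.
  by apply: cox_in_roots; rewrite ?reflprod_seq_in ?size_seq_in //; exact: seq_in_prs.
have imq x : exists y, p y = q x.
  apply: (@zspan_img p (seq_in q)); last by apply/zspan_seq_in; exists x.
  by move=> a /qp [b _ <-]; exists b.
have imp x : exists y, q y = p x.
  apply: (@zspan_img q (seq_in p)); last by apply/zspan_seq_in; exists x.
  by move=> a /pq [b _ <-]; exists b.
have [f fE] := choice imq.
have fD : {morph f : x y / x + y} by move=> x y; apply: (@clm_inj _ _ p); rewrite clm_add !fE clm_add.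
have fB x y : bform (f x) (f y) = bform x y by rewrite -(clm_form p) !fE clm_form.
have fR a : a \in cl_seq (mor_dom q) -> real_root (f a).
  move=> aE; have : roots_in p (q a).
    have h : pabs (q a) \in seq_in q by apply/map_f/map_f.
    have [{}E|{}E] := pabs_cases (q a); have := qp _ h; rewrite E // => /roots_inN.
    by rewrite opprK.
  by case=> b rb; rewrite -fE => /(@clm_inj _ _ p) <-.
pose F := map f (cl_seq (mor_dom q)).
have cF : complete_exceptional F.
  have [[_ tri] _] := cl_complete (mor_dom q).
  split; first split.
  - by move=> _ /mapP [a aE ->]; apply/real_root_root/fR.
  - move=> i j; rewrite size_map => ij; have /andP [ji hi] := ij.
    by rewrite !(nth_map 0) ?fB ?tri //; exact: ltn_trans hi.
  move=> x; apply/int_span; have [y yE] := imp x.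
  have -> : x = f y by apply: (@clm_inj _ _ p); rewrite fE.
  have f0 : f 0 = 0 by apply: (addIr (f 0)); rewrite -fD !add0r.
  have fN z : f (- z) = - f z by apply: (addIr (f z)); rewrite -fD !addNr f0.
  have fM z k : f (z *~ k) = f z *~ k.
    elim/int_rect: k => [|n IH|n IH]; first by rewrite !mulr0z f0.
      by rewrite intS !mulrzDr fD IH.
    by rewrite intS opprD !mulrzDr fD IH !mulrN1z fN.
  rewrite /F; elim: (cl_seq _) y (zspan_cl y) {yE} => [|a s IH] y /=; first by move=> ->.
  by case=> k /IH h; exists k; rewrite -fM -fN -fD.
have rF : real_exceptional F.
  by exists F; split=> // _ /mapP [a aE ->]; exact: fR.
by exists (CLMorphism fD fB rF) => x /=; rewrite fE.
Qed.
End Classes.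

(** * The Cartan lattice spanned by an orthogonal exceptional sequence *)

Section SubLattice.
Variable C : cartan_lattice.
Variable E : seq C.
Hypotheses (nE : num_exc E) (oE : orth E).
Let r := size E.
(** The span of E is modelled on integral row vectors, with the form pulled back along this map;
    triangularity makes the pulled-back form non-degenerate on both sides. *)
Definition iota (x : 'rV[int]_r) : C := \sum_(i < r) E`_i *~ x 0 i.
Lemma iotaD x y : iota (x + y) = iota x + iota y.
Proof. by rewrite /iota -big_split; apply: eq_bigr => i _ /=; rewrite mxE mulrzDr. Qed.
Lemma iota_delta i : iota (delta_mx 0 i) = E`_i.
Proof.
rewrite /iota (bigD1 i) //= mxE !eqxx mulr1z big1 ?addr0 // => j ji.
by rewrite mxE eqxx /= (negPf ji) mulr0z.
Qed.
Definition sform x y := bform (iota x) (iota y).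
Lemma sformDl x y z : sform (x + y) z = sform x z + sform y z.
Proof. by rewrite /sform iotaD bformDl. Qed.
Lemma sformDr x y z : sform x (y + z) = sform x y + sform x z.
Proof. by rewrite /sform iotaD bformDr. Qed.
Lemma Epos (i : 'I_r) : bform E`_i E`_i != 0.
Proof. by have [/(_ _ (mem_nth 0 (ltn_ord i))) [/lt0r_neq0]] := nE. Qed.
Lemma sform_ndr y : (forall x, sform x y = 0) -> y = 0.
Proof.
move=> h; apply/rowP => i; rewrite mxE.
pose c k := if insub k is Some j then y 0 (j : 'I_r) else 0.
have cE : iota y = \sum_(i < size E) E`_i *~ c i by apply: eq_bigr => j _; rewrite /c valK.
have : c i = 0.
  apply: (num_exc_free nE) => // k hk.
  by rewrite -cE -(iota_delta (Ordinal hk)); exact: h.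
by rewrite /c valK.
Qed.
Lemma sform_ndl x : (forall y, sform x y = 0) -> x = 0.
Proof.
move=> h; apply/rowP; suff H k (i : 'I_r) : (i < k)%N -> x 0 i = 0.
  by move=> i; rewrite (H i.+1) // mxE.
elim: k i => [//|k IH] i ik; have := h (delta_mx 0 i).
rewrite /sform iota_delta /iota bform_suml (bigD1 i) //= big1 ?addr0 => [|j ji].
  by rewrite bformMzl => /eqP; rewrite mulf_eq0 (negPf (Epos i)) orbF => /eqP.
rewrite bformMzl; have [lt|lt|/val_inj eq] := ltngtP j i; last by rewrite eq eqxx in ji.
  by rewrite IH ?mul0r //; exact: leq_trans lt _.
by have [_ ->] := nE; rewrite ?mulr0 // lt ltn_ord.
Qed.
Definition slattice := BilinearLattice sformDl sformDr sform_ndl sform_ndr.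
Definition sseq : seq slattice := [seq delta_mx 0 i : 'rV[int]_r | i <- enum 'I_r].
Lemma size_sseq : size sseq = r. Proof. by rewrite size_map size_enum_ord. Qed.
Lemma iota_sseq : map iota sseq = E.
Proof.
rewrite -map_comp (eq_map (g := fun i : 'I_r => E`_i)); last exact: iota_delta.
by rewrite -[RHS](mkseq_nth 0) /mkseq -val_enum_ord -map_comp.
Qed.
Lemma iota_nth i : (i < r)%N -> iota sseq`_i = E`_i.
Proof. by move=> hi; have := nth_map 0 0 iota (s := sseq) (n := i); rewrite iota_sseq size_sseq => ->. Qed.
Lemma sseq_complete : complete_exceptional sseq.
Proof.
split; first split.
- move=> _ /mapP [i _ ->]; have [/(_ _ (mem_nth 0 (ltn_ord i))) [h1 h2] _] := nE.
  split; rewrite /= /sform iota_delta // => x; exact: h2.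
- move=> i j; rewrite size_sseq => ij; have /andP [ji hi] := ij.
  rewrite /= /sform !iota_nth //; last exact: ltn_trans hi.
  by have [_ ->] := nE.
move=> x; have sr := size_sseq.
exists [ffun i => (x : 'rV[int]_r) 0 (cast_ord sr i)].
rewrite {1}[x](row_sum_delta (x : 'rV[int]_r)).
rewrite (reindex (cast_ord sr)) /=; last by exists (cast_ord (esym sr)) => k _; rewrite ?cast_ordK ?cast_ordKV.
apply: eq_bigr => i _; rewrite ffunE -[X in X *: _]intz scaler_int.
have ir : (i < r)%N := ltn_ord (cast_ord sr i).
congr (_ *~ _); rewrite (nth_map (cast_ord sr i)) ?size_enum_ord //.
by congr delta_mx; apply: val_inj; rewrite /= nth_enum_ord.
Qed.
Lemma sseq_orth : orthogonal_seq sseq.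
Proof.
by move=> i j; rewrite size_sseq => hi hj ij; rewrite /= /sform !iota_nth //; exact: oE.
Qed.
Definition scartan := CartanLattice sseq_complete sseq_orth.

Lemma sub_mor : real_exceptional E -> exists p : mor_to C, map p (cl_seq (mor_dom p)) = E.
Proof.
move=> h; have h' : real_exceptional (map iota (cl_seq scartan)) by rewrite iota_sseq.
by exists (MorTo (@CLMorphism scartan C iota iotaD (fun _ _ => erefl) h')); exact: iota_sseq.
Qed.
End SubLattice.

(** * The bijection between subobjects and subgroups *)

Section Bijection.
Variable C : cartan_lattice.
Notation pcs := (pc_subgroup (weyl C) (simple_refl C) (cox C)).
Implicit Types (p q : mor_to C).

Lemma pointed_subgroup_top p :
  pointed_subgroup (weyl_in p) (simple_in p) (cox_in p) (weyl C) (simple_refl C) (cox C).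
Proof.
have := pointed_subgroup_in (factors_id p).
by rewrite weyl_in_id simple_in_id cox_in_id.
Qed.

Lemma cox_in_surj c : NC (weyl C) (simple_refl C) (cox C) c -> exists p, cox_in p = c.
Proof.
rewrite -weyl_in_id -simple_in_id -cox_in_id => /NC_in [F [X [pF <- rF sF]]].
have fF : cox_fact (F ++ X) by split=> //; rewrite rF cox_in_id.
have [E [hE oE]] := cox_fact_orth fF.
have fE := cox_fact_hurw (hurwitz_catr X hE) fF.
have nEX := cox_fact_nexc fE; have [nE _ _] := (num_exc_cat _ _).1 nEX.
have rE : real_exceptional E.
  exists (E ++ X); split; last exact: prefix_subseq.
    by split=> // x; apply/int_span; exact: cox_fact_spn.
  by case: fE => pE _ _ a aE; case: (pE a aE).
have [p pE] := sub_mor nE oE rE.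
by exists p; rewrite cox_inE pE (hurwitz_rp hE).
Qed.

Lemma pcs_eq (x y : pcs) : pcs_group x = pcs_group y -> pcs_cox x = pcs_cox y -> x = y.
Proof.
case: x y => [W1 c1 h1] [W2 c2 h2] /= E1 E2; subst W2 c2.
by congr PCSubgroup; exact: Prop_irrelevance.
Qed.

Lemma weyl_in_surj (x : pcs) : exists p, weyl_in p = pcs_group x /\ cox_in p = pcs_cox x.
Proof.
case: x => W' c' /= [S' [pW sW eW]].
have [p pE] : exists p, cox_in p = c'.
  by apply: cox_in_surj; have := pointed_top pW; rewrite eW => -[].
exists p; split=> //.
have [pp _ ep] := pointed_subgroup_top p.
have EE : NC W' S' c' = NC (weyl_in p) (simple_in p) (cox_in p) by rewrite eW ep pE.
apply/seteqP; split.
  rewrite in_WS; apply: gen_subgroup_min; first exact: pointed_subgroup_set pW.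
  by move=> s /(pointed_letters pp); rewrite -EE => -[].
have [[-> _ _] _] := pW; apply: gen_subgroup_min; first exact: pointed_subgroup_set pp.
by move=> s /(pointed_letters pW); rewrite EE => -[].
Qed.

Definition pcs_of p : pcs := PCSubgroup (ex_intro _ (simple_in p) (pointed_subgroup_top p)).
(** Classes have no canonical representative. The choice is harmless, since [cox_in] is constant on
    a class and determines both the class and the group [weyl_in]. *)
Definition sub_rep (X : subobject C) : mor_to C := sval (cid (sub_memP X)).

Lemma sub_classE p q : sub_class p q <-> cox_in p = cox_in q.
Proof.
split=> [[h1 h2]|h]; first exact: cox_in_eq.
by split; apply: cox_in_factors.
Qed.
Lemma sub_repP (X : subobject C) q : Defs.sub_mem X q <-> cox_in (sub_rep X) = cox_in q.
Proof. by rewrite /sub_rep; case: cid => p /= ->; exact: sub_classE. Qed.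
Lemma sub_rep_of p : cox_in (sub_rep (subobject_of p)) = cox_in p.
Proof. by apply/sub_repP/sub_classE. Qed.
Lemma weyl_in_cox p q : cox_in p = cox_in q -> weyl_in p = weyl_in q.
Proof.
by move=> h; apply/seteqP; split; apply: weyl_in_sub; apply: cox_in_factors.
Qed.
Lemma subobject_eq (X Y : subobject C) : cox_in (sub_rep X) = cox_in (sub_rep Y) -> X = Y.
Proof.
move=> h; have E : Defs.sub_mem X = Defs.sub_mem Y.
  by apply/funext => q; apply/propext; rewrite !sub_repP h.
case: X Y E {h} => [m1 h1] [m2 h2] /= E; subst m2.
by congr Subobject; exact: Prop_irrelevance.
Qed.
End Bijection.

Theorem corollary5p8 (C : cartan_lattice) :
  pointed_coxeter (weyl C) (simple_refl C) (cox C) /\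
  exists F : subobject C -> pc_subgroup (weyl C) (simple_refl C) (cox C),
    [/\ forall p : mor_to C,
          pcs_group (F (subobject_of p)) = weyl_in p /\
          pcs_cox (F (subobject_of p)) = cox_in p,
        bijective F
      & forall X Y : subobject C,
          subobject_le X Y -> pc_subgroup_le (F X) (F Y)].
Proof.
split; first exact: pointed_coxeter_weyl.
pose F (X : subobject C) := pcs_of (sub_rep X).
have FE p : pcs_group (F (subobject_of p)) = weyl_in p /\ pcs_cox (F (subobject_of p)) = cox_in p.
  by split; [apply: weyl_in_cox|]; exact: sub_rep_of.
exists F; split=> //.
  (* The Coxeter element alone already separates subobjects. *)
  have Finj X Y : F X = F Y -> X = Y.
    by move=> /(congr1 (@pcs_cox _ _ _ _)) h; exact: subobject_eq.
  have Fsurj y : exists X, F X = y.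
    have [p [h1 h2]] := weyl_in_surj y; exists (subobject_of p).
    by have [e1 e2] := FE p; apply: pcs_eq; rewrite ?e1 ?e2.
  have [g gP] := choice Fsurj.
  by exists g => // X; apply: Finj; rewrite gP.
move=> _ _ [p [q [-> -> pq]]].
have [e1 e2] := FE p; have [e3 e4] := FE q.
exists (simple_in p), (simple_in q); rewrite e1 e2 e3 e4.
by split; [exact: pointed_subgroup_top | exact: pointed_subgroup_top | exact: pointed_subgroup_in].
Qed.
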